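(* (Multiterm maximum principle, weak solutions.) Let $T>0$, let $\ell$ be a positive integer, $0<\alpha_\ell<\dots<\alpha_2<\alpha_1<1$, and let $q_i:[0,T]\to\mathbb{R}$ satisfy $q_i(t)\ge0$, $i=1,\dots,\ell$, and $\sum_{i=1}^\ell q_i(t)\ge C_q>0$ for all $t\in[0,T]$. Let $\Omega\subset\mathbb{R}^d$, $d\in\{1,2,3\}$, be a bounded Lipschitz domain, and let $\mathcal{L}u:=-\sum_{i,j=1}^d\partial_{x_i}(a_{ij}(x,t)\,\partial_{x_j}u)+\sum_{i=1}^d b_i(x,t)\,\partial_{x_i}u$ with symmetric positive definite $\{a_{ij}(x,t)\}$, with coefficients in $L_\infty(\Omega\times(0,T))$, and with $C_{\mathcal{L}}:=\sup_{\Omega\times(0,T)}\frac{\sum_{i=1}^d b_i^2}{4\lambda_a}<\infty$, where $\lambda_a=\lambda_a(x,t)>0$ is the minimal eigenvalue of $\{a_{ij}(x,t)\}$. Let $\inf_{\Omega\times(0,T)}c\ge-\lambda$ for some constant $\lambda\ge0$. Suppose that $u(\cdot,0)\le0$ in $\Omega$ and $u(\cdot,t)\le0$ on $\partial\Omega$ for any $t\in[0,T]$, and also that $u\in C([0,T];L_\infty(\Omega))\cap W^{1,\infty}(\epsilon,t;L_\infty(\Omega))$ for any $0<\epsilon<t\le T$, while $u(\cdot,t)\in H^1(\Omega)$ for any $t\in(0,T]$. Then $$\Bigl(\sum_{i=1}^\ell q_i(t)\,D_t^{\alpha_i}+\mathcal{L}+c\Bigr)u\le0,$$ understood in the weak sense,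 implies $\sup_\Omega u(\cdot,t)\le0$ for all $t\in[0,T]$.
   Context: For $\alpha\in(0,1)$, $D_t^\alpha u(\cdot,t):=\frac{1}{\Gamma(1-\alpha)}\int_0^t(t-s)^{-\alpha}\,\partial_s u(\cdot,s)\,ds$, $t>0$ (Caputo derivative), the integral being understood as $\lim_{\epsilon\to0^+}\int_\epsilon^t$ in $L_\infty(\Omega)$, which exists for $u$ of the stated regularity. $\langle\cdot,\cdot\rangle$ is the $L_2(\Omega)$ inner product; $w^+:=\max\{0,w\}$; inequalities, suprema and infima for $L_\infty$ functions are essential in $x$. The coefficients are regarded as functions defined for every fixed $t\in(0,T]$: for each such $t$, $a_{ij}(\cdot,t),b_i(\cdot,t)\in L_\infty(\Omega)$, and $\sum_i b_i^2\le4\lambda_aC_{\mathcal{L}}$ and $c\ge-\lambda$ hold a.e. in $\Omega$. $w\in H^1(\Omega)$ satisfies $w\le0$ on $\partial\Omega$ if $w^+\in H^1_0(\Omega)$ (automatic at $t=0$ from $u(\cdot,0)\le0$). The weak inequality means: for every $t\in(0,T]$ and every nonnegative $\chi\in H^1_0(\Omega)$, $\langle(\sum_i q_i(t)D_t^{\alpha_i}+\mathcal{L}+c)u,\chi\rangle\le0$ at time $t$, where $\langle\mathcal{L}u,\chi\rangle:=\sum_{i,j}\int_\Omega a_{ij}(\partial_{x_j}u)(\partial_{x_i}\chi)+\sum_i\int_\Omega b_i(\partial_{x_i}u)\chi$ and all pairings (in particular $\langle cu,\chi\rangle$) are assumed to be well defined. *)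

(* Defs.v *)
From HB Require Import structures.
From mathcomp Require Import all_boot all_order all_algebra.
From mathcomp Require Import all_classical all_reals all_analysis.
From mathcomp Require Import ess_sup_inf.

Set Implicit Arguments.
Unset Strict Implicit.
Unset Printing Implicit Defensive.

Import Order.TTheory GRing.Theory Num.Theory.
Import numFieldNormedType.Exports.

Local Open Scope classical_set_scope.
Local Open Scope ring_scope.

(* The sigma-algebra generated by the coordinates, i.e. the Borel one. *)
Section measurable_rV.
Context (R : realType) (n : nat).

Definition rV_coord (i : 'I_n) (x : 'rV[R]_n) : measurableTypeR R := x ord0 i.

Let rV_set0 : g_sigma_preimage rV_coord set0.
Proof. exact: sigma_algebra0. Qed.

Let rV_setC A : g_sigma_preimage rV_coord A -> g_sigma_preimage rV_coord (~` A).
Proof. exact: sigma_algebraC. Qed.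

Let rV_bigcup (F : _^nat) : (forall i, g_sigma_preimage rV_coord (F i)) ->
  g_sigma_preimage rV_coord (\bigcup_i (F i)).
Proof. exact: sigma_algebra_bigcup. Qed.

HB.instance Definition _ := @isMeasurable.Build default_measure_display
  'rV[R]_n (g_sigma_preimage rV_coord) rV_set0 rV_setC rV_bigcup.

End measurable_rV.

Section measurable_rV_theory.
Context (R : realType).

Lemma measurable_rV_coord n (i : 'I_n) :
  measurable_fun [set: 'rV[R]_n] (rV_coord i).
Proof.
move=> _ Y mY; rewrite setTI; apply: sub_sigma_algebra => /=.
rewrite -bigcup_seq/=; exists i => /=; first by rewrite mem_index_enum.
by exists Y => //; rewrite setTI.
Qed.

Lemma measurable_fun_rVP d (T : measurableType d) n (f : T -> 'rV[R]_n) :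
  (forall i, measurable_fun [set: T] (rV_coord i \o f)) ->
  measurable_fun [set: T] f.
Proof.
move=> mf _ A mA; rewrite setTI.
suff /(_ A mA) : (@measurable _ 'rV[R]_n) `<=` [set B | measurable (f @^-1` B)].
  by [].
apply: smallest_sub.
  split => /=; first by rewrite preimage_set0.
    by move=> B mB; rewrite setTD -preimage_setC; exact: measurableC.
  by move=> F mF; rewrite preimage_bigcup; exact: bigcup_measurable.
rewrite -bigcup_seq => B [i _ [Y mY <-]] /=.
by rewrite setTI -comp_preimage -[X in measurable X]setTI; exact: mf.
Qed.

Definition rV_cons n (p : measurableTypeR R * 'rV[R]_n) : 'rV[R]_n.+1 :=
  \row_j if unlift ord0 j is Some k then p.2 ord0 k else p.1.

Definition rV_uncons n (x : 'rV[R]_n.+1) : measurableTypeR R * 'rV[R]_n :=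
  (x ord0 ord0, \row_j x ord0 (lift ord0 j)).

Lemma rV_cons0 n (p : measurableTypeR R * 'rV[R]_n) :
  rV_cons p ord0 ord0 = p.1.
Proof.
by rewrite mxE unlift_none.
Qed.

Lemma rV_consS n (p : measurableTypeR R * 'rV[R]_n) j :
  rV_cons p ord0 (lift ord0 j) = p.2 ord0 j.
Proof.
by rewrite mxE liftK.
Qed.

Lemma rV_consK n : cancel (@rV_cons n) (@rV_uncons n).
Proof.
move=> p; rewrite /rV_uncons rV_cons0 [RHS]surjective_pairing; congr pair.
by apply/rowP => j; rewrite mxE rV_consS.
Qed.

Lemma measurable_rV_cons n : measurable_fun setT (@rV_cons n).
Proof.
apply: measurable_fun_rVP => i; have [j ->|->] := unliftP ord0 i.
  rewrite (_ : _ \o _ = rV_coord j \o snd); last first.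
    by apply/funext => p /=; rewrite /rV_coord rV_consS.
  by apply: measurableT_comp => //; exact: measurable_rV_coord.
rewrite (_ : _ \o _ = fst)//.
by apply/funext => p /=; rewrite /rV_coord rV_cons0.
Qed.

Lemma measurable_rV_uncons n : measurable_fun setT (@rV_uncons n).
Proof.
apply/measurable_fun_pairP; split; first exact: measurable_rV_coord.
apply: measurable_fun_rVP => j.
rewrite (_ : _ \o _ = rV_coord (lift ord0 j)).
  exact: measurable_rV_coord.
by apply/funext => x /=; rewrite /rV_coord mxE.
Qed.

End measurable_rV_theory.

Section lebesgue_rVS.
Context (R : realType) (n : nat) (m : {sigma_finite_measure set 'rV[R]_n -> \bar R}).

Let prod : {measure set (measurableTypeR R * 'rV[R]_n)%type -> \bar R} :=
  (@lebesgue_measure R \x m)%E.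

Definition lebesgue_rVS : set 'rV[R]_n.+1 -> \bar R :=
  fun A => (lebesgue_measure \x m)%E (@rV_cons R n @^-1` A).

Let mpre A : measurable A -> measurable (@rV_cons R n @^-1` A).
Proof. by move=> mA; rewrite -[X in measurable X]setTI; exact: measurable_rV_cons. Qed.

Let lebesgue_rVS0 : lebesgue_rVS set0 = 0%E.
Proof. by rewrite /lebesgue_rVS preimage_set0; exact: (measure0 prod). Qed.

Let lebesgue_rVS_ge0 A : (0 <= lebesgue_rVS A)%E.
Proof. exact: (measure_ge0 prod). Qed.

Let lebesgue_rVS_sigma_additive : semi_sigma_additive lebesgue_rVS.
Proof.
move=> F mF tF mUF; rewrite /lebesgue_rVS preimage_bigcup.
apply: (@measure_semi_sigma_additive _ _ _ prod).
- by move=> k; exact: mpre.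
- apply/trivIsetP => /= i j _ _ ij; rewrite -preimage_setI.
  by move/trivIsetP : tF => /(_ _ _ _ _ ij) ->//; rewrite preimage_set0.
- by rewrite -preimage_bigcup; exact: mpre.
Qed.

HB.instance Definition _ := isMeasure.Build _ _ _ lebesgue_rVS
  lebesgue_rVS0 lebesgue_rVS_ge0 lebesgue_rVS_sigma_additive.

Let lebesgue_rVS_sigma_finite : sigma_finite setT lebesgue_rVS.
Proof.
have /sigma_finiteP[F [TF ndF Foo]] := sigma_finiteT (@lebesgue_measure R).
have /sigma_finiteP[G [TG ndG Goo]] := sigma_finiteT m.
exists (fun k => @rV_uncons R n @^-1` (F k `*` G k)).
  rewrite -preimage_bigcup -[LHS](preimage_setT (@rV_uncons R n)).
  congr (_ @^-1` _); rewrite -setXTT TF TG predeqE => -[x y]; split.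
    move=> [/= [i _ Fix] [j _ Gjy]]; exists (maxn i j) => //; split.
    - by move: x Fix; exact/subsetPset/ndF/leq_maxl.
    - by move: y Gjy; exact/subsetPset/ndG/leq_maxr.
  by move=> [i _ []/= ? ?]; split; exists i.
move=> k; have [mFk Fk] := Foo k; have [mGk Gk] := Goo k; split.
  by rewrite -[X in measurable X]setTI; apply: measurable_rV_uncons => //;
    exact: measurableX.
have consK : @rV_uncons R n \o @rV_cons R n = id.
  by apply/funext => p; exact: rV_consK.
by rewrite /lebesgue_rVS -comp_preimage consK product_measure1E// lte_mul_pinfty// ge0_fin_numE.
Qed.

HB.instance Definition _ := Measure_isSigmaFinite.Build _ _ _ lebesgue_rVS
  lebesgue_rVS_sigma_finite.

End lebesgue_rVS.

(* Iterated product of the one-dimensional Lebesgue measure. *)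
Fixpoint lebesgue_rV (R : realType) (n : nat) :
    {sigma_finite_measure set 'rV[R]_n -> \bar R} :=
  match n with
  | 0 => \d_(0 : 'rV[R]_0)
  | n'.+1 => lebesgue_rVS (lebesgue_rV R n')
  end.

Lemma measurable_rV_box (R : realType) n (A : 'I_n -> set (measurableTypeR R)) :
  (forall i, measurable (A i)) ->
  measurable [set x : 'rV[R]_n | forall i, A i (x ord0 i)].
Proof.
move=> mA.
rewrite (_ : [set x | _] = \big[setI/setT]_(i < n) (rV_coord i @^-1` A i)); last first.
  rewrite -bigcap_seq; apply/seteqP; split=> x /= H i; first by move=> _; exact: H.
  by apply: H; rewrite /= mem_index_enum.
apply: bigsetI_measurable =>
  i _; rewrite -[X in measurable X]setTI; exact: measurable_rV_coord.
Qed.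

Lemma lebesgue_rV_box (R : realType) n (A : 'I_n -> set (measurableTypeR R)) :
  (forall i, measurable (A i)) ->
  lebesgue_rV R n [set x : 'rV[R]_n | forall i, A i (x ord0 i)] =
  (\prod_(i < n) lebesgue_measure (A i))%E.
Proof.
move=> mA; elim: n A mA => [|n IH] A mA.
  rewrite big_ord0 /= diracE mem_set//= => -[]//.
rewrite big_ord_recl -(IH (fun i => A (lift ord0 i)))//.
have -> : lebesgue_rV R n.+1 [set x : 'rV[R]_n.+1 | forall i, A i (x ord0 i)] =
    (lebesgue_measure \x lebesgue_rV R n)%E
      (A ord0 `*` [set x : 'rV[R]_n | forall i, A (lift ord0 i) (x ord0 i)]).
  rewrite /= /lebesgue_rVS; congr (product_measure1 _ _ _).
  rewrite eqEsubset; split => -[p1 p2] /=.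
    move=> H; split => [|i]; first by have := H ord0; rewrite rV_cons0.
    by have := H (lift ord0 i); rewrite rV_consS.
  move=> [H1 H2] i.
  by have [j ->|->] := unliftP ord0 i; rewrite ?rV_consS ?rV_cons0.
rewrite product_measure1E//.
exact: (@measurable_rV_box _ _ (fun i => A (lift ord0 i))).
Qed.

Section Lp_on.
Context d (T : measurableType d) (R : realType).
Variable mu : {measure set T -> \bar R}.
Implicit Types (D : set T) (p : \bar R) (f : T -> R).

(* [f] belongs to L_p(D): its extension by 0 belongs to L_p of the whole
   space; elements of L_p(D) are represented by Borel functions. *)
Definition Lp_on D p f := (f \_ D) \in Lfun mu p.

Definition Lnorm_on D p f : \bar R := 'N[mu]_p[EFin \o (f \_ D)]%E.

Definition ess_sup_on D f : \bar R :=
  ess_sup mu (fun x => if x \in D then (f x)%:E else -oo%E).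

Definition ess_inf_on D f : \bar R :=
  ess_inf mu (fun x => if x \in D then (f x)%:E else +oo%E).

End Lp_on.

(* On a finite-dimensional [V], continuity of all the iterated directional
   derivatives of order at most [k] is the usual C^k. *)
Fixpoint Ck (R : realType) (V : normedModType R) (k : nat) (f : V -> R) : Prop :=
  match k with
  | 0 => continuous f
  | k'.+1 => (forall x v, derivable f x v) /\ forall v, Ck k' (fun x => 'D_v f x)
  end.

Definition test_function (R : realType) (V : normedModType R) (U : set V)
    (phi : V -> R) :=
  (forall k, Ck k phi) /\
  exists K : set V, [/\ compact K, K `<=` U & forall x, ~ K x -> phi x = 0].

Section space.
Context (R : realType) (d : nat).
Implicit Types (x y nu : 'rV[R]_d) (Omega : set 'rV[R]_d).

Definition dotv x y : R := \sum_(i < d) x ord0 i * y ord0 i.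

(* Near each boundary point, [Omega] is the region strictly above the graph,
   in the direction of a unit vector [nu], of a Lipschitz function [g] of the
   component orthogonal to [nu]; only the values of [g] on the hyperplane
   orthogonal to [nu] matter. *)
Definition bounded_Lipschitz_domain Omega :=
  [/\ open Omega, connected Omega, Omega !=set0, bounded_set Omega &
   forall x0, (closure Omega `\` Omega) x0 ->
     exists (nu : 'rV[R]_d) (g : 'rV[R]_d -> R) (k r : R),
       [/\ dotv nu nu = 1, k.-lipschitz g, 0 < r &
        forall y, ball x0 r y ->
          (Omega y <-> g (y - dotv y nu *: nu) < dotv y nu)]].

(* Only meaningful for matrices with real spectrum, such as symmetric ones. *)
Definition min_eigenvalue (A : 'M[R]_d) : R := inf [set l | eigenvalue A l].

Definition sym_pos_def (A : 'M[R]_d) :=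
  A^T = A /\ forall xi : 'rV[R]_d, xi != 0 -> 0 < (xi *m A *m xi^T) ord0 ord0.

End space.

Section Sobolev.
Context (R : realType) (d : nat).
Variable Omega : set 'rV[R]_d.
Local Notation mu := (lebesgue_rV R d).
Implicit Types (w chi : 'rV[R]_d -> R) (G : 'I_d -> 'rV[R]_d -> R).

Definition partial (i : 'I_d) (phi : 'rV[R]_d -> R) : 'rV[R]_d -> R :=
  fun x => 'D_(delta_mx ord0 i) phi x.

Definition is_weak_gradient w G :=
  (forall i, Lp_on mu Omega 2%:E (G i)) /\
  forall i phi, test_function Omega phi ->
    \int[mu]_(x in Omega) (w x * partial i phi x) =
    - \int[mu]_(x in Omega) (G i x * phi x).

Definition H1 w := Lp_on mu Omega 2%:E w /\ exists G, is_weak_gradient w G.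

(* The closure of the test functions in H^1. *)
Definition H10 w :=
  Lp_on mu Omega 2%:E w /\
  exists G, is_weak_gradient w G /\
  exists phi : nat -> 'rV[R]_d -> R,
    [/\ forall n, test_function Omega (phi n),
     Lnorm_on mu Omega 2%:E (w \- phi n) @[n --> \oo] --> 0%E &
     forall i, Lnorm_on mu Omega 2%:E (G i \- partial i (phi n))
       @[n --> \oo] --> 0%E].

Definition inner w chi : R := \int[mu]_(x in Omega) (w x * chi x).

Definition le0_on_boundary w := H10 (fun x => Num.max 0 (w x)).

End Sobolev.

Section Bochner.
Context (R : realType) (d : nat).
Variable Omega : set 'rV[R]_d.
Local Notation mu := (lebesgue_rV R d).
Local Notation leb := (@lebesgue_measure R).
Local Notation E := ('rV[R]_d -> R).
Local Notation Linf := (Lp_on mu Omega +oo%E).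
Local Notation "'N f" := (Lnorm_on mu Omega +oo%E f) (at level 10, f at level 8).
Implicit Types (a b t eps : R) (f u v : R -> E) (w : E).

(* sum over [k < step_size] of (indicator of [step_set k]) times [step_val k] *)
Record step_fun := StepFun {
  step_size : nat ;
  step_set : 'I_step_size -> set R ;
  step_val : 'I_step_size -> E ;
  step_measurable : forall k, measurable (step_set k) ;
  step_Linf : forall k, Linf (step_val k) }.

Definition step_eval (s : step_fun) (t : R) : E := fun x =>
  \sum_(k < step_size s) \1_(step_set k) t * step_val k x.

Definition step_integral a b (s : step_fun) : E := fun x =>
  \sum_(k < step_size s)
    fine (leb (`]a, b[ `&` step_set k)) * step_val k x.

Definition step_approx a b f (s : nat -> step_fun) :=
  {ae leb, forall t, `]a, b[%classic t ->
    'N (f t \- step_eval (s n) t) @[n --> \oo] --> 0%E}.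

(* [f] is Bochner integrable on ]a, b[ and its integral is (the class of) [w]. *)
Definition is_Bochner_integral a b f w :=
  Linf w /\
  exists s : nat -> step_fun,
    [/\ step_approx a b f s,
     (\int[leb]_(t in `]a, b[) 'N (f t \- step_eval (s n) t)%R)%E
       @[n --> \oo] --> 0%E &
     'N (w \- step_integral a b (s n)) @[n --> \oo] --> 0%E].

(* L_oo(a, b; L_oo(Omega)) *)
Definition Linf_Linf a b f :=
  [/\ forall t, `]a, b[%classic t -> Linf (f t),
   exists s, step_approx a b f s &
   exists M : R, {ae leb, forall t, `]a, b[%classic t -> ('N (f t) <= M%:E)%E}].

Definition is_weak_time_derivative a b u v :=
  Linf_Linf a b v /\
  forall phi : R -> R, test_function `]a, b[%classic phi ->
    exists w : E,
      is_Bochner_integral a b (fun t x => derive1 phi t * u t x) w /\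
      is_Bochner_integral a b (fun t x => phi t * v t x) (fun x => - w x).

(* W^{1,oo}(a, b; L_oo(Omega)) *)
Definition W1inf_Linf a b u :=
  Linf_Linf a b u /\ exists v, is_weak_time_derivative a b u v.

(* C([0, T]; L_oo(Omega)) *)
Definition C_Linf T u :=
  (forall t, 0 <= t <= T -> Linf (u t)) /\
  forall t, 0 <= t <= T ->
    'N (u s \- u t) @[s --> within [set s | 0 <= s <= T] (nbhs t)] --> 0%E.

Definition Gamma (z : R) : R :=
  \int[leb]_(s in `]0%R, +oo[) (s `^ (z - 1) * expR (- s)).

(* [w] is (a representative of) the Caputo derivative of order [alpha] of [u]
   at time [t]; [v] is the derivative of [u] in time and [J eps] the integral
   of [(t - s)^(-alpha) v(s)] over [eps < s < t]. *)
Definition is_Caputo (alpha : R) u t w :=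
  Linf w /\
  exists v, (forall eps, 0 < eps < t -> is_weak_time_derivative eps t u v) /\
  exists J : R -> E,
    (forall eps, 0 < eps < t ->
       is_Bochner_integral eps t (fun s x => (t - s) `^ (- alpha) * v s x)
         (J eps)) /\
    'N (w \- (fun x => (Gamma (1 - alpha))^-1 * J eps x))
      @[eps --> 0^'+] --> 0%E.

End Bochner.

Section operator.
Context (R : realType) (d : nat).
Variables (Omega : set 'rV[R]_d) (T : R).
Variables (a : 'rV[R]_d -> R -> 'M[R]_d) (b : 'rV[R]_d -> R -> 'rV[R]_d).
Local Notation mu := (lebesgue_rV R d).

Definition cylinder : set ('rV[R]_d * measurableTypeR R) := Omega `*` `]0, T[.

Definition cylinder_measure :
    {measure set ('rV[R]_d * measurableTypeR R)%type -> \bar R} :=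
  (mu \x @lebesgue_measure R)%E.

(* L_oo(Omega x (0, T)), for functions that need only be almost everywhere
   equal to a Borel one. *)
Definition Linf_cylinder (f : 'rV[R]_d -> R -> R) :=
  exists2 g : 'rV[R]_d * measurableTypeR R -> R,
    Lp_on cylinder_measure cylinder +oo%E g &
    {ae cylinder_measure, forall p, cylinder p -> f p.1 p.2 = g p}.

Definition CL : \bar R :=
  ess_sup_on cylinder_measure cylinder (fun p =>
    (\sum_(i < d) (b p.1 p.2 ord0 i) ^+ 2) / (4 * min_eigenvalue (a p.1 p.2))).

(* The pairing of L w with chi at time [t], where [G] and [H] are the weak
   gradients of [w] and [chi]. *)
Definition L_form (t : R) (G H : 'I_d -> 'rV[R]_d -> R) (chi : 'rV[R]_d -> R) : R :=
  \sum_(i < d) \sum_(j < d)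
     \int[mu]_(x in Omega) (a x t i j * G j x * H i x) +
  \sum_(i < d) \int[mu]_(x in Omega) (b x t ord0 i * G i x * chi x).

End operator.

(* Main.v *)
Require Import Defs.
From mathcomp Require Import all_boot all_order all_algebra.
From mathcomp Require Import all_classical all_reals all_analysis.
From mathcomp Require Import ess_sup_inf measurable_realfun ring lra.

Set Implicit Arguments.
Unset Strict Implicit.
Unset Printing Implicit Defensive.

Import Order.TTheory GRing.Theory Num.Theory.
Import numFieldNormedType.Exports.

Local Open Scope classical_set_scope.
Local Open Scope ring_scope.

(** Let S(t) be the essential supremum of the positive part of u(t), a continuous
function of t with S(0) = 0. It is enough to show that if S vanishes up to time
s, then it vanishes up to s + tau, where tau > 0 depends on the coefficients
only and is so small that
tau^(-alpha_i) / Gamma(1 - alpha_i) >= 2 (lam + 1) / Cq for every i.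

Otherwise S reaches, at a time t <= s + tau, a maximum M > 0 over the times up
to some t1 >= t, while S <= M / 4 up to some time s1 > s. Let chi = F(u(t)),
where F(y) = exp(-1/(y - k)) for y > k and F(y) = 0 for y <= k, with k slightly
smaller than M. The weak inequality at time t, tested with chi, is contradicted
unless u(t) <= k, which contradicts M = S(t) ([no_positive_maximum]):
- as F(y) = (y - k)^2 F'(y), completing the square in the diffusion and
  convection terms bounds them below by - C (M - k)^2 times the integral of chi
  ([Rayleigh], [energy_ge], [L_form_ge]);
- the reaction term is at least - lam M times that integral ([reaction_ge]);
- the fractional terms are at least (lam + 1) M times that integral
  ([Caputo_lower_bound]). Indeed the pairing of the Caputo derivative with chi
  is the integral of (t - r)^(-alpha) against the derivative of
  g(r) = <u(r), chi>, where g(t) is nearly M times the integral of chi, and g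
  stays below M times it, and below M / 4 times it up to time s1. As the kernel
  is increasing, the second mean value theorem applies ([second_mean_value],
  [ker_integral_ge]).

Two points have to be established first. The test function chi must belong to
H^1_0, and its gradient must be F'(u) times the gradient of u, although only the
positive part of u is known to be a limit of test functions; this is
[chain_rule], which rests on the divergence theorem for functions with compact
support ([Rintegral_partial_eq0]). And the inequality speaks of the Caputo
derivatives of u, whose existence is [Caputo_exists]. The Bochner integrals that
it requires are constructed in [Bochner_exists], and everything about them is
reduced to real integrals by pairing with integrable functions: an essential
bound can be read off such pairings ([Linf_dual]), and pairing commutes with
Bochner integration ([Bochner_pairing]). In particular the weak time derivative
becomes that of a continuous real function, which is its primitive
([weak_ftc]). *)

(** * Duality for essentially bounded functions *)

Definition pairing d (T : measurableType d) (R : realType)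
    (mu : {measure set T -> \bar R}) (D : set T) (f chi : T -> R) : R :=
  \int[mu]_(x in D) (f x * chi x).

Section Linf.
Context d (T : measurableType d) (R : realType).
Variables (mu : {measure set T -> \bar R}) (D : set T).
(* Without the positivity of the measure, norms of order +oo are 0 by
   convention. *)
Hypotheses (mD : measurable D) (muD : (mu D < +oo)%E) (muT : (0 < mu [set: T])%E).
Local Notation Linf := (Lp_on mu D +oo%E).
Local Notation "'N f" := (Lnorm_on mu D +oo%E f%R) (at level 10, f at level 8).
Local Notation L1 chi := (mu.-integrable D (EFin \o chi)).
Local Notation P := (pairing mu D).
Implicit Types (f g chi : T -> R) (M : R).

Lemma Lnorm_on_leP f M : 0 <= M ->
  ('N f <= M%:E)%E <-> {ae mu, forall x, D x -> `|f x| <= M}.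
Proof.
move=> M0; rewrite /Lnorm_on unlock muT; split.
  move=> /ess_supP; apply: filterS => x /= + Dx.
  by rewrite patchE mem_set// lee_fin.
move=> H; apply/ess_supP; apply: filterS H => x /=.
rewrite patchE lee_fin; case: ifPn => [/set_mem Dx /(_ Dx)//|_ _].
by rewrite normr0.
Qed.

Lemma Linf_measurable f : Linf f -> measurable_fun D f.
Proof. by move=> /andP[]; rewrite inE => /(measurable_restrictT _ mD). Qed.

Lemma Linf_bound f : Linf f -> exists2 M, 0 <= M & ('N f <= M%:E)%E.
Proof.
move=> /andP[_]; rewrite inE /= /finite_norm => Nf.
have N0 : (0 <= 'N f)%E by exact: Lnorm_ge0.
exists (fine ('N f)); first exact: fine_ge0.
by rewrite fineK// ge0_fin_numE.
Qed.

Lemma LinfI f M : measurable_fun D f -> ('N f <= M%:E)%E -> Linf f.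
Proof.
move=> mf fM; apply/andP; split; rewrite inE/=.
  exact/(measurable_restrictT _ mD).
by rewrite /finite_norm; apply: (le_lt_trans fM); rewrite ltry.
Qed.

Lemma Linf_integrable f chi : Linf f -> L1 chi ->
  mu.-integrable D (EFin \o (fun x => f x * chi x)).
Proof.
move=> lf; have [M M0 /(Lnorm_on_leP _ M0) fM] := Linf_bound lf.
move=> /integrableP[/measurable_EFinP mchi chioo].
have mf := Linf_measurable lf.
apply/integrableP; split; first exact/measurable_EFinP/measurable_funM.
apply: (@le_lt_trans _ _ (\int[mu]_(x in D) (M%:E * `|(chi x)%:E|))%E).
  apply: ae_ge0_le_integral => //.
  - by apply/measurableT_comp => //; exact/measurable_EFinP/measurable_funM.
  - by move=> x _; rewrite -EFinM lee_fin mulr_ge0.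
  - apply: measurable_funeM; apply/measurableT_comp => //; exact/measurable_EFinP.
  - apply: filterS fM => x + Dx => /(_ Dx) fxM /=.
    by rewrite -EFinM lee_fin normrM ler_wpM2r.
rewrite ge0_integralZl_EFin//; last first.
  by apply/measurableT_comp => //; exact/measurable_EFinP.
by rewrite lte_mul_pinfty.
Qed.

Lemma pairing_le f chi M : 0 <= M -> Linf f -> ('N f <= M%:E)%E -> L1 chi ->
  `|P f chi| <= M * \int[mu]_(x in D) `|chi x|.
Proof.
move=> M0 lf /(Lnorm_on_leP _ M0) fM ichi.
have ifc := Linf_integrable lf ichi.
have mf := Linf_measurable lf.
have nchi : L1 (fun x => `|chi x|) by exact: integrable_norm.
have nfc : L1 (fun x => `|f x * chi x|) by exact: integrable_norm.
apply: (le_trans (le_normr_Rintegral mD ifc)).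
rewrite -RintegralZl// /Rintegral.
have iM : mu.-integrable D (EFin \o (fun x => M * `|chi x|)).
  rewrite (_ : _ \o _ = (fun x => M%:E * (`|chi x|)%:E)%E)//.
  exact: integrableZl.
apply: fine_le; [exact: integrable_fin_num..|].
apply: ae_ge0_le_integral => //.
- exact: (measurable_int mu).
- by move=> x _; rewrite lee_fin mulr_ge0.
- exact: (measurable_int mu).
- by apply: filterS fM => x + Dx => /(_ Dx) ?; rewrite lee_fin normrM ler_wpM2r.
Qed.

Lemma L1_indic B : measurable B -> L1 (\1_B : T -> R).
Proof.
move=> mB; apply: measurable_bounded_integrable => //.
exists 1; split => // x x1 y _; apply: le_trans (ltW x1).
by rewrite indicE; case: (_ \in _); rewrite ?normr1 ?normr0.
Qed.

Lemma Linf_cst M : Linf (cst M).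
Proof.
apply: (@LinfI _ `|M|) => //; apply/(Lnorm_on_leP _ (normr_ge0 _)).
by apply: nearW => x.
Qed.

Lemma LinfD f g : Linf f -> Linf g -> Linf (f \+ g).
Proof.
move=> lf lg; have [M M0 fM] := Linf_bound lf; have [N N0 gN] := Linf_bound lg.
apply: (@LinfI _ (M + N)).
  by apply: measurable_funD; exact: Linf_measurable.
apply/(Lnorm_on_leP _ (addr_ge0 M0 N0)).
move/(Lnorm_on_leP _ M0) : fM; move/(Lnorm_on_leP _ N0) : gN.
apply: filterS2 => x gx fx Dx; apply: (le_trans (ler_normD _ _)).
by apply: lerD; [exact: fx|exact: gx].
Qed.

Lemma LinfZ f M : Linf f -> Linf (fun x => M * f x).
Proof.
move=> lf; have [K K0 fK] := Linf_bound lf.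
apply: (@LinfI _ (`|M| * K)).
  by apply: measurable_funM => //; exact: Linf_measurable.
apply/(Lnorm_on_leP _ (mulr_ge0 (normr_ge0 _) K0)).
move/(Lnorm_on_leP _ K0) : fK; apply: filterS => x fx Dx.
by rewrite normrM ler_wpM2l// fx.
Qed.

Lemma LinfB f g : Linf f -> Linf g -> Linf (f \- g).
Proof.
move=> lf lg; have := LinfD lf (LinfZ (-1) lg).
by congr Lp_on; apply/funext => x /=; rewrite mulN1r.
Qed.

(** Pair with the indicator function of the set where the bound fails. *)
Lemma ae_le_dual f M : Linf f ->
  (forall B, measurable B -> B `<=` D ->
     P f \1_B <= M * \int[mu]_(x in D) \1_B x) ->
  {ae mu, forall x, D x -> f x <= M}.
Proof.
move=> lf H; have mf := Linf_measurable lf.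
pose B := D `&` [set x | M < f x].
have mB : measurable B.
  have := @measurable_fun_ltr _ _ _ D (cst M) f (measurable_cst _) mf mD.
  move=> /(_ [set true]); rewrite (_ : _ `&` _ = B)//; first exact.
have BD : B `<=` D by move=> x [].
have iB := L1_indic mB.
have ifB := Linf_integrable lf iB.
have iMB : L1 (fun x => M * \1_B x) by apply: Linf_integrable => //; exact: Linf_cst.
pose g x := f x * \1_B x - M * \1_B x.
have ig : L1 g.
  rewrite (_ : EFin \o g = ((EFin \o (fun x => f x * \1_B x)%R) \- (EFin \o (fun x => M * \1_B x)%R))%E)//.
  exact: integrableB.
have g0 x : 0 <= g x.
  rewrite /g -mulrBl indicE; have [/set_mem[_ /= Mf]|_] := boolP (x \in B).
    by rewrite mulr1 subr_ge0 ltW.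
  by rewrite mulr0.
have g_eq0 : (\int[mu]_(x in D) `|(g x)%:E| = 0)%E.
  apply/eqP; rewrite eq_le integral_ge0// andbT.
  under eq_integral do rewrite gee0_abs ?lee_fin//.
  rewrite -(fineK (integrable_fin_num _ ig))// lee_fin.
  by rewrite [leLHS](RintegralB mD ifB iMB) [in leLHS]RintegralZl// subr_le0 H.
have mg : measurable_fun D (EFin \o g) by exact: measurable_int ig.
have /(ae_eq_integral_abs _ mD mg) := g_eq0.
apply: filterS => x /= + Dx => /(_ Dx) [] gx; rewrite leNgt; apply/negP => Mf.
have Bx : x \in B by rewrite inE.
by move: gx; rewrite /g indicE Bx !mulr1 => /eqP; rewrite subr_eq0 gt_eqF.
Qed.

(** Apply [ae_le_dual] to [f] and to its opposite. *)
Lemma Linf_dual f M : 0 <= M -> Linf f ->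
  (forall chi, L1 chi -> P f chi <= M * \int[mu]_(x in D) `|chi x|) ->
  ('N f <= M%:E)%E.
Proof.
move=> M0 lf H; apply/(Lnorm_on_leP _ M0).
have nB B x : `|\1_B x| = \1_B x :> R by rewrite ger0_norm.
have f1 : {ae mu, forall x, D x -> f x <= M}.
  apply: ae_le_dual => // B mB BD.
  by rewrite (le_trans (H _ (L1_indic mB)))//; under eq_Rintegral do rewrite nB.
have f2 : {ae mu, forall x, D x -> -1 * f x <= M}.
  apply: ae_le_dual => [|B mB BD]; first exact: LinfZ.
  have iB := L1_indic mB.
  have := H (fun x => -1 * \1_B x).
  rewrite /pairing; under eq_Rintegral do rewrite mulrA (mulrC _ (-1)).
  rewrite /pairing => /(_ _)/le_trans -> //.
    by apply: Linf_integrable => //; exact: Linf_cst.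
  by under eq_Rintegral do rewrite mulN1r normrN nB.
apply: filterS2 f1 f2 => x fx1 fx2 Dx.
by rewrite ler_norml fx1// andbT lerNl -mulN1r fx2.
Qed.

Lemma pairingBl f g chi : Linf f -> Linf g -> L1 chi ->
  P (f \- g) chi = P f chi - P g chi.
Proof.
move=> lf lg ic; rewrite -RintegralB//; try exact: Linf_integrable.
by apply: eq_Rintegral => x _ /=; rewrite mulrBl.
Qed.

Lemma pairingDl f g chi : Linf f -> Linf g -> L1 chi ->
  P (f \+ g) chi = P f chi + P g chi.
Proof.
move=> lf lg ic; rewrite -RintegralD//; try exact: Linf_integrable.
by apply: eq_Rintegral => x _ /=; rewrite mulrDl.
Qed.

Lemma pairingZl f M chi : Linf f -> L1 chi ->
  P (fun x => M * f x) chi = M * P f chi.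
Proof.
move=> lf ic; rewrite -RintegralZl//; try exact: Linf_integrable.
by apply: eq_Rintegral => x _ /=; rewrite mulrA.
Qed.

Lemma Lnorm_onD f g : ('N (f \+ g) <= 'N f + 'N g)%E.
Proof.
rewrite /Lnorm_on unlock muT; apply: le_trans (ess_sup_absD _ _ _).
apply: le_ess_sup; apply: nearW => x /=; rewrite !patchE.
by case: ifP => //=; rewrite addr0.
Qed.

Lemma Lnorm_onC f g : 'N (f \- g) = 'N (g \- f).
Proof.
rewrite /Lnorm_on -oppe_Lnorm; congr Lnorm; apply/funext => x /=.
by rewrite !patchE; case: ifP => _ /=; rewrite ?oppr0// opprB.
Qed.

Lemma Lnorm_onZ f M : 'N (fun x => M * f x) = (`|M|%:E * 'N f)%E.
Proof.
rewrite /Lnorm_on unlock muT -ess_supZl//.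
congr ess_sup; apply/funext => x /=.
by rewrite !patchE; case: ifP => _ /=; rewrite -EFinM ?normrM ?normr0 ?mulr0.
Qed.

Lemma Lnorm_on_tri f g h : ('N (f \- h) <= 'N (f \- g) + 'N (g \- h))%E.
Proof.
apply: le_trans (Lnorm_onD _ _); rewrite le_eqVlt; apply/orP; left; apply/eqP.
by congr Lnorm_on; apply/funext => x /=; rewrite subrKA.
Qed.

(** Completeness: off one null set, all the essential bounds of the Cauchy
condition hold everywhere, so that the sequence is pointwise Cauchy there. *)
Lemma Linf_complete (f : nat -> T -> R) : (forall n, Linf (f n)) ->
  (forall eps, 0 < eps -> exists N, forall n m, (N <= n)%N -> (N <= m)%N ->
     ('N (f m \- f n) <= eps%:E)%E) ->
  exists2 w, Linf w & forall eps, 0 < eps ->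
    exists N, forall n, (N <= n)%N -> ('N (w \- f n) <= eps%:E)%E.
Proof.
move=> lf fC.
have i0 (k : nat) : 0 < k.+1%:R^-1 :> R by rewrite invr_gt0.
have [K KP] := choice (fun k : nat => fC _ (i0 k)).
have : {ae mu, forall x, forall k n m, (K k <= n)%N -> (K k <= m)%N -> D x ->
    `|f m x - f n x| <= k.+1%:R^-1}.
  apply/ae_foralln => k; apply/ae_foralln => n; apply/ae_foralln => m.
  have [kn|] := boolP (K k <= n)%N; last by move=> _; apply: nearW => x.
  have [km|] := boolP (K k <= m)%N; last by move=> _; apply: nearW => x.
  have /(Lnorm_on_leP _ (ltW (i0 k))) := KP k n m kn km.
  by apply: filterS => x H _ _; exact: H.
move=> [N [mN N0 subN]].
pose g n x : R := (f n \_ (~` N)) x.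
have gC x k n m : D x -> (K k <= n)%N -> (K k <= m)%N ->
    `|g m x - g n x| <= k.+1%:R^-1.
  move=> Dx kn km; rewrite /g !patchE; case: ifPn => [|_].
    rewrite in_setC => /negP xN; apply: contrapT => H.
    by apply: xN; rewrite inE; apply: subN => /= /(_ k n m kn km Dx).
  by rewrite subrr normr0 ltW.
have small eps : 0 < eps -> exists k : nat, k.+1%:R^-1 < eps :> R.
  move=> e0; have /cvgrPdist_lt/(_ _ e0)[k _ kP] := @cvg_harmonic R.
  exists k; have := kP k (leqnn k); rewrite sub0r normrN ger0_norm//.
  by rewrite ltW// harmonic_gt0.
have gcvg x : D x -> cvgn (g ^~ x).
  move=> Dx; apply/cauchy_cvgP/cauchy_exP => eps eps0.
  have [k keps] := small _ eps0.
  exists (g (K k) x); exists (K k) => // m /= km; rewrite /ball/= distrC.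
  exact: le_lt_trans (gC _ _ _ _ Dx (leqnn _) km) keps.
pose w x : R := limn (g ^~ x).
have wg x k n : D x -> (K k <= n)%N -> `|w x - g n x| <= k.+1%:R^-1.
  move=> Dx kn; have gw : g ^~ x @ \oo --> w x by exact: gcvg.
  have : (fun m => `|g m x - g n x|) @ \oo --> `|w x - g n x|.
    by apply: cvg_norm; apply: cvgB => //; exact: cvg_cst.
  move=> h; rewrite -(cvg_lim (@Rhausdorff R) h); apply: limr_le.
    by apply/cvg_ex; eexists; exact: h.
  by exists (K k) => // m /= km; exact: gC.
have mg n : measurable_fun D (g n).
  apply/measurable_restrict => //; first exact: measurableC.
  by apply: (measurable_funS mD) (Linf_measurable (lf n)) => x [].
have wf k n : (K k <= n)%N -> ('N (w \- f n) <= k.+1%:R^-1%:E)%E.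
  move=> kn; apply/(Lnorm_on_leP _ (ltW (i0 k))); exists N; split => // x /=.
  move/not_implyP => [Dx wx]; apply: contrapT => Nx; apply: wx.
  have := wg x k n Dx kn; rewrite {1}/g patchE ifT// in_setC.
  by apply/negP; rewrite inE.
exists w; last first.
  move=> eps /small [k keps]; exists (K k) => n /wf /le_trans; apply.
  by rewrite lee_fin ltW.
have mw : measurable_fun D w.
  by apply: (measurable_fun_cvg mg) => x Dx; exact: gcvg.
have [M M0 fM] := Linf_bound (lf (K 0%N)).
apply: (@LinfI _ (1%:R^-1 + M)) => //; rewrite EFinD.
have -> : w = (w \- f (K 0%N)) \+ f (K 0%N) by apply/funext => x /=; rewrite subrK.
by rewrite (le_trans (Lnorm_onD _ _))// leeD// wf.
Qed.

End Linf.
Arguments Lnorm_onD {d T R mu D} muT f g.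
Arguments Lnorm_on_tri {d T R mu D} muT f g h.
Arguments Lnorm_onZ {d T R mu D} muT f M.
Arguments Lnorm_on_leP {d T R mu D} muT f M.
Arguments Linf_bound {d T R mu D f}.

(** * Smooth functions *)

Section smooth.
Context (R : realType) (V : normedModType R).
Implicit Types (f g phi : V -> R) (F : R -> R) (k : nat).

Definition smooth f := forall k, Ck k f.

Lemma smooth_continuous f : smooth f -> continuous f.
Proof. by move=> /(_ 0%N). Qed.

Lemma smooth_derivable f x v : smooth f -> derivable f x v.
Proof. by move=> /(_ 1%N) []. Qed.

Lemma smooth_derive f v : smooth f -> smooth (fun x => 'D_v f x).
Proof. by move=> sf k; have [_] := sf k.+1; exact. Qed.

(** Coinduction principle: being smooth follows from any invariant that implies
continuity and directional differentiability. *)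
Lemma Ck_ind (P : (V -> R) -> Prop) :
  (forall f, P f -> continuous f) ->
  (forall f, P f -> forall x v, derivable f x v) ->
  (forall f, P f -> forall v, P (fun x => 'D_v f x)) ->
  forall f, P f -> smooth f.
Proof.
move=> Pc Pd PD f Pf k; elim: k f Pf => [|k IH] f Pf /=; first exact: Pc.
by split => [x v|v]; [exact: Pd|exact/IH/PD].
Qed.

Lemma smooth_cst (c : R) : smooth (cst c).
Proof.
apply: (@Ck_ind (fun f => exists c, f = cst c)); last by exists c.
- by move=> _ [a ->] x; exact: cvg_cst.
- by move=> _ [a ->] x v; exact: derivable_cst.
- by move=> _ [a ->] v; exists 0; apply/funext => x; rewrite derive_cst.
Qed.

Lemma CkD k f g : Ck k f -> Ck k g -> Ck k (fun x => f x + g x).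
Proof.
elim: k f g => [|k IHk] f g /=.
  by move=> cf cg x; apply: cvgD; [exact: cf|exact: cg].
move=> [df Cf] [dg Cg]; split=> [x w|w]; first exact: derivableD.
rewrite (_ : (fun x => _) = fun x => 'D_w f x + 'D_w g x); first exact: IHk.
by apply/funext => x; rewrite deriveD.
Qed.

(* Ck k.+1 f does not obviously imply Ck k f, hence the quantification over
   all the smaller orders. *)
Let Cle k f := forall j, (j <= k)%N -> Ck j f.

Let CleS k f : Cle k.+1 f -> Cle k f /\ forall v, Cle k (fun x => 'D_v f x).
Proof.
move=> Cf; split=> [j jk|v j jk]; first exact/Cf/leqW.
by have [_] := Cf j.+1 jk; exact.
Qed.

Lemma CkM k f g : Cle k f -> Cle k g -> Ck k (fun x => f x * g x).
Proof.
elim: k f g => [|k IH] f g Cf Cg.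
  by move=> x; apply: cvgM; [exact: (Cf 0%N)|exact: (Cg 0%N)].
have [Cf0 Cf1] := CleS Cf; have [Cg0 Cg1] := CleS Cg.
have [df _] := Cf 1%N isT; have [dg _] := Cg 1%N isT.
split => [x v|v]; first exact: derivableM.
rewrite (_ : (fun x => _) = fun x => f x * 'D_v g x + g x * 'D_v f x).
  by apply: CkD; exact: IH.
by apply/funext => x; rewrite deriveM.
Qed.

Lemma smoothD f g : smooth f -> smooth g -> smooth (fun x => f x + g x).
Proof. by move=> sf sg k; exact: CkD. Qed.

Lemma smoothM f g : smooth f -> smooth g -> smooth (fun x => f x * g x).
Proof. by move=> sf sg k; apply: CkM => j _. Qed.

(** A directional derivative is a derivative along a line, which gives access to
the one-dimensional chain rule. *)
Lemma derive_line f x v : 'D_v f x = 'D_1 (fun h : R => f (h *: v + x)) 0.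
Proof.
rewrite /derive; set g1 := fun h => h^-1 *: _; set g2 := fun h => h^-1 *: _.
suff -> : g1 = g2 by [].
by rewrite funeqE /g1 /g2 => h /=; rewrite addr0 scale0r add0r [_%:A]mulr1.
Qed.

Lemma is_derive_along F f x v (dF : R) : derivable f x v ->
  is_derive (f x) 1 F dF -> is_derive x v (fun y => F (f y)) (dF * 'D_v f x).
Proof.
move=> /derivable1P df dF1.
pose p := fun h : R => f (h *: v + x).
have p0 : p 0 = f x by rewrite /p scale0r add0r.
have dFp : is_derive (p 0) 1 F dF by rewrite p0.
have dp : is_derive (0 : R) 1 p ('D_1 p 0) by exact: derivableP.
have [dFpp eFp] := @is_derive1_comp R F p 0 _ _ dFp dp.
apply: DeriveDef.
  by apply/derivable1P; exact: dFpp.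
by rewrite !derive_line -/p; exact: eFp.
Qed.

End smooth.

Section smooth_comp.
Context (R : realType).

Lemma smooth_derive1 (F : R -> R) : smooth F -> smooth (derive1 F).
Proof.
move=> sF; rewrite (_ : derive1 F = fun x => 'D_1 F x); first exact: smooth_derive.
by apply/funext => x; rewrite derive1E.
Qed.

Lemma smooth_is_derive (F : R -> R) (x : R) : smooth F -> is_derive x 1 F (derive1 F x).
Proof.
by move=> sF; rewrite derive1E; apply/derivableP/smooth_derivable.
Qed.

(** By induction on the order, for all outer functions at once, since the
derivative involves that of [F]. *)
Lemma smooth_comp (V : normedModType R) (F : R -> R) (f : V -> R) :
  smooth F -> smooth f -> smooth (fun x => F (f x)).
Proof.
move=> + sf k.
suff : forall j, (j <= k)%N -> forall F, smooth F -> Ck j (fun x => F (f x)).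
  by move=> H sF; exact: H.
elim: k => [|k IH] j; rewrite leq_eqVlt => /predU1P[->|jk] // {}F sF.
- by move=> x; apply: continuous_comp; exact: smooth_continuous.
- have FD x v : is_derive x v (fun y => F (f y)) (derive1 F (f x) * 'D_v f x).
    by apply: is_derive_along; [exact: smooth_derivable|exact: smooth_is_derive].
  split => [x v|v]; first by have [] := FD x v.
  rewrite (_ : (fun x => _) = fun x => derive1 F (f x) * 'D_v f x); last first.
    by apply/funext => x; have [_ ->] := FD x v.
  apply: CkM => i ik; last exact: smooth_derive.
  exact/IH/smooth_derive1.
- exact: IH.
Qed.

Lemma derive_comp_smooth (V : normedModType R) (F : R -> R) (f : V -> R) x v :
  smooth F -> smooth f -> 'D_v (fun x => F (f x)) x = derive1 F (f x) * 'D_v f x.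
Proof.
move=> sF sf.
have [] // := @is_derive_along R V F f x v (derive1 F (f x))
  (@smooth_derivable _ _ f x v sf) (smooth_is_derive (f x) sF).
Qed.

(** The derivative - f' / f^2 involves the inverse itself, at a lower order. *)
Lemma smoothV (V : normedModType R) (f : V -> R) : (forall x, f x != 0) ->
  smooth f -> smooth (fun x => (f x)^-1).
Proof.
move=> f0 sf k.
suff : forall j, (j <= k)%N -> Ck j (fun x => (f x)^-1) by apply.
elim: k => [|k IH] j; rewrite leq_eqVlt => /predU1P[->|jk] //.
- by move=> x; apply: cvgV => //; exact: smooth_continuous.
- split => [x v|v].
    by apply: derivableV => //; exact: smooth_derivable.
  rewrite (_ : (fun x => _) =
    fun x => (f x)^-1 * (-1 * ((f x)^-1 * 'D_v f x))); last first.
    apply/funext => x; rewrite deriveV//; last exact: smooth_derivable.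
    by rewrite scaleNr /GRing.scale/= mulN1r mulrN mulrA expr2 invfM.
  apply: CkM => i ik; first exact: IH.
  apply: CkM => m mi; first exact: smooth_cst.
  apply: CkM => m' mi'; first by apply/IH/(leq_trans mi')/(leq_trans mi).
  exact: smooth_derive.
- exact: IH.
Qed.

End smooth_comp.

Section test_functions.
Context (R : realType) (V : normedModType R) (U : set V).
Implicit Types phi psi : V -> R.

Lemma test_functionM phi psi : test_function U phi -> smooth psi ->
  test_function U (fun x => psi x * phi x).
Proof.
move=> [sphi [K [cK KU phi0]]] spsi; split; first exact: smoothM.
by exists K; split=> // x /phi0 ->; rewrite mulr0.
Qed.

Lemma test_function_comp phi (F : R -> R) : smooth F -> F 0 = 0 ->
  test_function U phi -> test_function U (fun x => F (phi x)).
Proof.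
move=> sF F0 [sphi [K [cK KU phi0]]]; split; first exact: smooth_comp.
by exists K; split=> // x /phi0 ->.
Qed.

End test_functions.

(** * Cut-off functions *)

(** The functions p(1/x) exp(-1/x), extended by 0 to x <= 0, are stable under
differentiation and bounded; they supply all the cut-offs. *)
Section flat.
Context (R : realType).
Implicit Types (p : {poly R}) (x : R).

Definition flat p x : R := if 0 < x then p.[x^-1] * expR (- x^-1) else 0.

Lemma flat_le0 p x : x <= 0 -> flat p x = 0.
Proof. by rewrite /flat ltNge => ->. Qed.

Lemma flat_gt0 p x : 0 < x -> flat p x = p.[x^-1] * expR (- x^-1).
Proof. by rewrite /flat => ->. Qed.

Lemma exprn_expRN_le n (y : R) : 0 <= y -> y ^+ n * expR (- y) <= n`!%:R.
Proof.
move=> y0; rewrite expRN ler_pdivrMr ?expR_gt0//.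
case: n => [|n]; first by rewrite expr0 fact0 mul1r -expR0 ler_expR.
rewrite -ler_pdivrMl ?ltr0n ?fact_gt0// mulrC.
by apply: le_trans (expR_ge1Dxn n y0); rewrite lerDr.
Qed.

Lemma flat_bounded p : exists2 C, 0 <= C & forall x, `|flat p x| <= C.
Proof.
exists (\sum_(i < size p) `|p`_i| * i`!%:R).
  by apply: sumr_ge0 => i _; rewrite mulr_ge0.
move=> x; have [x0|x0] := leP x 0.
  by rewrite flat_le0// normr0; apply: sumr_ge0 => i _; rewrite mulr_ge0.
rewrite flat_gt0// horner_coef mulr_suml; apply: (le_trans (ler_norm_sum _ _ _)).
apply: ler_sum => i _; rewrite -mulrA normrM ler_wpM2l//.
have y0 : 0 <= x^-1 by rewrite invr_ge0 ltW.
by rewrite ger0_norm ?mulr_ge0 ?exprn_ge0 ?expR_ge0// exprn_expRN_le.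
Qed.

(** Used repeatedly, this gives any order of vanishing at 0. *)
Lemma flat_mulX p x : flat p x = x * flat (p * 'X) x.
Proof.
have [x0|x0] := leP x 0; first by rewrite !flat_le0// mulr0.
rewrite !flat_gt0// hornerMX; field; rewrite gt_eqF//.
Qed.

(** At 0, by [flat_mulX] applied twice, the difference quotient is the increment
times a bounded function. *)
Lemma is_derive_flat p x : is_derive x 1 (flat p) (flat ('X^2 * (p - p^`())) x).
Proof.
have [x0|x0|->] := ltgtP x 0.
- rewrite flat_le0 ?ltW//.
  apply: (@near_eq_is_derive _ _ _ (cst 0)) => //.
  by near=> y; rewrite flat_le0// ltW//; near: y; exact: lt_nbhsl.
- have xV : is_derive x 1 (fun y : R => y^-1) (- x^-2).
    have dx : derivable (@id R) x 1 by exact: derivable_id.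
    apply: DeriveDef; first by apply: derivableV => //; rewrite gt_eqF.
    by rewrite (@deriveV _ _ id) ?gt_eqF// derive_id /GRing.scale/= mulr1.
  apply: (@near_eq_is_derive _ R R (fun y : R => p.[y^-1] * expR (- y^-1))).
    by near=> y; rewrite flat_gt0//; near: y; exact: lt_nbhsr.
  have pV : is_derive x 1 (fun y => p.[y^-1]) (p^`().[x^-1] * (- x^-2)).
    exact: (@is_derive1_comp _ (horner p) (fun y => y^-1)).
  have eV : is_derive x 1 (fun y => expR (- y^-1)) (expR (- x^-1) * - (- x^-2)).
    exact: (@is_derive1_comp _ expR (fun y => - y^-1)).
  apply: is_derive_eq.
  rewrite flat_gt0// !hornerE /GRing.scale/=.
  by rewrite exprVn; ring.
- have [C C0 CP] := flat_bounded (p * 'X * 'X).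
  have lim0 : h^-1 *: (flat p (h *: 1 + 0) - flat p 0) @[h --> 0^'] --> (0 : R).
    apply/cvgrPdist_le => /= e e0; near=> h.
    have h0 : h != 0 by near: h; exact: nbhs_dnbhs_neq.
    rewrite (flat_le0 _ (lexx 0)) subr0 addr0 sub0r normrN.
    rewrite (_ : h *: 1 = h); last by rewrite /GRing.scale/= mulr1.
    rewrite flat_mulX flat_mulX /GRing.scale/= mulKf// normrM.
    have hC : `|h| <= e / (C + 1).
      near: h; apply: dnbhs0_le; rewrite divr_gt0// ltr_pwDr//.
    apply: (@le_trans _ _ (e / (C + 1) * C)); first by rewrite ler_pM.
    by rewrite mulrAC ler_pdivrMr ?ltr_pwDr// mulrDr mulr1 lerDl ltW.
  rewrite flat_le0//; apply: DeriveDef; last exact: (cvg_lim (@Rhausdorff R)).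
  by apply/cvg_ex; exists 0.
Unshelve. all: by end_near. Qed.

Lemma smooth_flat p : smooth (flat p).
Proof.
move=> k.
suff : forall j p, (j <= k)%N -> Ck j (flat p) by apply.
elim: k => [|k IH] j q; rewrite leq_eqVlt => /predU1P[->|jk] //.
- move=> x; apply/differentiable_continuous/derivable1_diffP.
  by have [] := is_derive_flat q x.
- have FD x v : is_derive x v (flat q) (v * flat ('X^2 * (q - q^`())) x).
    have [dF eF] := is_derive_flat q x; apply: DeriveDef.
      by apply: diff_derivable; exact/derivable1_diffP.
    rewrite deriveE; last exact/derivable1_diffP.
    by rewrite deriv1E// derive1E eF.
  split => [x v|v]; first by have [] := FD x v.
  rewrite (_ : (fun x => _) = fun x => v * flat ('X^2 * (q - q^`())) x).
    by apply: CkM => i ik; [exact: smooth_cst|exact: IH].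
  by apply/funext => x; have [_ ->] := FD x v.
- exact: IH.
Qed.

End flat.

Section step.
Context (R : realType).
Implicit Types x y s e : R.

Lemma flat1_gt0 x : 0 < x -> 0 < flat 1 x.
Proof. by move=> x0; rewrite flat_gt0// hornerC mul1r expR_gt0. Qed.

Lemma flat1_ge0 x : 0 <= flat 1 x.
Proof.
have [x0|x0] := leP x 0; first by rewrite flat_le0.
exact/ltW/flat1_gt0.
Qed.

Lemma smooth_affine (a b : R) : smooth (fun x : R => a * x + b).
Proof.
apply: smoothD; last exact: smooth_cst.
apply: smoothM; first exact: smooth_cst.
move=> [|k] /=; first by move=> x; exact: cvg_id.
split=> [x v|v]; first exact: derivable_id.
rewrite (_ : (fun x => _) = cst v); first exact: smooth_cst.
by apply/funext => x; rewrite derive_id.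
Qed.

(** The usual smooth transition from 0 to 1 over [0, 1]. *)
Definition step x : R := flat 1 x / (flat 1 x + flat 1 (1 - x)).

Lemma step_den_gt0 x : 0 < flat 1 x + flat 1 (1 - x).
Proof.
have [x0|x0] := leP x 0.
  by rewrite ltr_wpDl ?flat1_ge0// flat1_gt0// subr_gt0 (le_lt_trans x0).
by rewrite ltr_pwDl ?flat1_ge0// flat1_gt0.
Qed.

Lemma step_le0 x : x <= 0 -> step x = 0.
Proof. by move=> x0; rewrite /step flat_le0// mul0r. Qed.

Lemma step_ge1 x : 1 <= x -> step x = 1.
Proof.
move=> x1; rewrite /step (@flat_le0 _ _ (1 - x)) ?subr_le0// addr0 divff//.
by rewrite gt_eqF// flat1_gt0// (lt_le_trans _ x1).
Qed.

Lemma step_ge0 x : 0 <= step x.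
Proof. by rewrite divr_ge0 ?flat1_ge0// ltW// step_den_gt0. Qed.

Lemma step_le1 x : step x <= 1.
Proof. by rewrite ler_pdivrMr ?step_den_gt0// mul1r lerDl flat1_ge0. Qed.

Lemma smooth_step : smooth step.
Proof.
have s1 : smooth (fun x : R => flat 1 (1 - x)).
  apply: (@smooth_comp _ _ (flat 1) (fun x => 1 - x)); first exact: smooth_flat.
  rewrite (_ : (fun x => _) = fun x => -1 * x + 1); first exact: smooth_affine.
  by apply/funext => x; rewrite mulN1r addrC.
apply: smoothM; first exact: smooth_flat.
apply: smoothV; last by apply: smoothD => //; exact: smooth_flat.
by move=> x; rewrite gt_eqF// step_den_gt0.
Qed.

Lemma derive_step0 x : x < 0 \/ 1 < x -> derive1 step x = 0.
Proof.
rewrite derive1E => -[x0|x1].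
  rewrite (@near_eq_derive _ _ _ _ (cst 0)) ?derive_cst//.
  by near=> y; rewrite step_le0// ltW//; near: y; exact: lt_nbhsl.
rewrite (@near_eq_derive _ R R _ (cst 1)) ?derive_cst//.
by near=> y; rewrite step_ge1// ltW//; near: y; exact: lt_nbhsr.
Unshelve. all: by end_near. Qed.

Lemma derive_step_bounded : exists2 C, 0 <= C & forall x, `|derive1 step x| <= C.
Proof.
have cs : continuous (fun x => `|derive1 step x|).
  move=> x; apply: cvg_norm; exact/smooth_continuous/smooth_derive1/smooth_step.
have [c _ cP] := @EVT_max R _ 0 1 ler01 (continuous_subspaceT cs).
exists `|derive1 step c| => // x.
have [x0|x0] := ltP x 0; first by rewrite derive_step0 ?normr0//; left.
have [x1|x1] := ltP 1 x; first by rewrite derive_step0 ?normr0//; right.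
by apply: cP; rewrite in_itv/= x0.
Qed.

(** Scaled steps: increase from 0 to 1 over [s, s + e]. *)
Definition rise s e x := step ((x - s) / e).

Lemma rise_affine s e x : (x - s) / e = e^-1 * x + (- (s / e)).
Proof. by rewrite mulrBl mulrC. Qed.

Lemma smooth_rise s e : smooth (rise s e).
Proof.
rewrite (_ : rise s e = fun x => step (e^-1 * x + (- (s / e)))).
  apply: smooth_comp; first exact: smooth_step.
  exact: smooth_affine.
by apply/funext => x; rewrite /rise rise_affine.
Qed.

Lemma rise_le s e x : 0 < e -> x <= s -> rise s e x = 0.
Proof. by move=> e0 xs; rewrite /rise step_le0// pmulr_lle0 ?invr_gt0// subr_le0. Qed.

Lemma rise_ge s e x : 0 < e -> s + e <= x -> rise s e x = 1.
Proof.
move=> e0 xs; rewrite /rise step_ge1// ler_pdivlMr// mul1r.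
by rewrite lerBrDl.
Qed.

Lemma rise_itv s e x : 0 <= rise s e x <= 1.
Proof. by rewrite step_ge0 step_le1. Qed.

Lemma derive_rise s e x : derive1 (rise s e) x = derive1 step ((x - s) / e) / e.
Proof.
have da : is_derive x 1 (fun x : R => e^-1 * x + (- (s / e))) (e^-1 * 1 + 0).
  exact: is_deriveD.
have riseE : rise s e = step \o (fun x : R => e^-1 * x + (- (s / e))).
  by apply/funext => y; rewrite /= /rise rise_affine.
have [_ dE] := @is_derive1_comp R step (fun x : R => e^-1 * x + (- (s / e))) x _ _
  (smooth_is_derive _ smooth_step) da.
by rewrite riseE derive1E dE addr0 mulr1 rise_affine.
Qed.

End step.

(** * Integrals of bounded measurable functions *)

Section bounded_measurable.
Context d (T : measurableType d) (R : realType) (mu : {measure set T -> \bar R}).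
Implicit Types (D E : set T) (f g : T -> R) (M : R).

(** Bounded measurable functions, with a bound that holds everywhere. *)
Definition bmf D f :=
  measurable_fun D f /\ exists M, forall x, D x -> `|f x| <= M.

Lemma bmf_cst D (c : R) : bmf D (fun=> c).
Proof. by split => //; exists `|c|. Qed.

Lemma bmfD D f g : bmf D f -> bmf D g -> bmf D (fun x => f x + g x).
Proof.
move=> [mf [M fM]] [mg [N gN]]; split; first exact: measurable_funD.
by exists (M + N) => x Dx; rewrite (le_trans (ler_normD _ _))// lerD ?fM ?gN.
Qed.

Lemma bmfM D f g : bmf D f -> bmf D g -> bmf D (fun x => f x * g x).
Proof.
move=> [mf [M fM]] [mg [N gN]]; split; first exact: measurable_funM.
by exists (M * N) => x Dx; rewrite normrM ler_pM ?fM ?gN.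
Qed.

Lemma bmfB D f g : bmf D f -> bmf D g -> bmf D (fun x => f x - g x).
Proof.
move=> [mf [M fM]] [mg [N gN]]; split; first exact: measurable_funB.
exists (M + N) => x Dx; rewrite (le_trans (ler_normD _ _))// normrN.
by rewrite lerD ?fM ?gN.
Qed.

Lemma bmfN D f : bmf D f -> bmf D (fun x => - f x).
Proof.
move=> [mf [M fM]]; split; first exact: measurable_funN.
by exists M => x Dx; rewrite normrN fM.
Qed.

Lemma bmfS D E f : measurable D -> E `<=` D -> bmf D f -> bmf E f.
Proof.
move=> mD ED [mf [M fM]]; split; first exact: measurable_funS mf.
by exists M => x /ED; exact: fM.
Qed.

Lemma bmf_integrable D f : measurable D -> (mu D < +oo)%E -> bmf D f ->
  mu.-integrable D (EFin \o f).
Proof.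
move=> mD muD [mf [M fM]]; apply: measurable_bounded_integrable => //.
by exists M; split; [exact: num_real|move=> N MN x /fM /le_trans; apply; exact: ltW].
Qed.

Lemma norm_Rintegral_le D f M : measurable D -> (mu D < +oo)%E ->
  measurable_fun D f -> (forall x, D x -> `|f x| <= M) ->
  `|\int[mu]_(x in D) f x| <= M * fine (mu D).
Proof.
move=> mD muD mf fM.
have bf : bmf D f by split => //; exists M.
apply: (le_trans (le_normr_Rintegral mD (bmf_integrable mD muD bf))).
rewrite -Rintegral_cst//; apply: le_Rintegral => //.
- by apply: integrable_norm; exact: bmf_integrable.
- by apply: bmf_integrable => //; exact: bmf_cst.
Qed.

Lemma Rintegral_subset D E f : E `<=` D -> (forall x, D x -> ~ E x -> f x = 0) ->
  \int[mu]_(x in D) f x = \int[mu]_(x in E) f x.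
Proof.
move=> ED f0; rewrite Rintegral_mkcond [RHS]Rintegral_mkcond.
apply: eq_Rintegral => x _; rewrite !patchE.
have [/set_mem Ex|Ex] := boolP (x \in E); first by rewrite mem_set//; exact: ED.
case: ifPn => // /set_mem Dx; apply: f0 => // /mem_set.
exact/negP.
Qed.

Lemma bmf_sum_ord D n (f : 'I_n -> T -> R) : (forall k, bmf D (f k)) ->
  bmf D (fun t => \sum_(k < n) f k t).
Proof.
elim: n f => [|n IH] f bf.
  rewrite (_ : (fun x => _) = cst 0); first exact: bmf_cst.
  by apply/funext => x; rewrite big_ord0.
rewrite (_ : (fun x => _) = fun x => f ord0 x + \sum_(k < n) f (lift ord0 k) x).
  by apply: bmfD => //; exact: IH.
by apply/funext => x; rewrite big_ord_recl.
Qed.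

Lemma RintegralN D f : measurable D -> mu.-integrable D (EFin \o f) ->
  \int[mu]_(x in D) (- f x) = - \int[mu]_(x in D) f x.
Proof.
move=> mD if_; rewrite -mulN1r -RintegralZl//.
by apply: eq_Rintegral => x _; rewrite mulN1r.
Qed.

Lemma integrable_cmul D (c : R) f : measurable D ->
  mu.-integrable D (EFin \o f) -> mu.-integrable D (EFin \o (fun x => c * f x)).
Proof.
move=> mD if_; have : mu.-integrable D (fun x => (c%:E * (f x)%:E)%E).
  exact: integrableZl.
by [].
Qed.

Lemma integrableM_bmf D f g : measurable D ->
  mu.-integrable D (EFin \o f) -> bmf D g ->
  mu.-integrable D (EFin \o (fun x => f x * g x)).
Proof.
move=> mD if_ [mg [K gK]].
have mf : measurable_fun D f by apply/measurable_EFinP; exact: measurable_int if_.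
apply: (@le_integrable _ _ _ mu D mD _ _ _ _ (integrable_cmul K mD if_)).
  by apply/measurable_EFinP; exact: measurable_funM.
move=> x Dx; rewrite /= lee_fin !normrM mulrC ler_wpM2r// (le_trans (gK x Dx))//.
exact: ler_norm.
Qed.

Lemma le_Rintegral_ae D f g : measurable D ->
  mu.-integrable D (EFin \o f) -> mu.-integrable D (EFin \o g) ->
  {ae mu, forall x, D x -> f x <= g x} ->
  \int[mu]_(x in D) f x <= \int[mu]_(x in D) g x.
Proof.
move=> mD if_ ig fg; rewrite -subr_ge0 -RintegralB//.
have igf : mu.-integrable D (EFin \o (fun x => g x - f x)).
  by apply: eq_integrable (integrableB mD ig if_) => // x _.
rewrite (_ : \int[mu]_(x in D) (g x - f x) = \int[mu]_(x in D) `|g x - f x|).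
  exact: Rintegral_ge0.
have mgf := measurable_int _ igf.
congr fine; apply: ae_eq_integral => //.
  exact: measurable_int (integrable_norm igf).
by apply: filterS fg => x fgx Dx; rewrite ger0_norm// subr_ge0 fgx.
Qed.

Lemma Rintegral_sum D n (f : 'I_n -> T -> R) : measurable D ->
  (forall i, mu.-integrable D (EFin \o f i)) ->
  mu.-integrable D (EFin \o (fun x => \sum_(i < n) f i x)) /\
  \int[mu]_(x in D) (\sum_(i < n) f i x) = \sum_(i < n) \int[mu]_(x in D) f i x.
Proof.
move=> mD; elim: n f => [|n IH] f if_.
  rewrite big_ord0; under eq_fun do rewrite big_ord0.
  split; first exact: integrable0.
  by rewrite Rintegral_cst// mul0r.
have [IH1 IH2] := IH (fun i => f (lift ord0 i)) (fun i => if_ _).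
have E1 : (fun x => \sum_(i < n.+1) f i x) =
    fun x => f ord0 x + \sum_(i < n) f (lift ord0 i) x.
  by apply/funext => x; rewrite big_ord_recl.
rewrite E1 big_ord_recl -IH2; split.
  by apply: eq_integrable (integrableD mD (if_ ord0) IH1).
by rewrite -RintegralD//.
Qed.

End bounded_measurable.

(** * Integrals over intervals and weak derivatives *)

Section interval_integrals.
Context (R : realType).
Local Notation bmf := (@bmf _ (measurableTypeR R) R).
Local Notation leb := (@lebesgue_measure R).
Implicit Types (a b c s t p q m M : R) (f g h k phi : R -> R).

Lemma leb_itv_lty (b0 b1 : bool) a b :
  (leb [set` Interval (BSide b0 a) (BSide b1 b)] < +oo)%E.
Proof.
rewrite lebesgue_measure_itv/=; case: ifP => _ //.
by rewrite -EFinB ltry.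
Qed.

Lemma leb_cc a b : a <= b -> fine (leb `[a, b]) = b - a.
Proof.
rewrite lebesgue_measure_itv/= lte_fin le_eqVlt => /predU1P[->|ab].
  by rewrite ltxx subrr.
by rewrite ab.
Qed.

Lemma bmf_itv_integrable (b0 b1 : bool) a b f :
  bmf [set` Interval (BSide b0 a) (BSide b1 b)] f ->
  leb.-integrable [set` Interval (BSide b0 a) (BSide b1 b)] (EFin \o f).
Proof. exact/bmf_integrable/leb_itv_lty. Qed.

Lemma bmf_continuous a b f : {within `[a, b], continuous f} -> bmf `[a, b] f.
Proof.
move=> cf; split; first exact: subspace_continuous_measurable_fun.
have /compact_bounded[M [_ fM]] := continuous_compact cf (@segment_compact _ a b).
exists (M + 1) => x abx; apply: fM; first by rewrite ltrDl.
by exists x.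
Qed.

Lemma bmf_smooth a b phi : smooth phi -> bmf `]a, b[ phi.
Proof.
move=> sphi; apply: (@bmfS _ (measurableTypeR R) R `[a, b]).
- exact: measurable_itv.
- exact: subset_itv_oo_cc.
- by apply: bmf_continuous; apply: continuous_subspaceT; exact: smooth_continuous.
Qed.

Lemma Rintegral_split a b c f : a <= b -> b <= c -> bmf `[a, c] f ->
  \int[leb]_(x in `[a, c]) f x =
  \int[leb]_(x in `[a, b]) f x + \int[leb]_(x in `[b, c]) f x.
Proof.
move=> ab bc bf; have if_ := bmf_itv_integrable bf.
have := @Rintegral_itvB _ f (BLeft a) (BRight c) b if_.
rewrite !bnd_simp => /(_ ab bc); rewrite Rintegral_itv_obnd_cbnd.
  by move=> <-; rewrite subrKC.
apply: bmf_itv_integrable; apply: bmfS bf => //.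
by apply: subset_itvr; rewrite bnd_simp.
Qed.

Lemma Rintegral_cc_ge a b f : b <= a -> \int[leb]_(x in `[a, b]) f x = 0.
Proof.
rewrite le_eqVlt => /predU1P[->|ba]; first by rewrite set_itv1 Rintegral_set1.
by rewrite set_itv_ge ?Rintegral_set0// bnd_simp -ltNge.
Qed.

Lemma norm_Rintegral_cc_le a b f M : a <= b -> measurable_fun `[a, b] f ->
  (forall x, a <= x <= b -> `|f x| <= M) ->
  `|\int[leb]_(x in `[a, b]) f x| <= M * (b - a).
Proof.
move=> ab mf fM; rewrite -leb_cc//; apply: norm_Rintegral_le => //.
  exact: leb_itv_lty.
Qed.

Lemma Rintegral_derive phi a b : a <= b -> smooth phi ->
  \int[leb]_(x in `[a, b]) derive1 phi x = phi b - phi a.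
Proof.
rewrite le_eqVlt => /predU1P[-> _|ab sphi].
  by rewrite Rintegral_cc_ge// subrr.
rewrite /Rintegral (@continuous_FTC2 _ _ phi)//.
- by apply: continuous_subspaceT; exact/smooth_continuous/smooth_derive1.
- split => [x _||].
  + exact: smooth_derivable.
  + exact/cvg_at_right_filter/smooth_continuous.
  + exact/cvg_at_left_filter/smooth_continuous.
Qed.

(** Cut [a, b] into n equal pieces, which contribute at most C (b - a)^2 / n^2
each. *)
Lemma additive_quadratic_eq0 (I : R -> R -> R) a b C : a <= b ->
  (forall p q r, a <= p -> p <= q -> q <= r -> r <= b -> I p r = I p q + I q r) ->
  (forall p q, a <= p -> p <= q -> q <= b -> `|I p q| <= C * (q - p) ^+ 2) ->
  I a b = 0.
Proof.
move=> ab Iadd Iquad.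
have C0 : 0 <= C * (b - a) ^+ 2 by apply: le_trans (Iquad a b _ _ _).
have H (n : nat) : `|I a b| <= C * (b - a) ^+ 2 / n.+1%:R.
  pose e := (b - a) / n.+1%:R; pose p (i : nat) := a + i%:R * e.
  have e0 : 0 <= e by rewrite divr_ge0// subr_ge0.
  have pn : p n.+1 = b by rewrite /p /e mulrC divfK// subrKC.
  have p_le i j : (i <= j)%N -> p i <= p j.
    by move=> ij; rewrite lerD2l ler_wpM2r// ler_nat.
  have p0 : p 0%N = a by rewrite /p mul0r addr0.
  have ap i : a <= p i by rewrite -p0 p_le.
  have pb i : (i <= n.+1)%N -> p i <= b by rewrite -pn; exact: p_le.
  have Ie (i : nat) : (i <= n.+1)%N -> `|I a (p i)| <= i%:R * (C * e ^+ 2).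
    elim: i => [|i IH] i_n.
      by rewrite p0 mul0r (le_trans (Iquad a a _ _ _))// subrr expr0n mulr0.
    rewrite (Iadd a (p i)) ?pb ?p_le// (le_trans (ler_normD _ _))//.
    rewrite -natr1 mulrDl mul1r lerD ?IH 1?ltnW//.
    rewrite (le_trans (Iquad _ _ _ _ _)) ?pb ?p_le//.
    by rewrite /p -natr1 mulrDl mul1r opprD addrACA subrr add0r addrAC subrr add0r.
  have := Ie n.+1 (leqnn _); rewrite pn => /le_trans; apply.
  by rewrite /e le_eqVlt; apply/orP; left; apply/eqP; field.
apply/eqP; rewrite -normr_le0; apply/ler_addgt0Pr => e e0; rewrite add0r.
have Ce : 0 <= C * (b - a) ^+ 2 / e by rewrite divr_ge0// ltW.
rewrite (le_trans (H (Num.bound (C * (b - a) ^+ 2 / e))))//.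
rewrite ler_pdivrMr// -ler_pdivrMl// mulrC (le_trans (ltW (archi_boundP Ce)))//.
by rewrite ler_nat.
Qed.

Lemma test_support a b phi : test_function `]a, b[%classic phi -> a < b ->
  exists p q, [/\ a < p, p <= q, q < b &
    forall x, ~~ (p < x < q) -> phi x = 0].
Proof.
move=> [_ [K [cK Kab phi0]]] ab; have [K0|K0] := pselect (K !=set0); last first.
  exists ((a + b) / 2), ((a + b) / 2); split; [lra|lra|lra|] => x _.
  by apply: phi0 => Kx; apply: K0; exists x.
have cid : {within K, continuous (@id R)} by apply: continuous_subspaceT => x; exact: cvg_id.
have [P KP Pmin] := compact_EVT_min K0 cK cid.
have [Q KQ Qmax] := compact_EVT_max K0 cK cid.
have /= := Kab _ (set_mem KP); rewrite in_itv/= => /andP[aP Pb].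
have /= := Kab _ (set_mem KQ); rewrite in_itv/= => /andP[aQ Qb].
(* Halfway between the extreme points of the support and the end points. *)
exists ((a + P) / 2), ((Q + b) / 2).
have PQ := Pmin Q KQ.
split; [lra|simpl in PQ; lra|lra|] => x; rewrite negb_and -!leNgt => xout.
apply: phi0 => Kx; have /= := Pmin x (mem_set Kx); have /= := Qmax x (mem_set Kx).
by case/orP : xout => ? ? ?; lra.
Qed.

(** Integration by parts without differentiating [g]: the defect of the product
rule is additive in the interval, and it is quadratically small because [phi]
and [g] are Lipschitz continuous. *)
Lemma ftc_weak a b g h phi : a < b ->
  bmf `]a, b[ h -> bmf `]a, b[ g ->
  (forall s t, a < s -> s <= t -> t < b -> g t - g s = \int[leb]_(x in `[s, t]) h x) ->
  test_function `]a, b[%classic phi ->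
  \int[leb]_(x in `]a, b[) (phi x * h x) =
  - \int[leb]_(x in `]a, b[) (derive1 phi x * g x).
Proof.
move=> ab bh bg gh tphi; have [p [q [ap pq qb phi0]]] := test_support tphi ab.
have [sphi _] := tphi; have sdphi := smooth_derive1 sphi.
have pqab s t : p <= s -> t <= q -> `[s, t] `<=` `]a, b[.
  move=> ps tq x /=; rewrite !in_itv/= => /andP[sx xt].
  by rewrite (lt_le_trans ap (le_trans ps sx)) (le_lt_trans (le_trans xt tq) qb).
have dphi0 x : ~~ (p <= x <= q) -> derive1 phi x = 0.
  rewrite negb_and -!ltNge derive1E => /orP[xp|qx].
    rewrite (@near_eq_derive _ R R _ (cst 0)) ?derive_cst//.
    near=> y; apply: phi0; rewrite negb_and -!leNgt.
    by apply/orP; left; apply/ltW; near: y; exact: lt_nbhsl.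
  rewrite (@near_eq_derive _ R R _ (cst 0)) ?derive_cst//.
  near=> y; apply: phi0; rewrite negb_and -!leNgt.
  by apply/orP; right; apply/ltW; near: y; exact: lt_nbhsr.
have bmfC f s t : smooth f -> bmf `[s, t] f.
  by move=> /smooth_continuous cf; apply: bmf_continuous; exact: continuous_subspaceT.
have bh' s t : p <= s -> t <= q -> bmf `[s, t] h.
  by move=> ps tq; apply: bmfS bh => //; exact: pqab.
have bg' s t : p <= s -> t <= q -> bmf `[s, t] g.
  by move=> ps tq; apply: bmfS bg => //; exact: pqab.
rewrite (@Rintegral_subset _ (measurableTypeR R) R leb _ `[p, q]); first last.
- move=> x _ /= xpq; rewrite phi0 ?mul0r//; apply/negP => /andP[px xq].
  by apply: xpq; rewrite in_itv/= !ltW.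
- exact: pqab.
rewrite [in RHS](@Rintegral_subset _ (measurableTypeR R) R leb _ `[p, q]); first last.
- move=> x _ /= xpq; rewrite dphi0 ?mul0r//; apply/negP => /andP[px xq].
  by apply: xpq; rewrite in_itv/= px.
- exact: pqab.
pose G x := phi x * h x + derive1 phi x * g x.
have bG s t : p <= s -> t <= q -> bmf `[s, t] G.
  by move=> ps tq; apply: bmfD; apply: bmfM; (exact: bmfC || exact: bh' || exact: bg').
have [B Bphi] := (bmfC _ p q sdphi).2.
have [N hN] := (bh' p q (lexx _) (lexx _)).2.
have pp : p \in `[p, q] by rewrite in_itv/= lexx.
have B0 : 0 <= B := le_trans (normr_ge0 _) (Bphi p pp).
have N0 : 0 <= N := le_trans (normr_ge0 _) (hN p pp).
have phi_lip s t : p <= s -> s <= t -> t <= q -> `|phi t - phi s| <= B * (t - s).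
  move=> ps st tq; rewrite -Rintegral_derive//; apply: norm_Rintegral_cc_le => //.
    exact: (bmfC _ _ _ _).1.
  by move=> x /andP[sx xt]; apply: Bphi; rewrite /= in_itv/= (le_trans ps) ?(le_trans xt).
have g_lip s t : p <= s -> s <= t -> t <= q -> `|g t - g s| <= N * (t - s).
  move=> ps st tq; rewrite gh ?(lt_le_trans ap) ?(le_lt_trans tq)//.
  apply: norm_Rintegral_cc_le => //; first exact: (bh' _ _ _ _).1.
  by move=> x /andP[sx xt]; apply: hN; rewrite /= in_itv/= (le_trans ps) ?(le_trans xt).
pose I s t := \int[leb]_(x in `[s, t]) G x - (phi t * g t - phi s * g s).
have I0 : I p q = 0.
  apply: (@additive_quadratic_eq0 I p q (2 * B * N)) => // [r s t pr rs st tq|s t ps st tq].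
    by rewrite /I (@Rintegral_split r s t)//; [ring|exact: bG].
  have sh := bh' _ _ ps tq; have sg := bg' _ _ ps tq.
  have sG := bG _ _ ps tq.
  have sf := bmfC _ s t sphi; have sdf := bmfC _ s t sdphi.
  have int := fun f (bf : bmf `[s, t] f) => bmf_itv_integrable bf.
  have -> : I s t = \int[leb]_(x in `[s, t])
      ((phi x - phi s) * h x + derive1 phi x * (g x - g t)).
    have -> : \int[leb]_(x in `[s, t])
        ((phi x - phi s) * h x + derive1 phi x * (g x - g t)) =
      \int[leb]_(x in `[s, t]) (G x - (phi s * h x + g t * derive1 phi x)).
      by apply: eq_Rintegral => x _; rewrite /G; ring.
    have b1 : bmf `[s, t] (fun x => phi s * h x) by apply: bmfM => //; exact: bmf_cst.
    have b2 : bmf `[s, t] (fun x => g t * derive1 phi x) by apply: bmfM => //; exact: bmf_cst.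
    rewrite RintegralB//; try exact: int; last by apply: int; exact: bmfD.
    rewrite [X in _ = _ - X]RintegralD//; try exact: int.
    rewrite !RintegralZl//; try exact: int.
    rewrite Rintegral_derive// -gh ?(lt_le_trans ap) ?(le_lt_trans tq)//.
    by rewrite /I; ring.
  rewrite expr2 mulrA; apply: norm_Rintegral_cc_le => //.
    apply: measurable_funD; apply: measurable_funM; try apply: measurable_funB => //.
    - exact: sf.1.
    - exact: sh.1.
    - exact: sdf.1.
    - exact: sg.1.
  move=> x /andP[sx xt]; rewrite (le_trans (ler_normD _ _))// !normrM.
  have px := le_trans ps sx; have xq := le_trans xt tq.
  have xI : x \in `[p, q] by rewrite in_itv/= px.
  have H1 : `|phi x - phi s| * `|h x| <= B * (t - s) * N.
    rewrite ler_pM ?hN// (le_trans (phi_lip _ _ _ _ _))// ler_wpM2l// lerB//.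
  have H2 : `|derive1 phi x| * `|g x - g t| <= B * (N * (t - s)).
    rewrite ler_pM ?Bphi// distrC (le_trans (g_lip _ _ _ _ _))// ler_wpM2l// lerB//.
  by apply: (le_trans (lerD H1 H2)); rewrite le_eqVlt; apply/orP; left; apply/eqP; ring.
have pq1 := lexx p; have pq2 := lexx q.
have := I0; rewrite /I !phi0 ?ltxx ?andbF// !mul0r !subr0 /G RintegralD//.
- by move=> /eqP; rewrite addr_eq0 => /eqP.
- by apply: bmf_itv_integrable; apply: bmfM; [exact: bmfC|exact: bh'].
- by apply: bmf_itv_integrable; apply: bmfM; [exact: bmfC|exact: bg'].
Unshelve. all: by end_near. Qed.

End interval_integrals.

Section weak_derivative.
Context (R : realType).
Local Notation leb := (@lebesgue_measure R).
Local Notation bmf := (@bmf _ (measurableTypeR R) R).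
Implicit Types (a b s t : R) (g h phi : R -> R) (delta : nat -> R).

Lemma derive_rise_eq0 s e x : 0 < e -> ~~ (s <= x <= s + e) ->
  derive1 (rise s e) x = 0.
Proof.
move=> e0; rewrite negb_and -!ltNge derive_rise => /orP[xs|xs].
  by rewrite derive_step0 ?mul0r//; left; rewrite pmulr_llt0 ?invr_gt0// subr_lt0.
rewrite derive_step0 ?mul0r//; right.
by rewrite ltr_pdivlMr// mul1r ltrBrDl.
Qed.

(** The derivatives of steps of vanishing width at [s] form an approximate
identity. *)
Lemma rise_average a b s g delta : a < s -> s < b -> bmf `]a, b[ g ->
  {for s, continuous g} -> (forall n, 0 < delta n) ->
  (forall n, s + delta n < b) -> delta @ \oo --> 0 ->
  \int[leb]_(x in `]a, b[) (derive1 (rise s (delta n)) x * g x)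
    @[n --> \oo] --> g s.
Proof.
move=> as_ sb bg cg d0 db dcvg; apply/cvgrPdist_le => /= eps eps0.
have [C C0 CP] := @derive_step_bounded R.
have C1 : 0 < C + 1 by rewrite ltr_pwDr.
move/cvgrPdist_le : cg => /(_ (eps / (C + 1)) (divr_gt0 eps0 C1)) [r /= r0 rP].
near=> n; set e := delta n.
have e0 : 0 < e by exact: d0.
have er : e < r.
  have : `|0 - delta n| < r by near: n; move/cvgrPdist_lt : dcvg; exact.
  by rewrite sub0r normrN gtr0_norm.
have se : s <= s + e by rewrite lerDl ltW.
have sub : `[s, s + e] `<=` `]a, b[.
  move=> x /=; rewrite !in_itv/= => /andP[sx xe].
  by rewrite (lt_le_trans as_)// (le_lt_trans xe (db n)).
have bg' : bmf `[s, s + e] g by exact: bmfS bg.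
have bd : bmf `[s, s + e] (derive1 (rise s e)).
  apply: bmf_continuous; apply: continuous_subspaceT.
  exact/smooth_continuous/smooth_derive1/smooth_rise.
rewrite (@Rintegral_subset _ (measurableTypeR R) R leb _ `[s, s + e])//; last first.
  move=> x _ /= xs; rewrite derive_rise_eq0 ?mul0r//.
  by apply/negP => H; apply: xs; rewrite in_itv.
have -> : g s = \int[leb]_(x in `[s, s + e]) (g s * derive1 (rise s e) x).
  rewrite RintegralZl//; last exact: bmf_itv_integrable.
  rewrite Rintegral_derive//; last exact: smooth_rise.
  by rewrite (rise_le e0 (lexx s)) (rise_ge e0 (lexx _)) subr0 mulr1.
rewrite -RintegralB//; last 2 first.
- by apply: bmf_itv_integrable; apply: bmfM => //; exact: bmf_cst.
- by apply: bmf_itv_integrable; exact: bmfM.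
apply: (@le_trans _ _ (C / e * (eps / (C + 1)) * (s + e - s))).
  apply: norm_Rintegral_cc_le => //.
    apply: measurable_funB; apply: measurable_funM => //; [exact: bd.1|exact: bd.1|exact: bg'.1].
  move=> x /andP[sx xe]; rewrite mulrC -mulrBr normrM ler_pM//.
    rewrite derive_rise normrM [X in _ * X]ger0_norm; last by rewrite invr_ge0 ltW.
    by rewrite ler_wpM2r// invr_ge0 ltW.
  apply: rP; rewrite /ball_/= distrC ger0_norm ?subr_ge0//.
  by rewrite (le_lt_trans _ er)// lerBlDl.
have -> : C / e * (eps / (C + 1)) * (s + e - s) = eps * (C / (C + 1)).
  by field; rewrite !gt_eqF.
by rewrite ler_piMr ?(ltW eps0)// ler_pdivrMr// mul1r lerDl.
Unshelve. all: by end_near. Qed.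

Lemma rise_test a b s t e : a < s -> s <= t -> 0 < e -> t + e < b ->
  test_function `]a, b[%classic (fun x => rise s e x - rise t e x).
Proof.
move=> as_ st e0 tb; split.
  rewrite (_ : (fun x => _) = fun x => rise s e x + (-1) * rise t e x); last first.
    by apply/funext => x; rewrite mulN1r.
  apply: smoothD; first exact: smooth_rise.
  by apply: smoothM; [exact: smooth_cst|exact: smooth_rise].
exists `[s, t + e]%classic; split; first exact: segment_compact.
  move=> x /=; rewrite !in_itv/= => /andP[sx xt].
  by rewrite (lt_le_trans as_)// (le_lt_trans xt).
move=> x /=; rewrite in_itv/= => /negP; rewrite negb_and -!ltNge => /orP[xs|tx].
  by rewrite !rise_le ?subrr ?(le_trans (ltW xs))// ltW.
by rewrite !rise_ge ?subrr ?(ltW tx)// (le_trans _ (ltW tx))// lerD2r.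
Qed.

(** Test with differences of steps of vanishing width at [s] and [t]: one side
tends to [g t - g s] by [rise_average], the other one to the integral. *)
Lemma weak_ftc a b g h : bmf `]a, b[ h -> bmf `]a, b[ g ->
  {in `]a, b[, continuous g} ->
  (forall phi, test_function `]a, b[%classic phi ->
     \int[leb]_(x in `]a, b[) (derive1 phi x * g x) =
     - \int[leb]_(x in `]a, b[) (phi x * h x)) ->
  forall s t, a < s -> s <= t -> t < b ->
    g t - g s = \int[leb]_(x in `[s, t]) h x.
Proof.
move=> bh bg cg weak s t as_; rewrite le_eqVlt => /predU1P[-> tb|st tb].
  by rewrite Rintegral_cc_ge// subrr.
have [M hM] := bh.2.
(* Widths for which the two steps are disjoint and fit in ]a, b[. *)
pose D := Num.min (b - t) (t - s).
have D0 : 0 < D by rewrite lt_min !subr_gt0 tb.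
pose delta (n : nat) : R := D / n.+2%:R.
have d0 n : 0 < delta n by rewrite divr_gt0.
have dD n : delta n < D by rewrite ltr_pdivrMr// ltr_pMr// ltr1n.
have dbt n : t + delta n < b.
  by rewrite -ltrBrDl (lt_le_trans (dD n))// ge_min lexx.
have dts n : s + delta n < t.
  by rewrite -ltrBrDl (lt_le_trans (dD n))// ge_min lexx orbT.
have dcvg : delta @ \oo --> 0.
  rewrite -(mulr0 D); apply: cvgM; first exact: cvg_cst.
  by have /(cvg_comp _ _ (cvg_addnr 1)) := @cvg_harmonic R; under eq_fun do rewrite addn1.
have bphi n : bmf `]a, b[ (fun x => rise s (delta n) x - rise t (delta n) x).
  exact/bmf_smooth/(rise_test as_ (ltW st) (d0 n) (dbt n)).1.
have bdr n r : bmf `]a, b[ (derive1 (rise r (delta n))).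
  exact/bmf_smooth/smooth_derive1/smooth_rise.
have lim1 : \int[leb]_(x in `]a, b[)
    ((rise s (delta n) x - rise t (delta n) x) * h x) @[n --> \oo] --> g t - g s.
  have E n : \int[leb]_(x in `]a, b[)
      ((rise s (delta n) x - rise t (delta n) x) * h x) =
      \int[leb]_(x in `]a, b[) (derive1 (rise t (delta n)) x * g x) -
      \int[leb]_(x in `]a, b[) (derive1 (rise s (delta n)) x * g x).
    have := weak _ (rise_test as_ (ltW st) (d0 n) (dbt n)).
    move/eqP; rewrite -eqr_oppLR => /eqP <-.
    rewrite -opprB; congr (- _); rewrite -RintegralB//; last 2 first.
    - by apply: bmf_itv_integrable; exact: bmfM.
    - by apply: bmf_itv_integrable; exact: bmfM.
    apply: eq_Rintegral => x _; rewrite -mulrBl; congr (_ * _).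
    rewrite !derive1E deriveB//; exact/smooth_derivable/smooth_rise.
  under eq_fun do rewrite E.
  apply: cvgB.
    apply: rise_average => //; first exact: (lt_trans as_).
    by apply: cg; rewrite in_itv/= (lt_trans as_).
  apply: rise_average => //; first exact: (lt_trans st).
    by apply: cg; rewrite in_itv/= as_ (lt_trans st).
  by move=> n; rewrite (lt_trans (dts n)).
have lim2 : \int[leb]_(x in `]a, b[)
    ((rise s (delta n) x - rise t (delta n) x) * h x) @[n --> \oo] -->
    \int[leb]_(x in `[s, t]) h x.
  apply/cvgrPdist_le => /= eps eps0.
  have M1 : 0 < 3 * (`|M| + 1) by rewrite mulr_gt0// ltr_pwDr.
  near=> n; pose e := delta n; pose phi x := rise s e x - rise t e x.
  have e0 : 0 < e := d0 n; have ste : s + e < t := dts n.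
  have tbe : t + e < b := dbt n.
  have en : e <= eps / (3 * (`|M| + 1)).
    have : `|0 - delta n| <= eps / (3 * (`|M| + 1)).
      by near: n; move/cvgrPdist_le : dcvg; apply; rewrite divr_gt0.
    by rewrite sub0r normrN gtr0_norm.
  have sub p q : a < p -> q < b -> `[p, q] `<=` `]a, b[.
    move=> ap qb x /=; rewrite !in_itv/= => /andP[px xq].
    by rewrite (lt_le_trans ap)// (le_lt_trans xq).
  have bh' p q : a < p -> q < b -> bmf `[p, q] h.
    by move=> ap qb; apply: bmfS bh => //; exact: sub.
  have bp' p q : a < p -> q < b -> bmf `[p, q] (fun x => phi x * h x).
    move=> ap qb; apply: bmfM; last exact: bh'.
    by apply: bmfS (bphi n) => //; exact: sub.
  have ae : a < s + e by rewrite (lt_trans as_)// ltrDl.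
  have at_ := lt_trans as_ st.
  rewrite (@Rintegral_subset _ (measurableTypeR R) R leb `]a, b[ `[s, t + e]); first last.
  - move=> x _ xs; rewrite [X in X * _](_ : _ = 0) ?mul0r//.
    move/negP : xs; rewrite /= in_itv/= negb_and -!ltNge => /orP[xls|ltx].
      by rewrite !rise_le ?subrr ?(le_trans (ltW xls)) ?(ltW st)// ltW.
    by rewrite !rise_ge ?subrr// ?(ltW ltx)// (le_trans _ (ltW ltx))// lerD2r ltW.
  - exact: sub.
  have se_ : s <= s + e by rewrite lerDl ltW.
  have te_ : t <= t + e by rewrite lerDl ltW.
  rewrite -/(phi _) (@Rintegral_split _ s (s + e) (t + e))//; last 2 first.
  - by rewrite lerD2r ltW.
  - exact: bp'.
  rewrite (@Rintegral_split _ (s + e) t (t + e)) ?(ltW ste)//; last exact: bp'.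
  rewrite (@Rintegral_split _ s (s + e) t) ?(ltW ste)//; last exact: bh'.
  rewrite (_ : \int[leb]_(x in `[s + e, t]) (phi x * h x) =
    \int[leb]_(x in `[s + e, t]) h x); last first.
    apply: eq_Rintegral => x; rewrite inE/= in_itv/= => /andP[sx xt].
    by rewrite /phi rise_ge// rise_le// subr0 mul1r.
  have hle p q x : a < p -> q < b -> p <= x <= q -> `|h x| <= `|M| + 1.
    move=> ap qb pxq; rewrite (le_trans (hM x _))//.
      by apply: (sub p q) => //=; rewrite in_itv.
    by rewrite (le_trans (ler_norm M))// lerDl.
  have ple x : `|phi x| <= 1.
    have /andP[? ?] := rise_itv s e x.
    by have /andP[? ?] := rise_itv t e x; rewrite ler_norml; apply/andP; split; rewrite /phi; lra.
  have I1 : `|\int[leb]_(x in `[s, s + e]) (phi x * h x)| <= (`|M| + 1) * e.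
    rewrite [X in _ * X](_ : e = s + e - s); last by ring.
    apply: norm_Rintegral_cc_le => //; first by apply: (bp' _ _ _ _).1; rewrite ?(lt_trans ste).
    move=> x xs; rewrite normrM -[leRHS]mul1r ler_pM//.
    by apply: hle xs => //; rewrite (lt_trans ste).
  have I2 : `|\int[leb]_(x in `[s, s + e]) h x| <= (`|M| + 1) * e.
    rewrite [X in _ * X](_ : e = s + e - s); last by ring.
    apply: norm_Rintegral_cc_le => //; first by apply: (bh' _ _ _ _).1; rewrite ?(lt_trans ste).
    by move=> x; apply: hle => //; rewrite (lt_trans ste).
  have I3 : `|\int[leb]_(x in `[t, t + e]) (phi x * h x)| <= (`|M| + 1) * e.
    rewrite [X in _ * X](_ : e = t + e - t); last by ring.
    apply: norm_Rintegral_cc_le => //; first exact: (bp' _ _ _ _).1.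
    move=> x xs; rewrite normrM -[leRHS]mul1r ler_pM//.
    by apply: hle xs.
  have : 3 * (`|M| + 1) * e <= eps by rewrite mulrC -ler_pdivlMr.
  move: I1 I2 I3; rewrite !ler_norml => /andP[? ?] /andP[? ?] /andP[? ?] ?.
  by apply/andP; split; lra.
exact: (cvg_unique _ lim1 lim2).
Unshelve. all: by end_near. Qed.

End weak_derivative.

(** * The second mean value inequality *)

Section monotone_kernel.
Context (R : realType).
Local Notation leb := (@lebesgue_measure R).
Local Notation bmf := (@bmf _ (measurableTypeR R) R).
Implicit Types (a b c s t y m kappa : R) (h k : R -> R).

(** A Riemann sum for the integral of the indicator function of [0, y[. *)
Lemma count_lt (n : nat) y : 0 <= y -> y <= n%:R ->
  (y <= \sum_(j < n) (j%:R < y)%R%:R :> R) /\ (\sum_(j < n) (j%:R < y)%R%:R <= y + 1 :> R).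
Proof.
move=> y0; elim: n => [|n IH] yn.
  by rewrite big_ord0 addr_ge0.
rewrite big_ord_recr/=; have [ny|yn'] := ltP n%:R y; last by rewrite addr0; exact: IH.
have -> : \sum_(j < n) (j%:R < y)%R%:R = n%:R :> R.
  rewrite (eq_bigr (fun=> 1)); first by rewrite sumr_const card_ord.
  by move=> j _; rewrite (le_lt_trans _ ny)// ler_nat ltnW.
by rewrite natr1; split => //; rewrite -natr1 lerD2r ltW.
Qed.

(** The primitives of [h] are only controlled from base points before [c], after
which [k] is constant, equal to [kappa]. *)
Section mean_value.
Variables (a b c kappa m : R) (h k : R -> R).
Hypotheses (ac : a <= c) (cb : c <= b) (bh : bmf `[a, b] h)
  (k_ge0 : forall x, a <= x <= b -> 0 <= k x)
  (k_nd : forall x y, a <= x -> x <= y -> y <= b -> k x <= k y)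
  (k_cb : forall x, c <= x <= b -> k x = kappa)
  (mk : measurable_fun `[a, b] k)
  (hm : forall s, a <= s -> s <= c -> m <= \int[leb]_(x in `[s, b]) h x).

Let k_le x : a <= x <= b -> k x <= kappa.
Proof.
move=> /andP[ax xb]; rewrite -(@k_cb b); last by rewrite cb lexx.
exact: k_nd.
Qed.

Let level y x : R := (y < k x)%R%:R.

Let blevel y : bmf `[a, b] (level y).
Proof.
split; last first.
  by exists 1 => x _; rewrite /level; case: (_ < _); rewrite ?normr1 ?normr0.
apply: (@measurableT_comp _ _ _ (measurableTypeR R) bool (measurableTypeR R)
  (fun b : bool => b%:R : R) `[a, b] (fun x => y < k x)) => //.
exact: measurable_fun_ltr.
Qed.

(* The superlevel sets of [k] are intervals ending at [b]. *)
Let level_ge y : y < kappa -> m <= \int[leb]_(x in `[a, b]) (level y x * h x).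
Proof.
move=> ykappa; pose S := [set s | a <= s <= b /\ y < k s].
have Sc : S c by split; [rewrite ac cb|rewrite k_cb ?cb ?lexx].
have Sa : lbound S a by move=> s [/andP[]].
have hS : has_inf S by split; [exists c|exists a].
pose sg := inf S.
have asg : a <= sg by apply: lb_le_inf => //; exists c.
have sgc : sg <= c by apply: ge_inf => //; exists a.
have sgb := le_trans sgc cb.
have bf : bmf `[a, b] (fun x => level y x * h x) by apply: bmfM => //; exact: blevel.
have bf1 : bmf `[a, sg] (fun x => level y x * h x).
  by apply: bmfS bf => //; apply: subset_itvl; rewrite bnd_simp.
have bf2 : bmf `[sg, b] (fun x => level y x * h x).
  by apply: bmfS bf => //; apply: subset_itvr; rewrite bnd_simp.
have bh2 : bmf `[sg, b] h.
  by apply: bmfS bh => //; apply: subset_itvr; rewrite bnd_simp.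
have mo f s t : bmf `[s, t] f -> measurable_fun `]s, t[ f.
  by move=> bf'; apply: measurable_funS bf'.1 => //; exact: subset_itv_oo_cc.
rewrite (@Rintegral_split _ a sg b)//.
have -> : \int[leb]_(x in `[a, sg]) (level y x * h x) = 0.
  transitivity (\int[leb]_(x in `[a, sg]) (cst 0 x : R)); last first.
    by rewrite Rintegral_cst// mul0r.
  rewrite /Rintegral; congr fine; apply: eq_integral_itv_bounded => //; first exact: mo.
  move=> x; rewrite in_itv/= => /andP[ax xsg].
  rewrite /level; case: ltP => [yk|_]; last by rewrite mul0r.
  have : sg <= x.
    apply: ge_inf; first by exists a.
    by split => //; rewrite (ltW ax) (le_trans (ltW xsg)).
  by rewrite leNgt xsg.
rewrite add0r.
suff -> : \int[leb]_(x in `[sg, b]) (level y x * h x) = \int[leb]_(x in `[sg, b]) h x.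
  exact: hm.
rewrite /Rintegral; congr fine; apply: eq_integral_itv_bounded; [exact: mo..|].
move=> x; rewrite in_itv/= => /andP[sgx xb].
have [s [/andP[as_ sb] yks] sx] := inf_lt (ex_intro _ c Sc) sgx.
rewrite /level (lt_le_trans yks) ?mul1r//; apply: k_nd => //; exact: ltW.
Qed.

(** Second mean value inequality: [k] is an average of the indicator functions
of its superlevel sets. *)
Lemma second_mean_value : kappa * m <= \int[leb]_(x in `[a, b]) (k x * h x).
Proof.
have ab := le_trans ac cb.
have [M hM] := bh.2.
have M0 : 0 <= M by apply: le_trans (hM a _) => //; rewrite /= in_itv/= lexx.
have kappa0 : 0 <= kappa by rewrite -(@k_cb b) ?k_ge0 ?lexx ?ab ?cb.
move: kappa0; rewrite le_eqVlt => /predU1P[k0|kappa0].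
  rewrite -k0 mul0r (@eq_Rintegral _ _ _ _ _ (fun=> 0)); first by rewrite Rintegral_cst// mul0r.
  move=> x; rewrite inE/= in_itv/= => xab.
  have := k_le xab; have := k_ge0 xab; rewrite -k0 => k1 k2.
  by rewrite (_ : k x = 0) ?mul0r//; apply/eqP; rewrite eq_le k1 k2.
have bk : bmf `[a, b] k.
  split => //; exists kappa => x /=; rewrite in_itv/= => xab.
  by rewrite ger0_norm ?k_le ?k_ge0.
have H (n : nat) : kappa * m <=
    \int[leb]_(x in `[a, b]) (k x * h x) + kappa * M * (b - a) / n.+1%:R.
  (* e times the number of j <= n such that e * j < k x approximates k x to
     within e. *)
  pose e := kappa / n.+1%:R.
  have e0 : 0 < e by rewrite divr_gt0.
  have bF (j : 'I_n.+1) : bmf `[a, b] (fun x => level (e * j%:R) x * h x).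
    exact: bmfM (blevel _) bh.
  have bS : bmf `[a, b] (fun x => \sum_(j < n.+1) level (e * j%:R) x * h x).
    exact: bmf_sum_ord.
  have -> : kappa * m = e * \sum_(j < n.+1) m.
    by rewrite sumr_const card_ord -[X in e * X]mulr_natl /e mulrA divfK.
  apply: (@le_trans _ _ (e * \int[leb]_(x in `[a, b])
     (\sum_(j < n.+1) level (e * j%:R) x * h x))).
    apply: ler_wpM2l; first exact: ltW.
    rewrite (Rintegral_sum _ (fun j => bmf_itv_integrable (bF j))).2//.
    apply: ler_sum => j _; apply: level_ge.
    by rewrite /e mulrAC ltr_pdivrMr// ltr_pM2l// ltr_nat.
  rewrite -lerBlDl -RintegralZl//; last exact: bmf_itv_integrable.
  rewrite -RintegralB//; last 2 first.
  - by apply: bmf_itv_integrable; apply: bmfM => //; exact: bmf_cst.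
  - by apply: bmf_itv_integrable; exact: bmfM.
  apply: (le_trans (ler_norm _)).
  have -> : kappa * M * (b - a) / n.+1%:R = e * M * (b - a) by rewrite /e; field.
  apply: norm_Rintegral_cc_le => //.
    apply: measurable_funB; first by apply: measurable_funM => //; exact: bS.1.
    exact: (bmfM bk bh).1.
  move=> x xab; rewrite -mulr_suml mulrA -mulrBl normrM ler_pM ?hM//.
  have kx0 := k_ge0 xab; have kx1 := k_le xab.
  have := @count_lt n.+1 (k x / e) (divr_ge0 kx0 (ltW e0)).
  have kxe : k x / e <= n.+1%:R by rewrite ler_pdivrMr// /e mulrC divfK.
  move=> /(_ kxe).
  rewrite (eq_bigr (fun j : 'I_n.+1 => level (e * j%:R) x)); last first.
    by move=> j _; rewrite /level ltr_pdivlMr// mulrC.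
  rewrite ler_pdivrMr// -[k x / e + 1](_ : (k x + e) / e = _); last first.
    by field; rewrite gt_eqF.
  rewrite ler_pdivlMr// => -[]; set S := \sum_(j < _) _.
  move=> S1 S2; rewrite ler_norml mulrC; apply/andP; split; lra.
apply/ler_addgt0Pr => eps eps0.
have Ce : 0 <= kappa * M * (b - a) / eps.
  by rewrite divr_ge0 ?(ltW eps0)// mulr_ge0 ?subr_ge0// mulr_ge0// ltW.
rewrite (le_trans (H (Num.bound (kappa * M * (b - a) / eps))))// lerD2l.
rewrite ler_pdivrMr// -ler_pdivrMl// mulrC (le_trans (ltW (archi_boundP Ce)))//.
by rewrite ler_nat.
Qed.

End mean_value.
End monotone_kernel.

(** * The singular kernel *)

Section improper.
Context (R : realType).
Local Notation leb := (@lebesgue_measure R).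
Implicit Types (a b s t x y alpha z C : R) (f F : R -> R).

(** Exhaust the open interval by segments, on which the fundamental theorem of
calculus applies, and pass to the limit by monotone convergence. *)
Lemma improper_le a b f F C : a < b -> (forall x, a < x < b -> 0 <= f x) ->
  {in `]a, b[, continuous f} ->
  (forall x : R, a < x < b -> is_derive x 1 F (f x)) ->
  (forall x y, a < x -> x < y -> y < b -> F y - F x <= C) ->
  (\int[leb]_(x in `]a, b[) (f x)%:E <= C%:E)%E.
Proof.
move=> ab f0 cf dF FC.
pose e (i : nat) : R := (b - a) / i.+3%:R.
have ba0 : 0 < b - a by rewrite subr_gt0.
have e0 i : 0 < e i by rewrite divr_gt0.
have eab i : a + e i < b - e i.
  have e3 : 3 * e i <= b - a.
    by rewrite /e mulrCA ler_piMr ?(ltW ba0)// ler_pdivrMr// mul1r ler_nat.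
  have := e0 i; lra.
pose S i : set R := [set` `[a + e i, b - e i]].
have Sab i x : S i x -> a < x < b.
  rewrite /S/= in_itv/= => /andP[ax xb]; apply/andP; split.
    by apply: lt_le_trans ax; rewrite ltrDl.
  by apply: le_lt_trans xb _; rewrite ltrBlDr ltrDl.
have mf i : measurable_fun (S i) f.
  apply: (@measurable_funS _ _ _ _ [set` `]a, b[]) => //.
    by move=> x /Sab; rewrite /= in_itv.
  by apply: open_continuous_measurable_fun => // x; rewrite inE => ?; exact: cf.
have Sint i : (\int[leb]_(x in S i) (f x)%:E <= C%:E)%E.
  have dFx x : S i x -> is_derive x 1 F (f x) by move=> /Sab; exact: dF.
  have ae_ : S i (a + e i) by rewrite /S/= in_itv/= lexx ltW.
  have be_ : S i (b - e i) by rewrite /S/= in_itv/= lexx ltW.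
  have cF x : S i x -> {for x, continuous F}.
    move=> /dFx [dF' _]; exact/differentiable_continuous/derivable1_diffP.
  rewrite (@continuous_FTC2 _ _ F)//.
  - rewrite -EFinB lee_fin; apply: FC => //.
      by have /andP[] := Sab _ _ ae_.
    by have /andP[] := Sab _ _ be_.
  - apply: continuous_in_subspaceT => x; rewrite inE => /Sab xab.
    by apply: cf; rewrite in_itv.
  - split=> [x xS||].
    + have xSi : S i x by apply: subset_itv_oo_cc.
      by have [] := dFx x xSi.
    + exact/cvg_at_right_filter/cF.
    + exact/cvg_at_left_filter/cF.
  - move=> x xS; have xSi : S i x by apply: subset_itv_oo_cc.
    by rewrite derive1E; have [_ ->] := dFx x xSi.
have -> : [set` `]a, b[] = \bigcup_i S i.
  apply/seteqP; split=> [x|x [i _ /Sab]]; rewrite /= in_itv/= // => /andP[ax xb].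
  pose m := Num.min (x - a) (b - x).
  have m0 : 0 < m by rewrite lt_min !subr_gt0 ax.
  have q0 : 0 <= (b - a) / m by rewrite divr_ge0 ?ltW.
  exists (Num.bound ((b - a) / m)) => //.
  have em : e (Num.bound ((b - a) / m)) <= m.
    rewrite /e ler_pdivrMr// -ler_pdivrMl// mulrC (le_trans (ltW (archi_boundP q0)))//.
    by rewrite ler_nat; do 3 apply: leqW.
  have := em; rewrite le_min => /andP[e1 e2].
  by rewrite /S/= in_itv/=; apply/andP; split; lra.
have ndS : nondecreasing_seq S.
  move=> i j ij; apply/subsetPset; apply: subset_itv; rewrite bnd_simp.
    by rewrite lerD2l /e ler_pM2l// lef_pV2// ?posrE// ler_nat.
  by rewrite lerD2l lerN2 /e ler_pM2l// lef_pV2// ?posrE// ler_nat.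
have := @ge0_nondecreasing_set_cvg_integral _ (measurableTypeR R) R S (EFin \o f) leb ndS.
move=> /(_ _ _ _) cv.
rewrite -(cvg_lim _ (cv _ _ _))//; first last.
- by move=> i x /Sab; rewrite lee_fin; exact: f0.
- by move=> i; apply/measurable_EFinP; exact: mf.
- by move=> i; exact: measurable_itv.
- apply: lime_le; last exact: nearW.
  apply/cvg_ex; eexists; apply: cv => //.
  + by move=> i; exact: measurable_itv.
  + by move=> i; apply/measurable_EFinP; exact: mf.
  + by move=> i x /Sab; rewrite lee_fin; exact: f0.
Qed.

Definition ker alpha t s : R := (t - s) `^ (- alpha).

Lemma ker_ge0 alpha t s : 0 <= ker alpha t s.
Proof. exact: powR_ge0. Qed.

Lemma ker_gt0 alpha t s : s < t -> 0 < ker alpha t s.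
Proof. by move=> st; rewrite powR_gt0// subr_gt0. Qed.

Lemma ker_nd alpha t x y : 0 < alpha -> x <= y -> y < t ->
  ker alpha t x <= ker alpha t y.
Proof.
move=> a0 xy yt; rewrite /ker !powRN.
have ty : 0 < t - y by rewrite subr_gt0.
have tx : 0 < t - x by rewrite subr_gt0 (le_lt_trans xy).
rewrite lef_pV2 ?posrE ?powR_gt0//; apply: ge0_ler_powR; rewrite ?nnegrE; [exact: ltW|exact: ltW|exact: ltW|lra].
Qed.

Lemma measurable_ker alpha t (D : set R) : measurable_fun D (ker alpha t).
Proof.
apply: measurable_funTS; apply: (measurableT_comp (measurable_powR _)) => //.
exact: measurable_funB.
Qed.

Lemma powR_continuous_at z x : 0 < x -> {for x, continuous (@powR R ^~ z)}.
Proof.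
move=> x0; apply/differentiable_continuous/derivable1_diffP.
by have [] := is_derive1_powR z x0.
Qed.

Lemma powR_exp_gt0 z x : 0 < x -> x `^ z / x = x `^ (z - 1).
Proof. by move=> x0; rewrite powRB ?(gt_eqF x0) ?implybT// powRr1// ltW. Qed.

(** A primitive of the kernel is - (t - s)^(1 - alpha) / (1 - alpha). *)
Lemma ker_integral_le alpha a t : alpha < 1 -> a < t ->
  (\int[leb]_(s in `]a, t[) (ker alpha t s)%:E <=
    ((t - a) `^ (1 - alpha) / (1 - alpha))%:E)%E.
Proof.
move=> a1 at_; have a10 : 0 < 1 - alpha by rewrite subr_gt0.
apply: (@improper_le _ _ _ (fun s => - ((1 - alpha)^-1 * (t - s) `^ (1 - alpha)))) => //.
- by move=> x _; exact: ker_ge0.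
- move=> x; rewrite in_itv/= => /andP[ax xt].
  apply: (@continuous_comp _ _ _ (fun s => t - s) (@powR R ^~ (- alpha))).
    by apply: cvgB; [exact: cvg_cst|exact: cvg_id].
  by apply: powR_continuous_at; rewrite subr_gt0.
- move=> x /andP[ax xt].
  have tx0 : 0 < t - x by rewrite subr_gt0.
  have d1 : is_derive x 1 (fun s : R => t - s) (0 - 1) by exact: is_deriveB.
  have d2 := @is_derive1_comp R (@powR R ^~ (1 - alpha)) (fun s => t - s) x _ _
    (is_derive1_powR (1 - alpha) tx0) d1.
  have d3 : is_derive x 1 (fun s : R => - ((1 - alpha)^-1 * (t - s) `^ (1 - alpha)))
    (- ((1 - alpha)^-1 *: ((1 - alpha) * (t - x) `^ (1 - alpha - 1) * (0 - 1)))).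
    exact: is_deriveN.
  apply: (is_derive_eq d3).
  rewrite /ker (_ : 1 - alpha - 1 = - alpha); last by ring.
  by rewrite /GRing.scale/=; field; rewrite gt_eqF.
- move=> x y ax xy yt; rewrite opprK.
  have tx : 0 <= t - x by rewrite subr_ge0 ltW// (lt_trans xy).
  have ty : 0 <= t - y by rewrite subr_ge0 ltW.
  have H1 : (t - x) `^ (1 - alpha) <= (t - a) `^ (1 - alpha).
    apply: ge0_ler_powR; rewrite ?nnegrE ?(ltW a10)//.
      by rewrite subr_ge0 ltW.
    by rewrite lerD2l lerN2 ltW.
  have H2 := powR_ge0 (t - y) (1 - alpha).
  rewrite addrC -mulrBr mulrC ler_pM2r ?invr_gt0//; lra.
Qed.

Lemma ker_integrable alpha a t : alpha < 1 -> a < t ->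
  leb.-integrable `]a, t[ (EFin \o ker alpha t).
Proof.
move=> a1 at_; apply/integrableP; split.
  by apply/measurable_EFinP; exact: measurable_ker.
apply: (@le_lt_trans _ _ (\int[leb]_(s in `]a, t[) (ker alpha t s)%:E)%E).
  rewrite le_eqVlt; apply/orP; left; apply/eqP/eq_integral => x _ /=.
  by rewrite ger0_norm// ker_ge0.
by apply: le_lt_trans (ker_integral_le a1 at_) _; rewrite ltry.
Qed.

(** The integral must be shown to be finite for its real value to be positive: the
integrand is at most s^(z - 1) on ]0, 1[ and exp(-s) after 1. *)
Lemma Gamma_gt0 z : 0 < z -> z <= 1 -> 0 < Gamma z.
Proof.
move=> z0 z1; pose f s : R := s `^ (z - 1) * expR (- s).
have f0 s : 0 <= f s by rewrite mulr_ge0 ?powR_ge0 ?expR_ge0.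
have mpow (D : set R) : measurable_fun D (@powR R ^~ (z - 1)).
  by apply: measurable_funTS; exact: measurable_powR.
have mf (D : set R) : measurable_fun D f.
  apply: measurable_funM => //; apply: (measurableT_comp (@measurable_expR R)).
  exact: oppr_measurable.
pose g1 : R -> R := (@powR R ^~ (z - 1)) \_ `]0, 1[.
pose g2 : R -> R := exponential_pdf 1.
have mg1 (D : set R) : measurable_fun D g1.
  apply: measurable_funTS; apply/(measurable_restrictT _ _).1 => //; exact: mpow.
have mg2 (D : set R) : measurable_fun D g2.
  by apply: measurable_funTS; exact: measurable_exponential_pdf.
have g10 s : 0 <= g1 s by rewrite /g1 patchE; case: ifP => // _; rewrite powR_ge0.
have g20 s : 0 <= g2 s by apply: exponential_pdf_ge0.
have fg s : 0 < s -> f s <= g1 s + g2 s.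
  move=> s0; rewrite /g2 exponential_pdfE ?(ltW s0)//= mul1r mulN1r.
  have [s1|s1] := ltP s 1.
    rewrite /g1 patchE mem_set/= ?in_itv/= ?s0//.
    rewrite ler_wpDr ?expR_ge0// ler_piMr ?powR_ge0// expR_le1 oppr_le0 ltW//.
  rewrite ler_wpDl ?g10// ler_piMl ?expR_ge0//.
  by rewrite -[leRHS](powRr0 s); apply: ler_powR => //; rewrite subr_le0.
have intf : (\int[leb]_(s in `]0%R, +oo[) (f s)%:E < +oo)%E.
  apply: (@le_lt_trans _ _ (\int[leb]_(s in `]0%R, +oo[) ((g1 s)%:E + (g2 s)%:E))%E).
    apply: ge0_le_integral => //.
    - by move=> s _; rewrite lee_fin.
    - by apply/measurable_EFinP; exact: mf.
    - rewrite (_ : (fun x => _) = EFin \o (g1 \+ g2))//.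
      by apply/measurable_EFinP; apply: measurable_funD; [exact: mg1|exact: mg2].
    - by move=> s /=; rewrite in_itv/= andbT -EFinD lee_fin; exact: fg.
  rewrite ge0_integralD//; last 4 first.
  - by move=> s _; rewrite lee_fin.
  - by apply/measurable_EFinP; exact: mg1.
  - by move=> s _; rewrite lee_fin.
  - by apply/measurable_EFinP; exact: mg2.
  apply: lte_add_pinfty.
    apply: (@le_lt_trans _ _ (\int[leb]_s (g1 s)%:E)%E).
      apply: ge0_subset_integral => //; first by apply/measurable_EFinP; exact: mg1.
      by move=> s _; rewrite lee_fin.
    rewrite (_ : (\int[leb]_s (g1 s)%:E)%E =
        (\int[leb]_(s in `]0%R, 1%R[) (s `^ (z - 1))%:E)%E); last first.
      rewrite [RHS]integral_mkcond; apply: eq_integral => s _.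
      by rewrite /g1 !patchE; case: ifP.
    apply: (@le_lt_trans _ _ (z^-1)%:E); last by rewrite ltry.
    apply: (@improper_le _ _ _ (fun s => z^-1 * s `^ z)) => //.
    - by move=> x _; rewrite powR_ge0.
    - by move=> x; rewrite in_itv/= => /andP[x0 _]; exact: powR_continuous_at.
    - move=> x /andP[x0 _].
      have d1 : is_derive x 1 (fun s => z^-1 * s `^ z) (z^-1 *: (z * x `^ (z - 1))).
        by apply: is_deriveZ; exact: is_derive1_powR.
      apply: (is_derive_eq d1).
      by rewrite /GRing.scale/= mulrA mulVf ?mul1r// gt_eqF.
    - move=> x y x0 xy y1; rewrite -mulrBr ler_piMr ?invr_ge0 ?(ltW z0)//.
      have H := powR_ge0 x z.
      have : y `^ z <= 1 `^ z.
        by apply: ge0_ler_powR; rewrite ?nnegrE// ?ltW// (lt_trans x0).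
      rewrite powR1; lra.
  apply: (@le_lt_trans _ _ (\int[leb]_s (g2 s)%:E)%E).
    apply: ge0_subset_integral => //; first by apply/measurable_EFinP; exact: mg2.
    by move=> s _; rewrite lee_fin.
  by rewrite integral_exponential_pdf// ltry.
have lowf : ((expR (-1))%:E <= \int[leb]_(s in `]0%R, +oo[) (f s)%:E)%E.
  apply: (@le_trans _ _ (\int[leb]_(s in `]0%R, 1%R]) (f s)%:E)%E); last first.
    apply: ge0_subset_integral => //; first by apply/measurable_EFinP; exact: mf.
      by move=> s _; rewrite lee_fin.
    by apply: subset_itvl.
  apply: (@le_trans _ _ (\int[leb]_(s in `]0%R, 1%R]) (expR (-1))%:E)%E).
    rewrite integral_cst// [X in (_ * X)%E](lebesgue_measure_itv `]0%R, 1%R])/= lte_fin ltr01.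
    by rewrite -EFinB subr0 mule1.
  apply: ge0_le_integral => //.
  - by apply/measurable_EFinP; exact: mf.
  - move=> s /=; rewrite in_itv/= => /andP[s0 s1].
    rewrite lee_fin -[leLHS]mul1r ler_pM ?expR_ge0//; last by rewrite ler_expR lerN2.
    rewrite -[leLHS](powRr0 s); apply: ger_powR; first by rewrite s0.
    by rewrite subr_le0.
rewrite /Gamma /Rintegral; apply: fine_gt0; rewrite (lt_le_trans _ lowf) ?lte_fin ?expR_gt0//.
Qed.

End improper.

(** * Almost everywhere inequalities between integrals *)

Section integral_lemmas.
Context d (T : measurableType d) (R : realType) (mu : {measure set T -> \bar R}).
Implicit Types (D : set T) (f g : T -> \bar R).
Local Open Scope ereal_scope.

(** The integral of a nonnegative function is a supremum over the simple functions
below it, whether or not it is measurable. It applies to norms whose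
measurability is not known. *)
Lemma le_integral_nonmeasurable D f g : (forall x, D x -> 0 <= f x) ->
  (forall x, D x -> f x <= g x) ->
  \int[mu]_(x in D) f x <= \int[mu]_(x in D) g x.
Proof.
move=> f0 fg; have g0 x : D x -> 0 <= g x.
  by move=> Dx; rewrite (le_trans (f0 x Dx)) ?fg.
rewrite !ge0_integralE//; apply: le_ereal_sup => _ [h /= hf <-]; exists h => //= x.
by apply: (le_trans (hf x)); apply: lee_restrict => y Dy; exact: fg.
Qed.

(** The larger function is replaced by +oo on the exceptional null set. *)
Lemma ae_le_integral_r D f g : measurable D -> (forall x, D x -> 0 <= f x) ->
  (forall x, D x -> 0 <= g x) -> measurable_fun D g ->
  {ae mu, forall x, D x -> f x <= g x} ->
  \int[mu]_(x in D) f x <= \int[mu]_(x in D) g x.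
Proof.
move=> mD f0 g0 mg [N [mN N0 fgN]].
have mg' : measurable_fun D (g \_ (~` N) \+ (cst +oo) \_ N).
  apply: emeasurable_funD; apply/measurable_restrict => //.
  - exact: measurableC.
  - by apply: measurable_funS mg => // x [].
have g'0 x : D x -> 0 <= (g \_ (~` N) \+ (cst +oo) \_ N) x.
  by move=> Dx; rewrite adde_ge0// patchE; case: ifP => // _; rewrite ?leey// g0.
rewrite [leRHS](_ : _ =
    \int[mu]_(x in D) (g \_ (~` N) \+ (cst +oo) \_ N) x).
  apply: le_integral_nonmeasurable => // x Dx /=.
  rewrite !patchE in_setC; have [xN|xN] /= := boolP (x \in N).
    by rewrite add0e leey.
  rewrite adde0; apply: contrapT => H; move/negP : xN; apply.
  by rewrite inE; apply: fgN => /= /(_ Dx).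
apply: ge0_ae_eq_integral => //; exists N; split => // x /= /not_implyP[Dx H].
apply: contrapT => Nx; apply: H; rewrite !patchE in_setC memNset//=.
by rewrite adde0.
Qed.

(** The smaller function is replaced by 0 on the exceptional null set. *)
Lemma ae_le_integral_l D f g : measurable D -> (forall x, D x -> 0 <= f x) ->
  (forall x, D x -> 0 <= g x) -> measurable_fun D f ->
  {ae mu, forall x, D x -> f x <= g x} ->
  \int[mu]_(x in D) f x <= \int[mu]_(x in D) g x.
Proof.
move=> mD f0 g0 mf [N [mN N0 fgN]].
have mf' : measurable_fun D (f \_ (~` N)).
  apply/measurable_restrict => //; first exact: measurableC.
  by apply: measurable_funS mf => // x [].
have f'0 x : D x -> 0 <= (f \_ (~` N)) x.
  by move=> Dx; rewrite patchE; case: ifP => // _; exact: f0.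
rewrite [leLHS](_ : _ = \int[mu]_(x in D) (f \_ (~` N)) x).
  apply: le_integral_nonmeasurable => // x Dx /=.
  rewrite !patchE in_setC; have [xN|xN] /= := boolP (x \in N); first exact: g0.
  apply: contrapT => H; move/negP : xN; apply.
  by rewrite inE; apply: fgN => /= /(_ Dx).
apply: ge0_ae_eq_integral => //; exists N; split => // x /= /not_implyP[Dx H].
by apply: contrapT => Nx; apply: H; rewrite !patchE in_setC memNset.
Qed.

Lemma cvge0_le {S : Type} (F : set_system S) {FF : Filter F} (u : S -> \bar R) (eps : R) :
  u @ F --> 0 -> (0 < eps)%R -> \forall n \near F, u n <= eps%:E.
Proof.
move=> u0 e0; have /u0 : nbhs (0 : \bar R) [set y : \bar R | y < eps%:E].
  by apply: open_ereal_lt'; rewrite lte_fin.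
by move=> H; apply: (@filterS _ F _ [set n | u n < eps%:E]) => // n /ltW.
Qed.

End integral_lemmas.

Lemma cvge0P (R : realType) {S : Type} (F : set_system S) {FF : Filter F}
    (u : S -> \bar R) : (forall n, (0 <= u n)%E) ->
  (forall eps : R, 0 < eps -> \forall n \near F, (u n <= eps%:E)%E) ->
  (u @ F --> 0%E).
Proof.
move=> u0 H.
have fu : \forall n \near F, u n \is a fin_num.
  apply: filterS (H 1 ltr01) => n un; rewrite ge0_fin_numE//.
  by rewrite (le_lt_trans un)// ltry.
apply/fine_cvgP; split => //; apply/cvgrPdist_le => e e0.
apply: filterS2 fu (H e e0) => n fn un.
by rewrite sub0r normrN ger0_norm ?fine_ge0//= -lee_fin fineK.
Qed.

Section ae_lebesgue.
Context (R : realType).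
Local Notation leb := (@lebesgue_measure R).

Lemma ae_lebS (P Q : R -> Prop) : (forall t, P t -> Q t) ->
  {ae leb, forall t, P t} -> {ae leb, forall t, Q t}.
Proof.
move=> PQ [N [mN N0 PN]]; exists N; split => // t /= Qt.
by apply: PN => /= /PQ.
Qed.

Lemma ae_lebI (P Q : R -> Prop) : {ae leb, forall t, P t} ->
  {ae leb, forall t, Q t} -> {ae leb, forall t, P t /\ Q t}.
Proof.
move=> [N [mN N0 PN]] [N' [mN' N'0 QN]]; exists (N `|` N'); split.
- exact: measurableU.
- exact: null_set_setU.
- move=> t /= /not_andP[Pt|Qt]; [left; exact: PN|right; exact: QN].
Qed.

End ae_lebesgue.

(** * Step functions and Bochner integrals *)

Section steps.
Context (R : realType) (d : nat) (Omega : set 'rV[R]_d).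
Local Notation mu := (lebesgue_rV R d).
Local Notation leb := (@lebesgue_measure R).
Local Notation E := ('rV[R]_d -> R).
Local Notation Linf := (Lp_on mu Omega +oo%E).
Local Notation "'N f" := (Lnorm_on mu Omega +oo%E f%R) (at level 10, f at level 8).
Local Notation L1 chi := (mu.-integrable Omega (EFin \o chi)).
Local Notation P := (pairing mu Omega).
Local Notation sfun_ := (step_fun Omega).
Local Notation bmf := (@bmf _ (measurableTypeR R) R).
Hypotheses (mO : measurable Omega) (muO : (mu Omega < +oo)%E)
  (muT : (0 < mu [set: 'rV[R]_d])%E).
Implicit Types (s : sfun_) (a b t : R) (chi : E).

Definition step0 : sfun_ :=
  @StepFun R d Omega 0 (fun=> set0) (fun _ _ => 0)
    (fun=> measurable0) (fun k : 'I_0 => match k with Ordinal m i => False_ind _ (notF i) end).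

Lemma step0E t : step_eval step0 t = cst 0.
Proof. by apply/funext => x; rewrite /step_eval big_ord0. Qed.

Section step_cat.
Variables s1 s2 : sfun_.

Let n1 := step_size s1.
Let n2 := step_size s2.
Let A (k : 'I_(n1 + n2)) : set R :=
  match fintype.split k with inl i => @step_set _ _ _ s1 i | inr j => @step_set _ _ _ s2 j end.
Let V (k : 'I_(n1 + n2)) : E :=
  match fintype.split k with inl i => @step_val _ _ _ s1 i | inr j => @step_val _ _ _ s2 j end.

Let mA k : measurable (A k).
Proof. by rewrite /A; case: fintype.split => i; exact: step_measurable. Qed.

Let lV k : Linf (V k).
Proof. by rewrite /V; case: fintype.split => i; exact: step_Linf. Qed.

Definition step_cat : sfun_ := StepFun mA lV.

Lemma step_catE t x : step_eval step_cat t x = step_eval s1 t x + step_eval s2 t x.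
Proof.
rewrite /step_eval/= big_split_ord/=; congr (_ + _); apply: eq_bigr => i _.
  by rewrite /A /V (unsplitK (inl i)).
by rewrite /A /V (unsplitK (inr i)).
Qed.

Lemma step_cat_integral a b x : step_integral a b step_cat x =
  step_integral a b s1 x + step_integral a b s2 x.
Proof.
rewrite /step_integral/= big_split_ord/=; congr (_ + _); apply: eq_bigr => i _.
  by rewrite /A /V (unsplitK (inl i)).
by rewrite /A /V (unsplitK (inr i)).
Qed.

End step_cat.

Definition step_scale (c : R) s : sfun_ :=
  @StepFun R d Omega (step_size s) (@step_set _ _ _ s)
    (fun k x => c * @step_val _ _ _ s k x) (@step_measurable _ _ _ s)
    (fun k => LinfZ mO muT c (@step_Linf _ _ _ s k)).

Lemma step_scaleE c s t x : step_eval (step_scale c s) t x = c * step_eval s t x.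
Proof. by rewrite /step_eval mulr_sumr; apply: eq_bigr => k _; rewrite mulrCA. Qed.

Lemma step_scale_integral a b c s x :
  step_integral a b (step_scale c s) x = c * step_integral a b s x.
Proof. by rewrite /step_integral mulr_sumr; apply: eq_bigr => k _; rewrite mulrCA. Qed.

Definition step_sub s1 s2 := step_cat s1 (step_scale (-1) s2).

Lemma step_subE s1 s2 t : step_eval (step_sub s1 s2) t = step_eval s1 t \- step_eval s2 t.
Proof. by apply/funext => x; rewrite step_catE step_scaleE mulN1r. Qed.

Lemma step_sub_integral a b s1 s2 : step_integral a b (step_sub s1 s2) =
  step_integral a b s1 \- step_integral a b s2.
Proof.
by apply/funext => x; rewrite step_cat_integral step_scale_integral mulN1r.
Qed.

Definition step_restrict (B : set R) (mB : measurable B) s : sfun_ :=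
  @StepFun R d Omega (step_size s) (fun k => B `&` @step_set _ _ _ s k)
    (@step_val _ _ _ s) (fun k => measurableI _ _ mB (@step_measurable _ _ _ s k))
    (@step_Linf _ _ _ s).

Lemma step_restrictE B (mB : measurable B) s t x :
  step_eval (step_restrict mB s) t x = \1_B t * step_eval s t x.
Proof.
rewrite /step_eval mulr_sumr; apply: eq_bigr => k _ /=.
by rewrite mulrA indicI.
Qed.

Fixpoint step_bigcat (F : nat -> sfun_) (n : nat) : sfun_ :=
  if n is m.+1 then step_cat (step_bigcat F m) (F m) else step0.

Lemma step_bigcatE F n t x :
  step_eval (step_bigcat F n) t x = \sum_(j < n) step_eval (F j) t x.
Proof.
elim: n => [|n IH]; first by rewrite step0E big_ord0.
by rewrite big_ord_recr/= step_catE IH.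
Qed.

Import HBSimple.

(** A real simple function has finitely many values: the product is the sum, over
these values, of multiples of restrictions of [s]. *)
Section step_mul.
Variables (g : {sfun measurableTypeR R >-> R}) (s : sfun_).

Let rs : seq R := finmap.enum_fset (fset_set (range g)).

Definition step_mul : sfun_ := step_bigcat (fun j =>
  step_scale (nth 0 rs j)
    (step_restrict (measurable_sfunP g (measurable_set1 (nth 0 rs j))) s)) (size rs).

Lemma step_mulE t x : step_eval step_mul t x = g t * step_eval s t x.
Proof.
rewrite step_bigcatE.
under eq_bigr do rewrite step_scaleE step_restrictE mulrA.
rewrite -mulr_suml; congr (_ * _).
have gt : g t \in rs by rewrite in_fset_set// inE; exists t.
rewrite (bigD1 (Ordinal (_ : (index (g t) rs < size rs)%N)))/= ?index_mem//.
move=> H; rewrite nth_index// indicE mem_set//= mulr1.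
rewrite big1 ?addr0// => i /eqP ij; rewrite indicE memNset ?mulr0// => /= gti.
apply: ij; apply: val_inj => /=; rewrite gti index_uniq//.
exact: finmap.fset_uniq.
Qed.

End step_mul.

Lemma Linf_sum_ord n (f : 'I_n -> E) : (forall k, Linf (f k)) ->
  Linf (fun x => \sum_(k < n) f k x).
Proof.
elim: n f => [|n IH] f lf.
  rewrite (_ : (fun x => _) = cst 0); first exact: Linf_cst.
  by apply/funext => x; rewrite big_ord0.
rewrite (_ : (fun x => _) = (fun x => \sum_(k < n) f (widen_ord (leqnSn n) k) x) \+ f ord_max).
  by apply: LinfD => //; exact: IH.
by apply/funext => x; rewrite big_ord_recr.
Qed.

Lemma pairing_sum_ord n (f : 'I_n -> E) chi : (forall k, Linf (f k)) -> L1 chi ->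
  P (fun x => \sum_(k < n) f k x) chi = \sum_(k < n) P (f k) chi.
Proof.
elim: n f => [|n IH] f lf ic.
  rewrite big_ord0 /pairing; under eq_Rintegral do rewrite big_ord0 mul0r.
  by rewrite Rintegral_cst// mul0r.
rewrite (_ : (fun x => _) = (fun x => \sum_(k < n) f (widen_ord (leqnSn n) k) x) \+ f ord_max).
  by rewrite pairingDl// ?IH ?big_ord_recr//; exact: Linf_sum_ord.
by apply/funext => x; rewrite big_ord_recr.
Qed.

Lemma Linf_step_eval s t : Linf (step_eval s t).
Proof. by apply: Linf_sum_ord => k; apply: LinfZ => //; exact: step_Linf. Qed.

Lemma Linf_step_integral a b s : Linf (step_integral a b s).
Proof. by apply: Linf_sum_ord => k; apply: LinfZ => //; exact: step_Linf. Qed.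

Lemma pairing_step_eval s t chi : L1 chi ->
  P (step_eval s t) chi =
  \sum_(k < step_size s) \1_(@step_set _ _ _ s k) t * P (@step_val _ _ _ s k) chi.
Proof.
move=> ic; rewrite pairing_sum_ord//; last first.
  by move=> k; apply: LinfZ => //; exact: step_Linf.
by apply: eq_bigr => k _; rewrite pairingZl//; exact: step_Linf.
Qed.

Lemma bmf_indic (A D : set R) : measurable A -> bmf D (\1_A).
Proof.
move=> mA; split; first exact: measurable_indic.
by exists 1 => x _; rewrite indicE; case: (_ \in _); rewrite ?normr1 ?normr0.
Qed.

Lemma bmf_pairing_step (D : set R) s chi : L1 chi ->
  bmf D (fun t => P (step_eval s t) chi).
Proof.
move=> ic; under [X in bmf D X]eq_fun do rewrite pairing_step_eval//.
apply: bmf_sum_ord => k; apply: bmfM; last exact: bmf_cst.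
by apply: bmf_indic; exact: step_measurable.
Qed.

Lemma pairing_step_integral a b s chi : L1 chi ->
  P (step_integral a b s) chi = \int[leb]_(t in `]a, b[) P (step_eval s t) chi.
Proof.
move=> ic; under eq_Rintegral do rewrite pairing_step_eval//.
rewrite (Rintegral_sum _ _).2//; last first.
  move=> k; apply: bmf_itv_integrable; apply: bmfM; last exact: bmf_cst.
  by apply: bmf_indic; exact: step_measurable.
rewrite pairing_sum_ord//; last first.
  by move=> k; apply: LinfZ => //; exact: step_Linf.
apply: eq_bigr => k _; rewrite pairingZl//; last exact: step_Linf.
rewrite RintegralZr//; last first.
  by apply: bmf_itv_integrable; by apply: bmf_indic; exact: step_measurable.
congr (_ * _); rewrite /Rintegral integral_indic// 1?setIC//.
exact: step_measurable.
Qed.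

(** A quantity which only depends on which of finitely many measurable sets
contain [t] has finitely many values. *)
Lemma measurable_fin_vec n (A : 'I_n -> set R) (Phi : {ffun 'I_n -> bool} -> \bar R)
  (D : set R) : (forall k, measurable (A k)) ->
  measurable_fun D (fun t => Phi [ffun k => t \in A k]).
Proof.
move=> mA; apply: measurable_funTS => _ Y mY; rewrite setTI.
rewrite (_ : _ @^-1` _ = \bigcup_(v in [set v | Y (Phi v)])
    [set t | [ffun k => t \in A k] = v]); last first.
  apply/seteqP; split=> [t Yt|t [v /= Yv tv]]; last by rewrite /= tv.
  by exists [ffun k => t \in A k].
apply: fin_bigcup_measurable => [|v _]; first exact: finite_finset.
rewrite (_ : [set t | _] = \bigcap_(k in [set: 'I_n]) [set t | (t \in A k) = v k]); last first.
  apply/seteqP; split=> [t /= <- k _|t H]; first by rewrite /= ffunE.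
  by apply/ffunP => k; rewrite ffunE; exact: H.
apply: fin_bigcap_measurable => [|k _]; first exact: finite_finset.
case: (v k).
  rewrite (_ : [set t | _] = A k)//.
  by apply/seteqP; split=> t /=; [move/set_mem|move/mem_set].
rewrite (_ : [set t | _] = ~` A k); first exact: measurableC.
apply/seteqP; split=> t /=; first by move/negbT; rewrite notin_setE.
by move=> At; apply/negbTE; rewrite notin_setE.
Qed.

Lemma measurable_norm_step (D : set R) s :
  measurable_fun D (fun t => 'N (step_eval s t)).
Proof.
pose Phi (v : {ffun 'I_(step_size s) -> bool}) :=
  'N (fun x => \sum_(k < step_size s) (v k)%:R * @step_val _ _ _ s k x).
rewrite (_ : (fun t => _) = fun t => Phi [ffun k => t \in @step_set _ _ _ s k]).
  by apply: measurable_fin_vec => k; exact: step_measurable.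
apply/funext => t; congr Lnorm_on; apply/funext => x; apply: eq_bigr => k _.
by rewrite ffunE indicE.
Qed.

(** For step functions this is linearity, and both sides are continuous with
respect to the approximation by step functions. *)
Lemma Bochner_pairing a b (f : R -> E) (w chi : E) (h : R -> R) :
  (forall t, `]a, b[%classic t -> Linf (f t)) ->
  is_Bochner_integral Omega a b f w -> L1 chi ->
  leb.-integrable `]a, b[ (EFin \o h) ->
  {ae leb, forall t, `]a, b[%classic t -> h t = P (f t) chi} ->
  P w chi = \int[leb]_(t in `]a, b[) h t.
Proof.
move=> lf [lw [s [sa sI sw]]] ic ih hP.
pose C := \int[mu]_(x in Omega) `|chi x|.
have C0 : 0 <= C by exact: Rintegral_ge0.
have C1 : 0 < C + 1 by rewrite ltr_pwDr.
apply/eqP; rewrite -subr_eq0 -normr_le0; apply/ler_addgt0Pr => eps eps0.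
rewrite add0r; pose e := eps / (2 * (C + 1)).
have e0 : 0 < e by rewrite divr_gt0// mulr_gt0.
have [n [sIn swn]] := filter_ex (filterI (cvge0_le sI e0) (cvge0_le sw e0)).
pose I := step_integral a b (s n).
pose p t := P (step_eval (s n) t) chi.
have ip : leb.-integrable `]a, b[ (EFin \o p).
  by apply: bmf_itv_integrable; exact: bmf_pairing_step.
have lI : Linf I by exact: Linf_step_integral.
have -> : P w chi - \int[leb]_(t in `]a, b[) h t =
    P (w \- I) chi + \int[leb]_(t in `]a, b[) (p t - h t).
  by rewrite pairingBl// RintegralB// -pairing_step_integral//; ring.
have H1 : `|P (w \- I) chi| <= e * C by apply: pairing_le => //; [exact: ltW|exact: LinfB].
have iph : leb.-integrable `]a, b[ (EFin \o (fun t => p t - h t)).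
  rewrite (_ : EFin \o _ = (EFin \o p) \- (EFin \o h))%E//.
  exact: integrableB.
have H2 : `|\int[leb]_(t in `]a, b[) (p t - h t)| <= e * (C + 1).
  apply: (le_trans (le_normr_Rintegral _ iph)) => //.
  have iph' : leb.-integrable `]a, b[ (EFin \o (fun t => `|p t - h t|)).
    exact: integrable_norm.
  rewrite -ler_pdivrMr// mulrC -RintegralZl// /Rintegral -lee_fin fineK; last first.
    by apply: integrable_fin_num => //; exact: integrable_cmul.
  apply: le_trans sIn; apply: ae_le_integral_l => //.
  - by move=> t _; rewrite lee_fin mulr_ge0// invr_ge0 ltW.
  - by move=> t _; exact: Lnorm_ge0.
  - apply/measurable_EFinP; apply: measurable_funM => //.
    by apply/measurable_EFinP; exact: measurable_int iph'.
  apply: ae_lebS hP => t hPt abt; rewrite hPt//.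
  have lft := lf t abt; have ls := Linf_step_eval (s n) t.
  have /Linf_bound[B B0 NB] := LinfB mO muT lft ls.
  have Nfin : 'N (f t \- step_eval (s n) t) \is a fin_num.
    by rewrite ge0_fin_numE ?Lnorm_ge0// (le_lt_trans NB)// ltry.
  rewrite -(fineK Nfin) lee_fin ler_pdivrMl// -/C.
  rewrite -pairingBl//; apply: (@le_trans _ _ (fine ('N (f t \- step_eval (s n) t)) * C)).
    apply: pairing_le => //; [exact/fine_ge0/Lnorm_ge0|exact: LinfB|].
    by rewrite Lnorm_onC fineK.
  by rewrite mulrC ler_wpM2r ?fine_ge0 ?Lnorm_ge0// lerDl.
apply: (le_trans (ler_normD _ _)); apply: (le_trans (lerD H1 H2)).
apply: (@le_trans _ _ (e * (C + 1) + e * (C + 1))).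
  by rewrite lerD2r ler_wpM2l ?(ltW e0)// lerDl.
by rewrite le_eqVlt; apply/orP; left; apply/eqP; rewrite /e; field; rewrite gt_eqF.
Qed.

Section Bochner_exists.
Variables (a b : R) (f : R -> E) (s : nat -> sfun_) (M : R) (k : R -> R).
Hypotheses (lf : forall t, `]a, b[%classic t -> Linf (f t))
  (sa : step_approx a b f s) (M0 : 0 <= M)
  (fM : {ae leb, forall t, `]a, b[%classic t -> ('N (f t) <= M%:E)%E})
  (ik : leb.-integrable `]a, b[ (EFin \o k)).

(* The approximating step functions, cut off where their norm exceeds M + 1. *)
Let B n : set R := [set t | ('N (step_eval (s n) t) <= (M + 1)%:E)%E].

Let mB n : measurable (B n).
Proof.
rewrite -[B n]setTI.
apply: (@emeasurable_fun_infty_c _ (measurableTypeR R) R setT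
  (fun t => 'N (step_eval (s n) t))) => //.
exact: measurable_norm_step.
Qed.

Let s' n := step_restrict (mB n) (s n).

Let s'E n t : step_eval (s' n) t = if t \in B n then step_eval (s n) t else cst 0.
Proof.
apply/funext => x; rewrite step_restrictE indicE.
by case: (t \in B n); rewrite ?mul1r ?mul0r.
Qed.

Let Nf0 : 'N (cst 0) = 0%E.
Proof.
by rewrite /Lnorm_on unlock muT; apply: ess_sup_ae_cst => //; apply: nearW => x /=;
  rewrite patchE; case: ifP => _; rewrite normr0.
Qed.

Let s'M n t : ('N (step_eval (s' n) t) <= (M + 1)%:E)%E.
Proof.
rewrite s'E; case: ifPn => [/set_mem//|_].
by rewrite Nf0 lee_fin addr_ge0.
Qed.

Let s'cvg : {ae leb, forall t, `]a, b[%classic t ->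
  'N (f t \- step_eval (s' n) t) @[n --> \oo] --> 0%E}.
Proof.
apply: ae_lebS (ae_lebI sa fM) => t [sat fMt] abt.
have st := sat abt; have ft := fMt abt.
apply: cvge0P => [n|eps eps0]; first exact: Lnorm_ge0.
apply: filterS2 (cvge0_le st eps0) (cvge0_le st ltr01) => n sn s1.
rewrite s'E mem_set// /B/=.
have -> : step_eval (s n) t = (step_eval (s n) t \- f t) \+ f t.
  by apply/funext => x /=; rewrite subrK.
by rewrite addrC EFinD (le_trans (Lnorm_onD muT _ _))// leeD// Lnorm_onC.
Qed.

Let dist n m t := 'N (step_eval (step_sub (s' m) (s' n)) t).

(* The distance from f t to the n-th approximation may fail to be measurable in
   t; the supremum of the distances to the later approximations is measurable
   and bounds it. *)
Let e n t := esups (fun m => dist n m t) n.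

Let dist_e n m t : (n <= m)%N -> (dist n m t <= e n t)%E.
Proof. by move=> nm; apply: ereal_sup_ubound; exists m. Qed.

Let e_le n t c : (forall m, (n <= m)%N -> (dist n m t <= c)%E) -> (e n t <= c)%E.
Proof. by move=> H; apply: ge_ereal_sup => _ [m /= nm <-]; exact: H. Qed.

Let e_ge0 n t : (0 <= e n t)%E.
Proof. by rewrite (le_trans _ (dist_e t (leqnn n)))// Lnorm_ge0. Qed.

Let e_bound n t : (e n t <= (2 * (M + 1))%:E)%E.
Proof.
apply: e_le => m nm; rewrite /dist step_subE mulr_natl mulr2n EFinD.
have -> : step_eval (s' m) t \- step_eval (s' n) t =
  (step_eval (s' m) t \- cst 0) \+ (cst 0 \- step_eval (s' n) t).
  by apply/funext => x /=; rewrite subr0 sub0r.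
rewrite (le_trans (Lnorm_onD muT _ _))// leeD//.
  have -> : step_eval (s' m) t \- cst 0 = step_eval (s' m) t; last exact: s'M.
  by apply/funext => x /=; rewrite subr0.
rewrite Lnorm_onC; have -> : step_eval (s' n) t \- cst 0 = step_eval (s' n) t.
  by apply/funext => x /=; rewrite subr0.
exact: s'M.
Qed.

Let me n (D : set R) : measurable_fun D (e n).
Proof.
apply: (@measurable_fun_esups _ (measurableTypeR R) R D (fun m t => dist n m t)) => m.
exact: measurable_norm_step.
Qed.

Let N_e n t : 'N (f t \- step_eval (s' m) t) @[m --> \oo] --> 0%E ->
  ('N (f t \- step_eval (s' n) t) <= e n t)%E.
Proof.
move=> ft; apply/lee_addgt0Pr => eps eps0.
have [m [nm Nm]] := filter_ex (filterI (nbhs_infty_ge n) (cvge0_le ft eps0)).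
rewrite addeC (le_trans (Lnorm_on_tri muT _ (step_eval (s' m) t) _))// leeD//.
by rewrite -step_subE; exact: dist_e.
Qed.

Let e_cvg t : 'N (f t \- step_eval (s' m) t) @[m --> \oo] --> 0%E ->
  e n t @[n --> \oo] --> 0%E.
Proof.
move=> ft; apply: cvge0P => // eps eps0.
have e2 : 0 < eps / 2 by rewrite divr_gt0.
have [n _ nP] := cvge0_le ft e2; exists n => // m /= nm.
apply: e_le => p mp; rewrite /dist step_subE (splitr eps) EFinD.
rewrite (le_trans (Lnorm_on_tri muT _ (f t) _))// leeD//.
  by rewrite Lnorm_onC nP//= (leq_trans nm).
exact: nP.
Qed.

(** The weight [k] is approximated in L^1 by simple functions g n, and k f by
g n times the n-th step function. The distances to k f have the measurable
majorants |k| e n + |k - g n| (M + 1), whose integrals tend to 0, so that by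
duality the integrals of the step functions form a Cauchy sequence. *)
Lemma Bochner_exists :
  exists w, is_Bochner_integral Omega a b (fun t x => k t * f t x) w.
Proof.
have mab : measurable (`]a, b[%classic : set (measurableTypeR R)) by exact: measurable_itv.
have [g [ig gk gL1]] := approximation_sfun_integrable mab ik.
have mk : measurable_fun `]a, b[ k by apply/measurable_EFinP; exact: measurable_int ik.
have mg n : measurable_fun (`]a, b[ : set R) (g n).
  by apply/measurable_EFinP; exact: measurable_int (ig n).
pose fn n := step_mul (g n) (s' n).
pose G n t : \bar R := (`|k t|%:E * e n t + `|k t - g n t|%:E * (M + 1)%:E)%E.
have M1 : 0 <= M + 1 by rewrite addr_ge0.
have G0 n t : (0 <= G n t)%E by rewrite adde_ge0// mule_ge0// lee_fin.
have mG1 n : measurable_fun `]a, b[ (fun t => `|k t|%:E * e n t)%E.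
  apply: emeasurable_funM; last exact: me.
  by apply/measurable_EFinP; exact: measurableT_comp.
have mkg n : measurable_fun `]a, b[ (fun t => `|k t - g n t|%:E).
  by apply/measurable_EFinP; apply: measurableT_comp => //; exact: measurable_funB.
have mG n : measurable_fun `]a, b[ (G n).
  by apply: emeasurable_funD => //; apply: emeasurable_funM.
have fnG : {ae leb, forall t, `]a, b[%classic t ->
    forall n, ('N ((fun x => k t * f t x) \- step_eval (fn n) t) <= G n t)%E}.
  apply: ae_lebS s'cvg => t /[apply] /N_e Ne n.
  have -> : (fun x => k t * f t x) \- step_eval (fn n) t =
      (fun x => k t * (f t \- step_eval (s' n) t) x) \+
      (fun x => (k t - g n t) * step_eval (s' n) t x).
    by apply/funext => x /=; rewrite step_mulE; ring.
  rewrite (le_trans (Lnorm_onD muT _ _))// !Lnorm_onZ// leeD//.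
    by rewrite lee_wpmul2l.
  by rewrite lee_wpmul2l.
have ik' : leb.-integrable `]a, b[ (EFin \o (fun t => `|k t|)) by exact: integrable_norm.
have int1 : (\int[leb]_(t in `]a, b[) (`|k t|%:E * e n t))%E @[n --> \oo] --> 0%E.
  have H1 : {ae leb, forall t, `]a, b[%classic t ->
      (`|k t|%:E * e n t)%E @[n --> \oo] --> 0%E}.
    apply: ae_lebS s'cvg => t /[apply] /e_cvg et.
    by rewrite -[X in _ --> X](mule0 `|k t|%:E); apply: cvgeZl.
  have H2 : leb.-integrable `]a, b[ (fun t => (2 * (M + 1))%:E * `|k t|%:E)%E.
    exact: integrableZl.
  have H3 : {ae leb, forall t, forall n, `]a, b[%classic t ->
      (`| `|k t|%:E * e n t | <= (2 * (M + 1))%:E * `|k t|%:E)%E}.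
    apply: aeW => t n _; rewrite abseM [X in (X * _)%E]gee0_abs ?lee_fin//.
    by rewrite gee0_abs// muleC lee_wpmul2r ?lee_fin.
  have [_ + _] := @dominated_convergence _ (measurableTypeR R) R leb `]a, b[ mab
    (fun n t => `|k t|%:E * e n t)%E (cst 0%E) (fun t => (2 * (M + 1))%:E * `|k t|%:E)%E
    mG1 (measurable_cst _) H1 H2 H3.
  rewrite (_ : [sequence _]_n = fun n => (\int[leb]_(t in `]a, b[) (`|k t|%:E * e n t))%E)//.
  apply/funext => n; apply: eq_integral => t _ /=.
  by rewrite sube0 gee0_abs// mule_ge0.
have int2 : (\int[leb]_(t in `]a, b[) (`|k t - g n t|%:E * (M + 1)%:E))%E
    @[n --> \oo] --> 0%E.
  rewrite (_ : (fun n => _) =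
    fun n => ((M + 1)%:E * \int[leb]_(t in `]a, b[) `|(k t)%:E - (g n t)%:E|)%E).
    by rewrite -[X in _ --> X](mule0 (M + 1)%:E); apply: cvgeZl.
  apply/funext => n; rewrite -ge0_integralZl_EFin//; last exact: mkg.
  by apply: eq_integral => t _; rewrite muleC.
have intG : (\int[leb]_(t in `]a, b[) G n t)%E @[n --> \oo] --> 0%E.
  rewrite (_ : (fun n => _) = (fun n =>
    \int[leb]_(t in `]a, b[) (`|k t|%:E * e n t) +
    \int[leb]_(t in `]a, b[) (`|k t - g n t|%:E * (M + 1)%:E))%E).
    by rewrite -[X in _ --> X](adde0 0%E); apply: cvgeD.
  apply/funext => n; rewrite ge0_integralD//.
  - by move=> t _; rewrite mule_ge0// lee_fin.
  - exact: mG1.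
  - by move=> t _; rewrite mule_ge0// lee_fin.
  - by apply: emeasurable_funM => //; exact: mkg.
pose I n := step_integral a b (fn n).
have lI n : Linf (I n) by exact: Linf_step_integral.
have kflinf t : `]a, b[%classic t -> Linf (fun x => k t * f t x).
  by move=> abt; apply: LinfZ => //; exact: lf.
have ICauchy eps : 0 < eps -> exists N, forall n m, (N <= n)%N -> (N <= m)%N ->
    ('N (I m \- I n) <= eps%:E)%E.
  move=> eps0; have e2 : 0 < eps / 2 by rewrite divr_gt0.
  have [N _ NP] := cvge0_le intG e2; exists N => n m Nn Nm.
  apply: Linf_dual => //; [exact: ltW|exact: LinfB|].
  move=> chi ic; pose C := \int[mu]_(x in Omega) `|chi x|.
  have C0 : 0 <= C by exact: Rintegral_ge0.
  rewrite -/C /I -step_sub_integral pairing_step_integral//.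
  set q := fun t => P (step_eval (step_sub (fn m) (fn n)) t) chi.
  have iq : leb.-integrable `]a, b[ (EFin \o q).
    by apply: bmf_itv_integrable; exact: bmf_pairing_step.
  apply: (le_trans (ler_norm _)); apply: (le_trans (le_normr_Rintegral mab iq)).
  have iq' : leb.-integrable `]a, b[ (EFin \o (fun t => `|q t|)) by exact: integrable_norm.
  rewrite /Rintegral -lee_fin fineK; last exact: integrable_fin_num.
  apply: (@le_trans _ _ (\int[leb]_(t in `]a, b[) (C%:E * (G m t + G n t)))%E).
    apply: ae_le_integral_r => //.
    - by move=> t _; rewrite mule_ge0// adde_ge0.
    - by apply: measurable_funeM; apply: emeasurable_funD; exact: mG.
    apply: ae_lebS fnG => t /[swap] abt /(_ abt) fnGt.
    set y := step_eval (step_sub (fn m) (fn n)) t.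
    have ly : Linf y by exact: Linf_step_eval.
    have [Y Y0 NY] := Linf_bound ly.
    have Nfin : 'N y \is a fin_num by rewrite ge0_fin_numE ?Lnorm_ge0// (le_lt_trans NY)// ltry.
    have Ny : ('N y <= G m t + G n t)%E.
      rewrite /y step_subE (le_trans (Lnorm_on_tri muT _ (fun x => k t * f t x) _))//.
      by rewrite leeD// Lnorm_onC.
    apply: (@le_trans _ _ (C%:E * 'N y)%E); last by rewrite lee_wpmul2l// lee_fin.
    rewrite -(fineK Nfin) -EFinM lee_fin mulrC; apply: pairing_le => //.
      by rewrite fine_ge0// Lnorm_ge0.
    by rewrite fineK.
  rewrite ge0_integralZl_EFin//; last 2 first.
  - by move=> t _; rewrite adde_ge0.
  - by apply: emeasurable_funD; exact: mG.
  rewrite ge0_integralD//; [|exact: mG|exact: mG]; rewrite mulrC EFinM lee_wpmul2l ?lee_fin//.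
  by rewrite (splitr eps) EFinD leeD//; exact: NP.
have [w lw wP] := Linf_complete mO muT lI ICauchy.
exists w; split => //; exists fn; split.
- apply: ae_lebS (ae_lebI fnG s'cvg) => t [fnGt st] abt.
  have et := e_cvg (st abt).
  apply: cvge0P => [n|eps eps0]; first exact: Lnorm_ge0.
  have kc : (fun n => g n t) @ \oo --> k t by have /fine_cvgP[] := gk t abt.
  have Gt : G n t @[n --> \oo] --> 0%E.
    rewrite -[X in _ --> X](adde0 0%E); apply: cvgeD => //.
      by rewrite -[X in _ --> X](mule0 `|k t|%:E); apply: cvgeZl.
    under eq_fun do rewrite -EFinM.
    rewrite -[0%E]/(0%:E); apply: cvg_EFin; first exact: nearW.
    rewrite -[X in _ --> X](mul0r (M + 1)); apply: cvgM; last exact: cvg_cst.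
    apply/cvgrPdist_le => x x0; move/cvgrPdist_le : kc => /(_ _ x0).
    by apply: filterS => n; rewrite sub0r normrN normr_id.
  apply: filterS (cvge0_le Gt eps0) => n; apply: le_trans.
  exact: fnGt.
- apply: cvge0P => [n|eps eps0].
    by apply: integral_ge0 => t _; exact: Lnorm_ge0.
  apply: filterS (cvge0_le intG eps0) => n; apply: le_trans.
  apply: ae_le_integral_r => //.
  - by move=> t _; exact: Lnorm_ge0.
  - exact: mG.
  - by apply: ae_lebS fnG => t + abt => /(_ abt).
- apply: cvge0P => [n|eps eps0]; first exact: Lnorm_ge0.
  by have [N NP] := wP _ eps0; exists N.
Qed.

End Bochner_exists.
End steps.

(** * The time derivative *)

Section nice_representative.
Context (R : realType) (d : nat) (Omega : set 'rV[R]_d).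
Local Notation mu := (lebesgue_rV R d).
Local Notation leb := (@lebesgue_measure R).
Local Notation E := ('rV[R]_d -> R).
Local Notation Linf := (Lp_on mu Omega +oo%E).
Local Notation "'N f" := (Lnorm_on mu Omega +oo%E f%R) (at level 10, f at level 8).
Local Notation L1 chi := (mu.-integrable Omega (EFin \o chi)).
Local Notation P := (pairing mu Omega).
Local Notation bmf := (@bmf _ (measurableTypeR R) R).
Hypotheses (mO : measurable Omega) (muO : (mu Omega < +oo)%E)
  (muT : (0 < mu [set: 'rV[R]_d])%E).
Implicit Types (a b t : R) (v : R -> E) (chi : E) (M : R).

(** A family bounded by [M] which is everywhere, and not only almost everywhere,
a limit of step functions. *)
Definition strongly_measurable a b v M (s : nat -> step_fun Omega) :=
  [/\ forall t, `]a, b[%classic t -> Linf (v t),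
      forall t, `]a, b[%classic t -> ('N (v t) <= M%:E)%E &
      forall t, `]a, b[%classic t -> 'N (v t \- step_eval (s n) t) @[n --> \oo] --> 0%E].

Lemma Lnorm_on0 : 'N (fun=> 0) = 0%E.
Proof.
apply/eqP; rewrite eq_le Lnorm_ge0 andbT.
by apply/(Lnorm_on_leP muT _ _ (lexx _)); apply: nearW => x _; rewrite normr0.
Qed.

(** Redefine the family to be 0 on a null set of exceptional times. *)
Lemma strongly_measurable_repr a b v : Linf_Linf Omega a b v ->
  exists v' M s, [/\ 0 <= M, strongly_measurable a b v' M s &
    {ae leb, forall t, `]a, b[%classic t -> v' t = v t}].
Proof.
move=> [lv [s sv] [M vM]].
have [N [mN N0 NP]] := ae_lebI sv vM.
pose v' t : E := if t \in N then fun=> 0 else v t.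
pose s' n := step_restrict (measurableC mN) (s n).
exists v', `|M|, s'; split => //; last first.
  exists N; split => // t /= /not_implyP[abt]; rewrite /v'.
  by case: ifPn => [/set_mem//|].
have s'E n t : step_eval (s' n) t = if t \in N then fun=> 0 else step_eval (s n) t.
  apply/funext => x; rewrite step_restrictE indicE in_setC.
  by case: (t \in N); rewrite ?mul0r ?mul1r.
have good t : t \notin N -> (`]a, b[%classic t ->
    'N (v t \- step_eval (s n) t) @[n --> \oo] --> 0%E) /\
    (`]a, b[%classic t -> ('N (v t) <= M%:E)%E).
  by rewrite notin_setE => tN; apply: contrapT => H; apply: tN; apply: NP.
split=> t abt; rewrite /v'; case: ifPn => tN.
- exact: Linf_cst.
- exact: lv.
- by rewrite Lnorm_on0 lee_fin.
- by have [_ /(_ abt) vt] := good t tN; rewrite (le_trans vt)// lee_fin ler_norm.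
- under eq_fun do rewrite s'E tN.
  rewrite (_ : (fun=> _) = cst 0%E); first exact: cvg_cst.
  apply/funext => n; rewrite -[RHS]Lnorm_on0; congr Lnorm_on.
  by apply/funext => x /=; rewrite subrr.
- under eq_fun do rewrite s'E (negbTE tN).
  by have [/(_ abt)] := good t tN.
Qed.

Lemma strongly_measurable_Linf_Linf a b v M s :
  strongly_measurable a b v M s -> Linf_Linf Omega a b v.
Proof.
move=> [lv vM sv]; split => //; first by exists s; exact: aeW.
by exists M; exact: aeW.
Qed.

Lemma cvg_pairing v (s : nat -> step_fun Omega) chi t : L1 chi -> Linf (v t) ->
  'N (v t \- step_eval (s n) t) @[n --> \oo] --> 0%E ->
  P (step_eval (s n) t) chi @[n --> \oo] --> P (v t) chi.
Proof.
move=> ic lv sv; apply/cvgrPdist_le => e e0.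
pose C := \int[mu]_(x in Omega) `|chi x|.
have C0 : 0 <= C by exact: Rintegral_ge0.
have C1 : 0 < C + 1 by rewrite ltr_pwDr.
have e1 : 0 < e / (C + 1) by rewrite divr_gt0.
apply: filterS (cvge0_le sv e1) => n sn.
have ls := Linf_step_eval mO muT (s n) t.
rewrite -pairingBl//; apply: (@le_trans _ _ (e / (C + 1) * C)).
  by apply: pairing_le => //; [exact: ltW|exact: LinfB].
by rewrite mulrAC ler_pdivrMr// ler_wpM2l ?(ltW e0)// lerDl.
Qed.

Lemma bmf_pairing a b v M s chi : 0 <= M -> strongly_measurable a b v M s ->
  L1 chi -> bmf `]a, b[ (fun t => P (v t) chi).
Proof.
move=> M0 [lv vM sv] ic; split; last first.
  exists (M * \int[mu]_(x in Omega) `|chi x|) => t abt.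
  by apply: pairing_le => //; [exact: lv|exact: vM].
apply: (@measurable_fun_cvg _ (measurableTypeR R) R `]a, b[
    (fun n t => P (step_eval (s n) t) chi)).
  by move=> n; have [] := @bmf_pairing_step _ _ _ mO muT `]a, b[ (s n) _ ic.
by move=> t abt; apply: cvg_pairing => //; [exact: lv|exact: sv].
Qed.

Section derivative.
Variables (t : R) (u : R -> E).
Hypotheses (t0 : 0 < t) (lu : forall s, 0 <= s <= t -> Linf (u s))
  (cu : forall s, 0 <= s <= t -> forall eps, 0 < eps -> exists2 delta, 0 < delta &
     forall r, 0 <= r <= t -> `|s - r| < delta -> ('N (u s \- u r) <= eps%:E)%E)
  (Wu : forall eps, 0 < eps < t -> W1inf_Linf Omega eps t u).

Lemma pairing_continuous chi : L1 chi ->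
  {within `[0, t], continuous (fun s => P (u s) chi)}.
Proof.
move=> ic; apply/subspace_continuousP => s; rewrite /= in_itv/= => st.
apply/cvgrPdist_le => e e0.
pose C := \int[mu]_(x in Omega) `|chi x|.
have C0 : 0 <= C by exact: Rintegral_ge0.
have C1 : 0 < C + 1 by rewrite ltr_pwDr.
have e1 : 0 < e / (C + 1) by rewrite divr_gt0.
have [delta d0 dP] := cu st e1.
exists delta => //= r sr; rewrite in_itv/= => rt.
rewrite -pairingBl ?lu//; apply: (@le_trans _ _ (e / (C + 1) * C)).
  by apply: pairing_le => //; [exact: ltW|apply: LinfB => //; exact: lu|exact: dP].
by rewrite mulrAC ler_pdivrMr// ler_wpM2l ?(ltW e0)// lerDl.
Qed.

Lemma bmf_pairing_u chi a b : L1 chi -> 0 <= a -> b <= t ->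
  bmf `]a, b[ (fun s => P (u s) chi).
Proof.
move=> ic a0 bt.
apply: (@bmfS _ (measurableTypeR R) R `[0, t]); last exact/bmf_continuous/pairing_continuous.
- exact: measurable_itv.
- by apply: subset_itv; rewrite bnd_simp.
Qed.

Lemma pairing_continuous_in chi a : L1 chi -> 0 <= a ->
  {in `]a, t[, continuous (fun s => P (u s) chi)}.
Proof.
move=> ic a0 s; rewrite in_itv/= => /andP[as_ st].
have s0t : s \in `]0, t[ by rewrite in_itv/= st (le_lt_trans a0).
have := pairing_continuous ic; rewrite continuous_within_itvP//.
by move=> [+ _ _]; apply.
Qed.

(** Pairing commutes with the Bochner integrals of the weak formulation, which
makes the weak derivative a real one. *)
Lemma weak_derivative_pairing a v v' M s chi (phi : R -> R) : 0 < a -> a < t ->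
  is_weak_time_derivative Omega a t u v -> 0 <= M ->
  strongly_measurable a t v' M s ->
  {ae leb, forall r, `]a, t[%classic r -> v' r = v r} -> L1 chi ->
  test_function `]a, t[%classic phi ->
  \int[leb]_(r in `]a, t[) (derive1 phi r * P (u r) chi) =
  - \int[leb]_(r in `]a, t[) (phi r * P (v' r) chi).
Proof.
move=> a0 at_ [[lv _ _] wv] M0 sv' v'v ic tphi.
have [sphi _] := tphi; have [w [wu wv_]] := wv _ tphi.
have lua r : `]a, t[%classic r -> Linf (u r).
  by rewrite /= in_itv/= => /andP[ar rt]; apply: lu; rewrite (ltW rt) (ltW (lt_trans a0 ar)).
have b1 : bmf `]a, t[ (fun r => derive1 phi r * P (u r) chi).
  by apply: bmfM; [exact/bmf_smooth/smooth_derive1|apply: bmf_pairing_u => //; exact: ltW].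
have b2 : bmf `]a, t[ (fun r => phi r * P (v' r) chi).
  by apply: bmfM; [exact: bmf_smooth|exact: bmf_pairing sv' ic].
have lw : Linf w by have [_ []] := wu => ? []; case: wu.
have <- : P w chi = \int[leb]_(r in `]a, t[) (derive1 phi r * P (u r) chi).
  apply: (Bochner_pairing mO muT _ wu ic (bmf_itv_integrable b1)).
    by move=> r art; apply: LinfZ => //; exact: lua.
  by apply: aeW => r art; rewrite pairingZl//; exact: lua.
have <- : P (fun x => - w x) chi = \int[leb]_(r in `]a, t[) (phi r * P (v' r) chi).
  apply: (Bochner_pairing mO muT _ wv_ ic (bmf_itv_integrable b2)).
    by move=> r art; apply: LinfZ => //; exact: lv.
  apply: ae_lebS v'v => r v'vr art; rewrite -v'vr// pairingZl//.
  by have [lv' _ _] := sv'; exact: lv'.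
have -> : (fun x => - w x) = (fun x => -1 * w x).
  by apply/funext => x; rewrite mulN1r.
by rewrite pairingZl// mulN1r opprK.
Qed.

(** By [weak_ftc], applied to the pairing of [u] with each [chi]. *)
Lemma local_derivative eps : 0 < eps < t ->
  exists v M s, [/\ 0 <= M, strongly_measurable eps t v M s &
    forall chi, L1 chi -> forall p q, eps < p -> p <= q -> q < t ->
      P (u q) chi - P (u p) chi = \int[leb]_(r in `[p, q]) P (v r) chi].
Proof.
move=> /[dup] e0t /andP[e0 et]; have [_ [v dv]] := Wu e0t.
have [v' [M [s [M0 sv' v'v]]]] := strongly_measurable_repr dv.1.
exists v', M, s; split => // chi ic.
apply: (@weak_ftc _ eps t (fun s => P (u s) chi)).
- exact: bmf_pairing sv' ic.
- by apply: bmf_pairing_u => //; exact: ltW.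
- by apply: pairing_continuous_in => //; exact: ltW.
- by move=> phi tphi; exact: (weak_derivative_pairing e0 et dv M0 sv' v'v).
Qed.

End derivative.
End nice_representative.

(** * Existence of the Caputo derivative *)

Section Caputo.
Context (R : realType) (d : nat) (Omega : set 'rV[R]_d).
Local Notation mu := (lebesgue_rV R d).
Local Notation leb := (@lebesgue_measure R).
Local Notation E := ('rV[R]_d -> R).
Local Notation Linf := (Lp_on mu Omega +oo%E).
Local Notation "'N f" := (Lnorm_on mu Omega +oo%E f%R) (at level 10, f at level 8).
Local Notation L1 chi := (mu.-integrable Omega (EFin \o chi)).
Local Notation P := (pairing mu Omega).
Local Notation bmf := (@bmf _ (measurableTypeR R) R).
Hypotheses (mO : measurable Omega) (muO : (mu Omega < +oo)%E)
  (muT : (0 < mu [set: 'rV[R]_d])%E).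
Variables (t : R) (u : R -> E).
Hypotheses (t0 : 0 < t) (lu : forall s, 0 <= s <= t -> Linf (u s))
  (cu : forall s, 0 <= s <= t -> forall eps, 0 < eps -> exists2 delta, 0 < delta &
     forall r, 0 <= r <= t -> `|s - r| < delta -> ('N (u s \- u r) <= eps%:E)%E)
  (Wu : forall eps, 0 < eps < t -> W1inf_Linf Omega eps t u).

(** The local derivatives only agree almost everywhere; a single one on ]0, t[
is obtained by taking, on each piece ]t/(n+1), t/n], that of ]t/(n+2), t[. *)
Lemma global_derivative : exists V : R -> E,
  (forall eps, 0 < eps < t -> exists (M : R) (s : nat -> step_fun Omega),
     0 <= M /\ strongly_measurable eps t V M s) /\
  forall chi, L1 chi -> forall p q, 0 < p -> p <= q -> q < t ->
    P (u q) chi - P (u p) chi = \int[leb]_(r in `[p, q]) P (V r) chi.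
Proof.
pose e (n : nat) : R := t / n.+2%:R.
have e0t n : 0 < e n < t.
  by rewrite /e divr_gt0//= ltr_pdivrMr// ltr_pMr// ltr1n.
have /choice[v /choice[M /choice[s vP]]] : forall n, exists (v : R -> E) (M : R)
    (s : nat -> step_fun Omega),
    [/\ 0 <= M, strongly_measurable (e n) t v M s &
    forall chi, L1 chi -> forall p q, e n < p -> p <= q -> q < t ->
      P (u q) chi - P (u p) chi = \int[leb]_(r in `[p, q]) P (v r) chi].
  by move=> n; exact: (local_derivative mO muT t0 lu cu Wu).
(* nn r is the index of the piece that contains r. *)
pose nn r := Num.truncn (t / r).
pose V r := v (nn r) r.
pose B n : set R := [set` `]t / n.+1%:R, t / n%:R]].
have BP r n : 0 < r < t -> B n r <-> n = nn r.
  move=> /andP[r0 rt]; rewrite /B /= in_itv/=; split.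
    case: n => [|n]; first by rewrite invr0 mulr0 => /andP[_]; rewrite leNgt r0.
    move=> /andP[nr rn]; apply/esym/truncn_def.
    by rewrite ler_pdivlMr// -ler_pdivlMl// mulrC rn ltr_pdivrMr// -ltr_pdivrMl// mulrC nr.
  move=> ->; have tr1 : 1 <= t / r by rewrite ler_pdivlMr// mul1r ltW.
  have /truncn_itv/andP[n1 n2] : 0 <= t / r by rewrite (le_trans _ tr1).
  have nn0 : (0 < nn r)%N.
    by rewrite lt0n; apply/eqP => n0; move: n2; rewrite -/(nn r) n0 ltNge tr1.
  rewrite ltr_pdivrMr ?ltr0n// mulrC -ltr_pdivrMr// n2/=.
  by rewrite ler_pdivlMr ?ltr0n// mulrC -ler_pdivlMr.
have eB r n : 0 < r < t -> B n r -> e n < r.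
  move=> /andP[r0 rt]; rewrite /B /e /= in_itv/= => /andP[+ _]; apply: le_lt_trans.
  by rewrite ler_pM2l// lef_pV2 ?posrE ?ltr0n// ler_nat.
have mB n : measurable (B n) by exact: measurable_itv.
have SV eps : 0 < eps < t -> exists (M : R) (s : nat -> step_fun Omega),
    0 <= M /\ strongly_measurable eps t V M s.
  move=> /andP[e0 et]; pose N := (nn eps).+1.
  exists (\sum_(j < N) M j).
  exists (fun m => step_bigcat (fun j => step_restrict (mB j) (s j m)) N).
  have M0 j : 0 <= M j by have [] := vP j.
  split; first by apply: sumr_ge0.
  have key r : `]eps, t[%classic r ->
      [/\ 0 < r < t, `]e (nn r), t[%classic r & (nn r < N)%N].
    rewrite /= !in_itv/= => /andP[er rt]; have r0 := lt_trans e0 er.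
    have r0t : 0 < r < t by rewrite r0.
    split => //; first by rewrite rt eB//; apply/BP.
    rewrite ltnS; apply: le_truncn; rewrite ler_pM2l// lef_pV2 ?posrE//; exact: ltW.
  split=> r /key[r0t er rN]; have [_ [lv vM sv] _] := vP (nn r).
  - exact: lv.
  - apply: le_trans (vM _ er) _; rewrite lee_fin.
    rewrite (bigD1 (Ordinal rN))//= lerDl; exact: sumr_ge0.
  - have sE m : step_eval (step_bigcat (fun j => step_restrict (mB j) (s j m)) N) r =
        step_eval (s (nn r) m) r.
      apply/funext => x; rewrite step_bigcatE (bigD1 (Ordinal rN))//= big1 ?addr0.
        by rewrite step_restrictE indicE mem_set ?mul1r//; apply/BP.
      move=> j jr; rewrite step_restrictE indicE memNset ?mul0r// => /(BP _ _ r0t) jE.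
      by move/eqP : jr; apply; exact/val_inj.
    by under eq_fun do rewrite sE; exact: sv.
exists V; split => // chi ic.
have bV p q : 0 < p -> q < t -> bmf `[p, q] (fun r => P (V r) chi).
  move=> p0 qt; have [pt|tp] := ltP p t; last first.
    rewrite set_itv_ge ?bnd_simp -?ltNge ?(lt_le_trans qt)//.
    by split; [exact: measurable_fun_set0|exists 0].
  have p20 : 0 < p / 2 by rewrite divr_gt0.
  have p2p : p / 2 < p by rewrite ltr_pdivrMr// ltr_pMr// ltr1n.
  have [|M' [s' [M'0 SM]]] := SV (p / 2); first by rewrite p20 (lt_trans p2p).
  apply: (@bmfS _ (measurableTypeR R) R `]p / 2, t[); first exact: measurable_itv.
    by apply: subset_itv; rewrite bnd_simp.
  exact: bmf_pairing M'0 SM ic.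
have bv n : bmf `]e n, t[ (fun r => P (v n r) chi).
  by have [M0 SM _] := vP n; exact: bmf_pairing M0 SM ic.
have piece n p q : 0 < p -> t / n.+1%:R <= p -> p <= q -> q <= t / n%:R -> q < t ->
    P (u q) chi - P (u p) chi = \int[leb]_(r in `[p, q]) P (V r) chi.
  move=> p0 np pq qn qt; have [_ _ ftc] := vP n.
  have enp : e n < p.
    apply: lt_le_trans np; rewrite /e ltr_pM2l// ltf_pV2 ?posrE ?ltr0n//.
    by rewrite ltr_nat.
  rewrite (ftc _ ic _ _ enp pq qt); have sub : `]p, q[ `<=` `]e n, t[.
    by apply: subset_itv; rewrite bnd_simp ?(ltW enp) ?(ltW qt).
  rewrite /Rintegral; congr fine; apply: eq_integral_itv_bounded.
  - by have [mv _] := bv n; apply: measurable_funS mv => //; exact: measurable_itv.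
  - have [mv _] := bV p q p0 qt; apply: measurable_funS mv => //.
    by apply: subset_itv; rewrite bnd_simp.
  move=> r; rewrite in_itv/= => /andP[pr rq].
  have r0t : 0 < r < t by rewrite (lt_trans p0)//= (lt_trans rq).
  rewrite /V (_ : nn r = n)//; apply/esym/(BP _ _ r0t).
  by rewrite /B /= in_itv/= (le_lt_trans np)//= (le_trans (ltW rq)).
(* Induction on the piece that contains p, splitting the integral at the upper
   end of that piece. *)
suff H n p q : t / n.+1%:R <= p -> p <= q -> q < t ->
    P (u q) chi - P (u p) chi = \int[leb]_(r in `[p, q]) P (V r) chi.
  move=> p q p0 pq qt; apply: (H (nn p)) => //.
  have [pt|tp] := ltP p t.
    have : B (nn p) p by apply/BP => //; rewrite p0.
    by rewrite /B /= in_itv/= => /andP[/ltW].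
  by have := le_lt_trans (le_trans tp pq) qt; rewrite ltxx.
elim: n p q => [|n IH] p q np pq qt.
  by have := le_lt_trans np (le_lt_trans pq qt); rewrite invr1 mulr1 ltxx.
have p0 : 0 < p by apply: lt_le_trans np; rewrite divr_gt0.
have [qn|nq] := leP q (t / n.+1%:R); first exact: (piece n.+1).
have [np'|pn] := leP (t / n.+1%:R) p; first exact: IH.
rewrite (@Rintegral_split R p (t / n.+1%:R) q) ?(ltW pn) ?(ltW nq)//; last exact: bV.
rewrite -(piece n.+1) ?(ltW pn)//; last exact: lt_trans qt.
by rewrite -(IH (t / n.+1%:R)) ?(ltW nq)// [RHS]addrC subrKA.
Qed.

Lemma strongly_measurable_Bochner a b (v : R -> E) (M : R) (s : nat -> step_fun Omega)
    (k : R -> R) : 0 <= M ->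
  strongly_measurable a b v M s -> leb.-integrable `]a, b[ (EFin \o k) ->
  exists w, is_Bochner_integral Omega a b (fun r x => k r * v r x) w.
Proof.
move=> M0 [lv vM sv] ik.
have av : step_approx a b v s by exact: aeW.
have avM : {ae leb, forall r, `]a, b[%classic r -> ('N (v r) <= M%:E)%E} by exact: aeW.
exact: (Bochner_exists mO muO muT lv av M0 avM ik).
Qed.

Lemma Bochner_integral_eq a b (f : R -> E) w w' : Linf w' ->
  ('N (w' \- w) <= 0)%E -> is_Bochner_integral Omega a b f w ->
  is_Bochner_integral Omega a b f w'.
Proof.
move=> lw' w'w [lw [s [sf si sw]]]; split => //; exists s; split => //.
apply: cvge0P => [n|eps eps0]; first exact: Lnorm_ge0.
apply: filterS (cvge0_le sw eps0) => n; apply: le_trans.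
rewrite -[leRHS]add0e; apply: le_trans (Lnorm_on_tri muT w' w _) _.
by rewrite leeD2r.
Qed.

(** Integration by parts against test functions, first paired with [chi], then
transferred to the Bochner integrals by duality. *)
Lemma primitive_weak_derivative (V : R -> E) eps M (s : nat -> step_fun Omega) :
  0 < eps < t -> 0 <= M -> strongly_measurable eps t V M s ->
  (forall chi, L1 chi -> forall p q, 0 < p -> p <= q -> q < t ->
    P (u q) chi - P (u p) chi = \int[leb]_(r in `[p, q]) P (V r) chi) ->
  is_weak_time_derivative Omega eps t u V.
Proof.
move=> /[dup] e0t /andP[e0 et] M0 SM ftc; have [lV VM sV] := SM.
split; first exact: strongly_measurable_Linf_Linf SM.
move=> phi /[dup] tphi [sphi _]; have [[lU [sU aU] [MU UM]] _] := Wu e0t.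
have UM' : {ae leb, forall r, `]eps, t[%classic r -> ('N (u r) <= `|MU|%:E)%E}.
  by apply: ae_lebS UM => r H /H /le_trans; apply; rewrite lee_fin ler_norm.
have i1 : leb.-integrable `]eps, t[ (EFin \o derive1 phi).
  by apply: bmf_itv_integrable; apply/bmf_smooth/smooth_derive1.
have i2 : leb.-integrable `]eps, t[ (EFin \o phi).
  by apply: bmf_itv_integrable; exact: bmf_smooth.
have [w wP] := Bochner_exists mO muO muT lU aU (normr_ge0 _) UM' i1.
have [z zP] := strongly_measurable_Bochner M0 SM i2.
have [lw _] := wP; have [lz _] := zP.
have lw' : Linf (fun x => - w x).
  by have := LinfZ mO muT (-1) lw; congr Lp_on; apply/funext => x; rewrite mulN1r.
exists w; split => //; apply: (Bochner_integral_eq lw' _ zP).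
apply: Linf_dual => //; first exact: LinfB.
move=> chi ic; rewrite mul0r pairingBl//.
have bu : bmf `]eps, t[ (fun r => P (u r) chi).
  apply: (bmf_pairing_u mO muT lu cu ic) => //; exact: ltW.
have bv : bmf `]eps, t[ (fun r => P (V r) chi) by exact: bmf_pairing M0 SM ic.
have b1 : bmf `]eps, t[ (fun r => derive1 phi r * P (u r) chi).
  by apply: bmfM => //; exact/bmf_smooth/smooth_derive1.
have b2 : bmf `]eps, t[ (fun r => phi r * P (V r) chi).
  by apply: bmfM => //; exact: bmf_smooth.
have E1 : P w chi = \int[leb]_(r in `]eps, t[) (derive1 phi r * P (u r) chi).
  apply: (Bochner_pairing mO muT _ wP ic (bmf_itv_integrable b1)).
    by move=> r art; apply: LinfZ => //; exact: lU.
  by apply: aeW => r art; rewrite pairingZl//; exact: lU.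
have E2 : P z chi = \int[leb]_(r in `]eps, t[) (phi r * P (V r) chi).
  apply: (Bochner_pairing mO muT _ zP ic (bmf_itv_integrable b2)).
    by move=> r art; apply: LinfZ => //; exact: lV.
  by apply: aeW => r art; rewrite pairingZl//; exact: lV.
have -> : (fun x => - w x) = (fun x => -1 * w x).
  by apply/funext => x; rewrite mulN1r.
rewrite pairingZl// mulN1r E1 E2 (ftc_weak et bv bu _ tphi) ?subrr//.
by move=> p q ep; apply: ftc => //; exact: lt_trans ep.
Qed.

(** The Caputo derivative exists: by the second mean value theorem the integral
of (t - s)^(-alpha) u'(s) over ]eps1, eps2[ is at most (t - eps2)^(-alpha) times
the oscillation of [u] there, which is small since [u] is continuous at 0. The
last clause passes lower bounds of these integrals to the limit. *)
Lemma Caputo_exists : exists V : R -> E,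
  [/\ forall eps, 0 < eps < t -> exists (M : R) (s : nat -> step_fun Omega),
     0 <= M /\ strongly_measurable eps t V M s,
   forall chi, L1 chi -> forall p q, 0 < p -> p <= q -> q < t ->
    P (u q) chi - P (u p) chi = \int[leb]_(r in `[p, q]) P (V r) chi &
   forall alpha, 0 < alpha < 1 -> exists W, is_Caputo Omega alpha u t W /\
     forall chi, L1 chi -> forall m e, 0 < e ->
     (forall eps, 0 < eps < e -> eps < t ->
       m <= \int[leb]_(r in `]eps, t[) (ker alpha t r * P (V r) chi)) ->
     (Gamma (1 - alpha))^-1 * m <= P W chi].
Proof.
have [V [SV ftc]] := global_derivative; exists V; split => // alpha /andP[al0 al1].
have /choice[J JP] : forall eps, exists J, 0 < eps < t ->
    is_Bochner_integral Omega eps t (fun s x => (t - s) `^ (- alpha) * V s x) J.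
  move=> eps; have [e0t|] := boolP (0 < eps < t); last by exists (fun=> 0).
  have [M [s [M0 SM]]] := SV _ e0t; have /andP[_ et] := e0t.
  have [w wP] := strongly_measurable_Bochner M0 SM (ker_integrable al1 et).
  by exists w.
have ih eps chi : 0 < eps < t -> L1 chi ->
    leb.-integrable `]eps, t[ (EFin \o (fun r => ker alpha t r * P (V r) chi)).
  move=> /[dup] e0t /andP[e0 et] ic; have [M [s [M0 SM]]] := SV _ e0t.
  apply: (@integrableM_bmf _ (measurableTypeR R) R leb).
  - exact: measurable_itv.
  - exact: ker_integrable.
  - exact: bmf_pairing M0 SM ic.
have JE eps chi : 0 < eps < t -> L1 chi ->
    P (J eps) chi = \int[leb]_(r in `]eps, t[) (ker alpha t r * P (V r) chi).
  move=> e0t ic; have [M [s [M0 [lV VM sV]]]] := SV _ e0t.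
  apply: (Bochner_pairing mO muT _ (JP _ e0t) ic (ih _ _ e0t ic)).
    by move=> r art; apply: LinfZ => //; exact: lV.
  by apply: aeW => r art; rewrite pairingZl//; exact: lV.
have lJ eps : 0 < eps < t -> Linf (J eps) by move=> /JP[].
have t20 : 0 < t / 2 by rewrite divr_gt0.
have t2t : t / 2 < t by rewrite ltr_pdivrMr// ltr_pMr// ltr1n.
(* The truncated integrals J eps satisfy the Cauchy condition as eps tends to 0.
   Below t / 2, the kernel is bounded by its value K at t / 2. *)
have JC eta : 0 < eta -> exists2 delta, 0 < delta & forall e1 e2,
    0 < e1 -> e1 <= e2 -> e2 < delta -> e2 < t / 2 ->
    ('N (J e1 \- J e2) <= eta%:E)%E.
  move=> eta0; pose K := ker alpha t (t / 2).
  have K0 : 0 < K by exact: ker_gt0.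
  have eta' : 0 < eta / (K * 2) by rewrite divr_gt0// mulr_gt0.
  have [|delta d0 dP] := cu _ eta' (s := 0); first by rewrite lexx ltW.
  exists delta => // e1 e2 e10 e12 e2d e2t.
  have e20 := lt_le_trans e10 e12.
  have e2t' : e2 < t := lt_trans e2t t2t.
  have e1t : 0 < e1 < t by rewrite e10 (le_lt_trans e12).
  have e2t0 : 0 < e2 < t by rewrite e20.
  apply: Linf_dual => //; [exact: ltW|by apply: LinfB => //; exact: lJ|].
  move=> chi ic; rewrite pairingBl//; [|exact: lJ|exact: lJ].
  set C := \int[mu]_(x in Omega) `|chi x|.
  have C0 : 0 <= C by exact: Rintegral_ge0.
  have bV : bmf `[e1, e2] (fun r => P (V r) chi).
    have e120 : 0 < e1 / 2 by rewrite divr_gt0.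
    have e12' : e1 / 2 < e1 by rewrite ltr_pdivrMr// ltr_pMr// ltr1n.
    have [|M [s [M0 SM]]] := SV (e1 / 2).
      by rewrite e120 (lt_trans e12')//; case/andP : e1t.
    apply: (@bmfS _ (measurableTypeR R) R `]e1 / 2, t[); first exact: measurable_itv.
      by apply: subset_itv; rewrite bnd_simp.
    exact: bmf_pairing M0 SM ic.
  pose h r := ker alpha t r * P (V r) chi.
  have ih1 : leb.-integrable `]e1, t[ (EFin \o h) by exact: ih.
  rewrite !JE// -[X in X - _]/(\int[leb]_(r in `]e1, t[) h r)
    -[X in _ - X]/(\int[leb]_(r in `]e2, t[) h r).
  have bh : bmf `[e1, e2] h.
    apply: bmfM => //; split; first exact: measurable_ker.
    exists (ker alpha t e2) => r /=; rewrite in_itv/= => /andP[_ re].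
    by rewrite ger0_norm ?ker_ge0// ker_nd.
  have ihc := bmf_itv_integrable bh.
  have -> : \int[leb]_(r in `]e1, t[) h r =
      \int[leb]_(r in `[e1, e2]) h r + \int[leb]_(r in `]e2, t[) h r.
    rewrite -(@Rintegral_itvB R h (BRight e1) (BLeft t) e2)// ?bnd_simp//.
    rewrite [X in _ - X]Rintegral_itv_obnd_cbnd; first by rewrite addrC subrK.
    apply: integrableS ihc => //; apply: subset_itv; by rewrite bnd_simp.
  rewrite addrK; have osc s : e1 <= s -> s <= e2 ->
      P (u e2) chi - P (u s) chi <= eta / K * C.
    move=> es se; have s0 := lt_le_trans e10 es.
    have le2 : Linf (u e2) by apply: lu; rewrite !ltW.
    have ls : Linf (u s) by apply: lu; rewrite (ltW s0) (le_trans se)// ltW.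
    rewrite -pairingBl//; apply: (le_trans (ler_norm _)).
    apply: pairing_le => //; [by rewrite ltW// divr_gt0|exact: LinfB|].
    apply: le_trans (Lnorm_on_tri muT _ (u 0) _) _.
    have -> : eta / K = eta / (K * 2) + eta / (K * 2).
      by field; rewrite gt_eqF.
    rewrite EFinD leeD//; last first.
      by apply: dP; rewrite ?(ltW s0) ?(le_trans se (ltW e2t'))// sub0r normrN gtr0_norm// (le_lt_trans se).
    by rewrite Lnorm_onC; apply: dP; rewrite ?(ltW e20) ?(ltW e2t')// sub0r normrN gtr0_norm.
  have H : ker alpha t e2 * (- (eta / K * C)) <=
      \int[leb]_(r in `[e1, e2]) (ker alpha t r * - P (V r) chi).
    apply: (@second_mean_value R e1 e2 e2) => //.
    - exact/bmfN.
    - by move=> x _; exact: ker_ge0.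
    - by move=> x y _ xy ye; apply: ker_nd => //; exact: le_lt_trans e2t'.
    - by move=> x e2x; congr ker; apply/eqP; rewrite eq_le andbC.
    - exact: measurable_ker.
    - move=> s es se; have -> : \int[leb]_(x in `[s, e2]) (- P (V x) chi) =
          - \int[leb]_(x in `[s, e2]) P (V x) chi.
        apply: RintegralN => //; apply: bmf_itv_integrable.
        apply: (@bmfS _ (measurableTypeR R) R `[e1, e2]) => //.
        by apply: subset_itv; rewrite bnd_simp.
      by rewrite lerN2 -ftc ?osc// (lt_le_trans e10).
  have -> : \int[leb]_(r in `[e1, e2]) h r =
      - \int[leb]_(r in `[e1, e2]) (ker alpha t r * - P (V r) chi).
    rewrite -RintegralN//; last first.
      apply: bmf_itv_integrable; rewrite (_ : (fun _ => _) = (fun r => - h r)).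
        exact: bmfN.
      by apply/funext => r; rewrite mulrN.
    by apply: eq_Rintegral => r _; rewrite mulrN opprK.
  rewrite lerNl; apply: le_trans H; rewrite mulrN lerN2.
  have -> : eta * C = K * (eta / K * C) by field; rewrite gt_eqF.
  apply: ler_wpM2r; first by rewrite mulr_ge0// divr_ge0// ltW.
  by apply: ker_nd => //; exact: ltW.
pose e n : R := t / n.+3%:R.
have e0 n : 0 < e n by rewrite divr_gt0.
have e2 n : e n < t / 2 by rewrite ltr_pM2l// ltf_pV2 ?posrE// ltr_nat.
have et n : 0 < e n < t by rewrite e0 (lt_trans (e2 n)).
have e_nd m n : (m <= n)%N -> e n <= e m.
  by move=> mn; rewrite ler_pM2l// lef_pV2 ?posrE// ler_nat.
have e_small x : 0 < x -> exists N, forall n, (N <= n)%N -> e n < x.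
  move=> x0; exists (Num.truncn (t / x)) => n Nn.
  rewrite ltr_pdivrMr// mulrC -ltr_pdivrMr//.
  have /truncn_itv/andP[_ H] : 0 <= t / x by rewrite divr_ge0// ltW.
  by apply: (lt_le_trans H); rewrite ler_nat ltnS (leq_trans Nn)// ltnW// ltnW.
have lJe n : Linf (J (e n)) by exact: lJ.
have JeC eta : 0 < eta -> exists N, forall n m, (N <= n)%N -> (N <= m)%N ->
    ('N (J (e m) \- J (e n)) <= eta%:E)%E.
  move=> eta0; have [delta d0 dP] := JC _ eta0; have [N NP] := e_small _ d0.
  exists N => n m Nn Nm; have [nm|mn] := leqP n m.
    by apply: dP => //; [exact: e_nd|exact: NP].
  by rewrite Lnorm_onC; apply: dP => //; [exact/e_nd/ltnW|exact: NP].
have [w lw wP] := Linf_complete mO muT lJe JeC.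
have wJ eta : 0 < eta -> exists2 delta, 0 < delta & forall eps,
    0 < eps < delta -> eps < t /\ ('N (w \- J eps) <= eta%:E)%E.
  move=> eta0; have h0 : 0 < eta / 2 by rewrite divr_gt0.
  have [delta d0 dP] := JC _ h0; have [N NP] := wP _ h0.
  exists (Num.min delta (t / 2)); first by rewrite lt_min d0.
  move=> eps; rewrite lt_min => /and3P[ep0 ed et2]; split; first exact: lt_trans et2 _.
  have [N' N'P] := e_small _ ep0.
  apply: le_trans (Lnorm_on_tri muT _ (J (e (maxn N N'))) _) _.
  rewrite (splitr eta) EFinD leeD//; first by apply: NP; exact: leq_maxl.
  by apply: dP => //; apply/ltW/N'P; exact: leq_maxr.
have G0 : 0 < (Gamma (1 - alpha))^-1.
  by rewrite invr_gt0 Gamma_gt0 ?subr_gt0// lerBlDr lerDl ltW.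
exists (fun x => (Gamma (1 - alpha))^-1 * w x); split.
  split; first exact: LinfZ.
  exists V; split.
    move=> eps e0t; have [M [s [M0 SM]]] := SV _ e0t.
    exact: primitive_weak_derivative e0t M0 SM ftc.
  exists J; split => //.
  apply: cvge0P => [n|eta eta0]; first exact: Lnorm_ge0.
  have [|delta d0 dP] := wJ (eta / (Gamma (1 - alpha))^-1); first by rewrite divr_gt0.
  exists delta => //= eps /=; rewrite sub0r normrN => + ep0; rewrite gtr0_norm// => ed.
  rewrite (_ : _ \- _ = fun x => (Gamma (1 - alpha))^-1 * (w \- J eps) x); last first.
    by apply/funext => x /=; rewrite mulrBr.
  rewrite Lnorm_onZ// gtr0_norm// -lee_pdivlMl// -EFinM mulrC.
  by have [|_] := dP eps; rewrite ?ep0.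
move=> chi ic m e' e'0 H; rewrite pairingZl// ler_pM2l//.
pose C := \int[mu]_(x in Omega) `|chi x|.
have C0 : 0 <= C by exact: Rintegral_ge0.
apply/ler_addgt0Pr => x x0.
have C1 : 0 < C + 1 by rewrite ltr_pwDr.
have [|delta d0 dP] := wJ (x / (C + 1)); first by rewrite divr_gt0.
pose y := Num.min delta e' / 2.
have y0 : 0 < y by rewrite divr_gt0// lt_min d0.
have : y < Num.min delta e' by rewrite ltr_pdivrMr// ltr_pMr ?lt_min ?d0// ltr1n.
rewrite lt_min => /andP[yd ye].
have [|yt wy] := dP y; first by rewrite y0.
have := H y; rewrite y0 ye -JE ?y0// => /(_ isT yt) /le_trans; apply.
rewrite addrC -lerBlDr -pairingBl//; last by apply: lJ; rewrite y0.
apply: (le_trans (ler_norm _)); apply: (@le_trans _ _ (x / (C + 1) * C)).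
  apply: pairing_le => //; first by rewrite divr_ge0 ?(ltW x0) ?(ltW C1).
    by apply: LinfB => //; apply: lJ; rewrite y0.
  by rewrite Lnorm_onC.
by rewrite mulrAC ler_pdivrMr// ler_wpM2l ?(ltW x0)// lerDl.
Qed.

End Caputo.

(** * Lower bound of the Caputo derivative *)

Section kernel_lower_bound.
Context (R : realType).
Local Notation leb := (@lebesgue_measure R).
Local Notation bmf := (@bmf _ (measurableTypeR R) R).

(** If [g], with derivative [h], stays below [eta] up to time [c] and below [M]
up to time b = t - r, the singular integral of [h] is at least about
(t - c)^(-alpha) (gb - eta). The kernel is the sum of its truncation at height
(t - c)^(-alpha), constant on [c, b], and of a remainder which only sees the
defect M - g b; both are nondecreasing, so that the second mean value theorem
applies to each of them. *)
Lemma ker_integral_ge alpha t (g h : R -> R) eps c r eta M gb L :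
  0 < alpha < 1 -> 0 < eps -> eps <= c -> c < t - r -> 0 < r ->
  bmf `]eps / 2, t[ h ->
  (forall p q, 0 < p -> p <= q -> q < t ->
     g q - g p = \int[leb]_(s in `[p, q]) h s) ->
  (forall s, 0 < s -> s <= c -> g s <= eta) ->
  (forall s, 0 < s -> s <= t - r -> g s <= M) ->
  gb <= g (t - r) -> gb <= M ->
  0 <= L -> (forall s, t - r < s < t -> `|h s| <= L) ->
  (t - c) `^ (- alpha) * (gb - eta) - r `^ (- alpha) * (M - gb)
    - L * (r `^ (1 - alpha) / (1 - alpha)) <=
  \int[leb]_(s in `]eps, t[) (ker alpha t s * h s).
Proof.
move=> /andP[al0 al1] e0 ec cb r0 bh ftc gc gM gbr gbM L0 hL.
set b := t - r; have bt : b < t by rewrite ltrBlDr ltrDl.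
have eb : eps < b by exact: le_lt_trans cb.
have e2 : eps / 2 < eps by rewrite ltr_pdivrMr// ltr_pMr// ltr1n.
have et : eps < t := lt_trans eb bt.
have bheb : bmf `[eps, b] h.
  apply: (@bmfS _ (measurableTypeR R) R `]eps / 2, t[) bh; first exact: measurable_itv.
  by apply: subset_itv; rewrite bnd_simp.
have bhet : bmf `]eps, t[ h.
  apply: (@bmfS _ (measurableTypeR R) R `]eps / 2, t[) bh; first exact: measurable_itv.
  by apply: subset_itv; rewrite bnd_simp ?(ltW e2).
have ikh : leb.-integrable `]eps, t[ (EFin \o (fun s => ker alpha t s * h s)).
  apply: (@integrableM_bmf _ (measurableTypeR R) R leb) => //.
  exact: ker_integrable.
have bker : bmf `[eps, b] (ker alpha t).
  split; first exact: measurable_ker.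
  exists (ker alpha t b) => s /=; rewrite in_itv/= => /andP[_ sb].
  by rewrite ger0_norm ?ker_ge0// ker_nd.
have bkh : bmf `[eps, b] (fun s => ker alpha t s * h s) by exact: bmfM.
have ikheb := bmf_itv_integrable bkh.
have -> : \int[leb]_(s in `]eps, t[) (ker alpha t s * h s) =
    \int[leb]_(s in `[eps, b]) (ker alpha t s * h s) +
    \int[leb]_(s in `]b, t[) (ker alpha t s * h s).
  rewrite -(@Rintegral_itvB R _ (BRight eps) (BLeft t) b)// ?bnd_simp//; last exact: ltW.
  rewrite [X in _ - X]Rintegral_itv_obnd_cbnd; first by rewrite addrC subrK.
  by apply: integrableS ikheb => //; apply: subset_itv; rewrite bnd_simp.
apply: lerD; last first.
  have ik := ker_integrable al1 bt.
  have ikbt : leb.-integrable `]b, t[ (EFin \o (fun s => ker alpha t s * h s)).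
    apply: integrableS ikh => //; apply: subset_itv; rewrite bnd_simp//; exact: ltW.
  rewrite lerNl; apply: (le_trans (ler_norm _)); rewrite normrN.
  apply: (le_trans (le_normr_Rintegral _ ikbt)) => //.
  apply: (@le_trans _ _ (\int[leb]_(s in `]b, t[) (L * ker alpha t s))).
    apply: le_Rintegral => //.
    - exact: integrable_norm.
    - exact: integrable_cmul.
    - move=> s; rewrite /= in_itv/= => sbt.
      by rewrite normrM (ger0_norm (ker_ge0 _ _ _)) mulrC ler_wpM2r ?ker_ge0// hL.
  rewrite RintegralZl//; apply: ler_wpM2l => //.
  rewrite /Rintegral -lee_fin fineK; last exact: integrable_fin_num.
  by apply: le_trans (ker_integral_le al1 bt) _; rewrite opprB addrCA subrr addr0.
(* k1 is the truncation of the kernel, k2 the remainder. *)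
pose kap := ker alpha t c.
have ct : c < t := lt_trans cb bt.
pose k1 s := Num.min (ker alpha t s) kap.
pose k2 s := ker alpha t s - k1 s.
have mk1 : measurable_fun `[eps, b] k1.
  by apply: measurable_minr; [exact: measurable_ker|exact: measurable_cst].
have mk2 : measurable_fun `[eps, b] k2.
  by apply: measurable_funB => //; exact: measurable_ker.
have kap0 : 0 <= kap by exact: ker_ge0.
have k10 s : 0 <= k1 s by rewrite le_min ker_ge0.
have k20 s : 0 <= k2 s by rewrite subr_ge0 ge_min lexx.
have k2E s : k2 s = Num.max 0 (ker alpha t s - kap).
  rewrite /k2 /k1; case: (leP (ker alpha t s) kap) => H.
    by rewrite subrr max_l// subr_le0.
  by rewrite max_r// subr_ge0 ltW.
have H1 : kap * (gb - eta) <= \int[leb]_(s in `[eps, b]) (k1 s * h s).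
  apply: (@second_mean_value R eps b c) => //; first exact: ltW.
  - move=> x y ex xy yb; rewrite /k1 le_min !ge_min lexx orbT andbT.
    by rewrite ker_nd// (le_lt_trans yb).
  - move=> x /andP[cx xb]; rewrite /k1 min_r//; apply: ker_nd => //.
    exact: le_lt_trans bt.
  - move=> s es sc; have s0 := lt_le_trans e0 es.
    rewrite -ftc// ?lerB ?gc//; exact: le_trans sc (ltW cb).
have H2 : k2 b * (gb - M) <= \int[leb]_(s in `[eps, b]) (k2 s * h s).
  apply: (@second_mean_value R eps b b) => //; first exact: ltW.
  - move=> x y ex xy yb; rewrite !k2E ge_max le_max lexx/= le_max lerD2r.
    by rewrite ker_nd ?orbT// (le_lt_trans yb).
  - by move=> x bx; congr k2; apply/eqP; rewrite eq_le andbC.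
  - move=> s es sb; have s0 := lt_le_trans e0 es.
    by rewrite -ftc// lerB// gM.
have -> : \int[leb]_(s in `[eps, b]) (ker alpha t s * h s) =
    \int[leb]_(s in `[eps, b]) (k1 s * h s) + \int[leb]_(s in `[eps, b]) (k2 s * h s).
  have bk1 : bmf `[eps, b] k1.
    by split => //; exists kap => s _; rewrite ger0_norm// ge_min lexx orbT.
  have bk2 : bmf `[eps, b] k2 by exact: bmfB.
  rewrite -RintegralD//; last 2 first.
  - exact/bmf_itv_integrable/bmfM.
  - exact/bmf_itv_integrable/bmfM.
  by apply: eq_Rintegral => s _; rewrite -mulrDl addrC subrK.
apply: lerD; first exact: H1.
apply: le_trans H2; rewrite -mulrN opprB.
rewrite ler_wnM2r ?subr_le0//.
have -> : r `^ (- alpha) = ker alpha t b by rewrite /ker opprB addrCA subrr addr0.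
by rewrite gerBl.
Qed.

End kernel_lower_bound.

Section Caputo_lower_bound.
Context (R : realType) (d : nat) (Omega : set 'rV[R]_d).
Local Notation mu := (lebesgue_rV R d).
Local Notation leb := (@lebesgue_measure R).
Local Notation E := ('rV[R]_d -> R).
Local Notation Linf := (Lp_on mu Omega +oo%E).
Local Notation "'N f" := (Lnorm_on mu Omega +oo%E f%R) (at level 10, f at level 8).
Local Notation L1 chi := (mu.-integrable Omega (EFin \o chi)).
Local Notation P := (pairing mu Omega).
Local Notation bmf := (@bmf _ (measurableTypeR R) R).
Hypotheses (mO : measurable Omega) (muO : (mu Omega < +oo)%E)
  (muT : (0 < mu [set: 'rV[R]_d])%E).

Lemma pairing_ub f K chi : Linf f -> L1 chi -> (forall x, 0 <= chi x) ->
  {ae mu, forall x, Omega x -> f x <= K} ->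
  P f chi <= K * \int[mu]_(x in Omega) chi x.
Proof.
move=> lf ic chi0 fK; rewrite -RintegralZl//.
have i1 : L1 (fun x => f x * chi x) by exact: Linf_integrable.
have i2 : L1 (fun x => K * chi x) by exact: integrable_cmul.
apply: le_Rintegral_ae => //.
by apply: filterS fK => x fx Ox; rewrite ler_wpM2r// fx.
Qed.

Variables (t : R) (u : R -> E).
Hypotheses (t0 : 0 < t) (lu : forall s, 0 <= s <= t -> Linf (u s))
  (cu : forall s, 0 <= s <= t -> forall eps, 0 < eps -> exists2 delta, 0 < delta &
     forall r, 0 <= r <= t -> `|s - r| < delta -> ('N (u s \- u r) <= eps%:E)%E)
  (Wu : forall eps, 0 < eps < t -> W1inf_Linf Omega eps t u).

(** [ker_integral_ge] for the pairing of [u] with [chi]. The constant [L] bounds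
the time derivative on ]t/2, t[, so that the pairing at time t - r is at least
that at time t, minus L r times the integral of [chi]. *)
Lemma Caputo_lower_bound : exists2 L, 0 <= L & forall alpha, 0 < alpha < 1 ->
  exists W, is_Caputo Omega alpha u t W /\
  forall chi, L1 chi -> (forall x, 0 <= chi x) -> forall c r eta M k,
    0 < c -> 0 < r -> r < t / 2 -> c < t - r -> k <= M ->
    (forall s, 0 <= s <= c -> {ae mu, forall x, Omega x -> u s x <= eta}) ->
    (forall s, 0 <= s <= t -> {ae mu, forall x, Omega x -> u s x <= M}) ->
    k * (\int[mu]_(x in Omega) chi x) <= P (u t) chi ->
    (Gamma (1 - alpha))^-1 * (((t - c) `^ (- alpha) * (k - L * r - eta)
        - r `^ (- alpha) * (M - (k - L * r)) - L * (r `^ (1 - alpha) / (1 - alpha)))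
      * (\int[mu]_(x in Omega) chi x)) <= P W chi.
Proof.
have [V [SV ftc caputo]] := Caputo_exists mO muO muT t0 lu cu Wu.
have t20 : 0 < t / 2 by rewrite divr_gt0.
have t2t : t / 2 < t by rewrite ltr_pdivrMr// ltr_pMr// ltr1n.
have [|L [s' [L0 SM]]] := SV (t / 2); first by rewrite t20.
exists L => // alpha al; have [W [cW WP]] := caputo _ al; exists W; split => //.
move=> chi ic chi0 c r eta M k c0 r0 rt2 cr kM ueta uM kg.
set C := \int[mu]_(x in Omega) chi x.
have C0 : 0 <= C by exact: Rintegral_ge0.
have CE : \int[mu]_(x in Omega) `|chi x| = C.
  by apply: eq_Rintegral => x _; rewrite ger0_norm.
have trt : t - r < t by rewrite ltrBlDr ltrDl.
have t2r : t / 2 < t - r by rewrite ltrBrDr -ltrBrDl {1}(splitr t) addrK.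
have tr0 : 0 < t - r := lt_trans t20 t2r.
have hL s : t / 2 < s < t -> `|P (V s) chi| <= L * C.
  move=> st; have [lV VM _] := SM.
  by rewrite -CE; apply: pairing_le => //; [exact: lV|exact: VM].
apply: (WP _ ic _ c) => // eps /andP[e0 ec] et.
have gbr : (k - L * r) * C <= P (u (t - r)) chi.
  apply/ler_addgt0Pr => x x0; have C1 : 0 < C + 1 by rewrite ltr_pwDr.
  have tt : 0 <= t <= t by rewrite lexx ltW.
  have xC : 0 < x / (C + 1) by rewrite divr_gt0.
  have [delta d0 dP] := cu tt xC.
  pose q := Num.max (t - r) (t - delta / 2).
  have qt : q < t by rewrite gt_max trt ltrBlDr ltrDl divr_gt0.
  have rq : t - r <= q by rewrite le_max lexx.
  have q0 : 0 < q := lt_le_trans tr0 rq.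
  have lq : Linf (u q) by apply: lu; rewrite !ltW.
  have lt_ : Linf (u t) by apply: lu; rewrite lexx ltW.
  have H1 : P (u t) chi - P (u q) chi <= x.
    rewrite -pairingBl//; apply: (le_trans (ler_norm _)).
    apply: (@le_trans _ _ (x / (C + 1) * C)).
      rewrite -CE CE -{2}CE; apply: pairing_le => //.
      - by rewrite divr_ge0// ltW.
      - exact: LinfB.
      - apply: dP; first by rewrite !ltW.
        rewrite gtr0_norm ?subr_gt0// ltrBlDr -ltrBlDl lt_max; apply/orP; right.
        by rewrite ltrD2l ltrN2 ltr_pdivrMr// ltr_pMr// ltr1n.
    by rewrite mulrAC ler_pdivrMr// ler_wpM2l ?(ltW x0)// lerDl.
  have H2 : P (u q) chi - P (u (t - r)) chi <= L * C * r.
    rewrite ftc//; apply: (le_trans (ler_norm _)).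
    apply: (@le_trans _ _ (L * C * (q - (t - r)))).
      apply: norm_Rintegral_cc_le => //.
        have [mV _] := bmf_pairing mO muT L0 SM ic; apply: measurable_funS mV.
          exact: measurable_itv.
        by apply: subset_itv; rewrite bnd_simp.
      by move=> s /andP[rs sq]; apply: hL; rewrite (lt_le_trans t2r)//= (le_lt_trans sq).
    rewrite ler_wpM2l ?mulr_ge0// lerBlDr addrC subrK; exact: ltW.
  have := kg; rewrite -/C; nra.
have -> : ((t - c) `^ (- alpha) * (k - L * r - eta) - r `^ (- alpha) * (M - (k - L * r))
    - L * (r `^ (1 - alpha) / (1 - alpha))) * C =
    (t - c) `^ (- alpha) * ((k - L * r) * C - eta * C)
    - r `^ (- alpha) * (M * C - (k - L * r) * C)
    - (L * C) * (r `^ (1 - alpha) / (1 - alpha)) by ring.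
have e20 : 0 < eps / 2 by rewrite divr_gt0.
have e2 : eps / 2 < eps by rewrite ltr_pdivrMr// ltr_pMr// ltr1n.
have [|M' [s'' [M'0 SM']]] := SV (eps / 2); first by rewrite e20 (lt_trans e2).
apply: (@ker_integral_ge R alpha t (fun s => P (u s) chi) (fun s => P (V s) chi)) => //.
- exact: ltW.
- exact: bmf_pairing M'0 SM' ic.
- by move=> p q p0 pq qt; exact: ftc.
- move=> s s0 sc; apply: pairing_ub => //; last by apply: ueta; rewrite ltW.
  by apply: lu; rewrite ltW//= (le_trans sc)// ltW// (lt_trans cr).
- move=> s s0 sr; have st : 0 <= s <= t by rewrite ltW//= (le_trans sr)// ltW.
  by apply: pairing_ub => //; [exact: lu|exact: uM].
- by apply: ler_wpM2r => //; rewrite lerBlDr (le_trans kM)// lerDl mulr_ge0// ltW.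
- exact: mulr_ge0.
- by move=> s /andP[rs st]; apply: hL; rewrite (lt_trans t2r).
Qed.

End Caputo_lower_bound.

(** * The divergence theorem *)

(** [L] is the linear part of the affine map [A]. *)
Section smooth_slices.
Context (R : realType) (V W : normedModType R) (A L : V -> W).
Hypotheses (cA : continuous A) (AL : forall y v h, A (h *: v + y) = h *: L v + A y).

Lemma derive_slice (f : W -> R) y v : 'D_v (fun z => f (A z)) y = 'D_(L v) f (A y).
Proof. by rewrite /derive; under eq_fun do rewrite /= AL. Qed.

Lemma smooth_slice (f : W -> R) : smooth f -> smooth (fun z => f (A z)).
Proof.
move=> sf; apply: (@Ck_ind R V (fun g => exists2 f, smooth f & g = fun z => f (A z))).
- move=> _ [g sg ->] x; apply: continuous_comp; first exact: cA.
  exact: smooth_continuous.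
- move=> _ [g sg ->] x v; rewrite /derivable.
  under eq_fun do rewrite /= AL; exact: smooth_derivable.
- move=> _ [g sg ->] v; exists (fun x => 'D_(L v) g x); first exact: smooth_derive.
  by apply/funext => y; rewrite derive_slice.
- by exists f.
Qed.

End smooth_slices.

Section rV.
Context (R : realType).
Local Notation leb := (@lebesgue_measure R).

Lemma coord_le_norm n (x : 'rV[R]_n) j : `|x ord0 j| <= `|x|.
Proof.
rewrite [leRHS]/Num.norm/= mx_normrE.
exact: (@le_bigmax _ _ _ 0 (fun ij : 'I_1 * 'I_n => `|x ij.1 ij.2|) (ord0, j)).
Qed.

Definition cube n (M : R) : set 'rV[R]_n := [set x | forall i, `[- M, M]%classic (x ord0 i)].

Lemma compact_cube n (M : R) : compact (cube (n := n) M).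
Proof. by apply: (@rV_compact _ n (fun=> `[- M, M]%classic)) => i; exact: segment_compact. Qed.

Lemma measurable_cube n (M : R) : measurable (cube (n := n) M).
Proof.
by apply: (@measurable_rV_box R n (fun=> `[- M, M]%classic)) => i; exact: measurable_itv.
Qed.

Lemma lebesgue_cube_lty n (M : R) : (lebesgue_rV R n (cube M) < +oo)%E.
Proof.
rewrite (@lebesgue_rV_box R n (fun=> `[- M, M]%classic)); last by move=> i; exact: measurable_itv.
set I := [set` _]; have H : (leb I < +oo)%E by exact: leb_itv_lty.
suff : (0 <= \prod_(i < n) leb I < +oo)%E by case/andP.
elim: n => [|n /andP[IH0 IH]]; first by rewrite big_ord0 lee01 ltry.
by rewrite big_ord_recl mule_ge0//= lte_mul_pinfty// ge0_fin_numE.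
Qed.

Lemma lebesgue_rV_setT_gt0 n : (0 < lebesgue_rV R n setT)%E.
Proof.
have H : lebesgue_rV R n [set x : 'rV[R]_n | forall i, `[0, 1]%classic (x ord0 i)] = 1%E.
  rewrite (@lebesgue_rV_box R n (fun=> `[0, 1]%classic)); last by move=> i; exact: measurable_itv.
  rewrite big1// => i _; rewrite lebesgue_measure_itv/= lte_fin ltr01.
  by rewrite oppr0 adde0.
apply: (@lt_le_trans _ _ 1%E) => //; rewrite -H; apply: le_measure; rewrite ?inE//.
by apply: (@measurable_rV_box R n (fun=> `[0, 1]%classic)) => i; exact: measurable_itv.
Qed.

(** Open sets are countable unions of rational cubes. *)
Lemma open_measurable_rV n (U : set 'rV[R]_n) : open U -> measurable U.
Proof.
move=> oU.
pose B (p : 'rV[rat]_n * nat) : set 'rV[R]_n :=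
  [set x | forall i, ball (ratr (p.1 ord0 i) : R) p.2.+1%:R^-1 (x ord0 i)].
pose F p : set 'rV[R]_n := if `[< B p `<=` U >] then B p else set0.
rewrite (_ : U = \bigcup_p F p).
  apply: countable_bigcupT_measurable; first exact: countableP.
  move=> p; rewrite /F; case: ifPn => // _.
  apply: (@measurable_rV_box R n (fun i => ball (ratr (p.1 ord0 i) : R) p.2.+1%:R^-1)).
  by move=> i; exact: measurable_ball.
apply/seteqP; split => [x Ux|x [p _]]; last first.
  by rewrite /F; case: ifPn => // /asboolP; exact.
have [e /= e0 eU] : exists2 e : R, 0 < e & ball x e `<=` U.
  by have /nbhs_ballP[e e0 eU] := open_nbhs_nbhs (conj oU Ux); exists e.
pose k := Num.truncn (2 / e).
have k0 : 0 < k.+1%:R^-1 :> R by rewrite invr_gt0.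
have ke : k.+1%:R^-1 + k.+1%:R^-1 <= e.
  have /truncn_itv/andP[_ H] : 0 <= 2 / e by rewrite divr_ge0// ltW.
  by rewrite -mulr2n -(mulr_natl _ 2) ler_pdivrMr// mulrC -ler_pdivrMr// ltW.
have /choice[q qP] : forall i : 'I_n, exists q : rat,
    ball (x ord0 i) k.+1%:R^-1 (ratr q : R).
  move=> i; have [|q] := @rat_in_itvoo R (x ord0 i) (x ord0 i + k.+1%:R^-1).
    by rewrite ltrDl.
  rewrite in_itv/= => /andP[xq qx]; exists q; rewrite /ball/= ltr0_norm ?subr_lt0//.
  by rewrite opprB ltrBlDl.
exists (\row_i q i, k) => //; rewrite /F asboolT; last first.
  move=> y By; apply: eU; split => // i j; rewrite ord1.
  apply: le_ball ke _ _; apply: ball_triangle (qP j) _.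
  by have := By j; rewrite /= mxE.
by move=> i /=; rewrite mxE; exact/ball_sym/qP.
Qed.

Lemma continuous_measurable_rV n (f : 'rV[R]_n -> R) (D : set 'rV[R]_n) :
  continuous f -> measurable_fun D f.
Proof.
move=> cf; apply: measurable_funTS.
apply: (measurability _ (RGenOpens.measurableE R)).
move=> _ [_ [a [b ->] <-]]; rewrite setTI; apply: open_measurable_rV.
by move/continuousP : cf; apply; exact: interval_open.
Qed.

Section cons.
Variable n : nat.

Lemma continuous_nonexpansive (V W : pseudoMetricType R) (A : V -> W) :
  (forall y z e, ball y e z -> ball (A y) e (A z)) -> continuous A.
Proof.
move=> H y; apply/cvg_ballP => e e0; near=> z; apply: H.
by near: z; exact: nbhsx_ballx.
Unshelve. all: by end_near. Qed.

Definition consl (y : 'rV[R]_n) (x : R) : 'rV[R]_n.+1 := rV_cons (x, y).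
Definition consr (x : R) (y : 'rV[R]_n) : 'rV[R]_n.+1 := rV_cons (x, y).

Lemma continuous_consl y : continuous (consl y).
Proof.
apply: continuous_nonexpansive => x z e xz; split.
  exact: le_lt_trans xz.
move=> i j; rewrite ord1; have [k ->|->] := unliftP ord0 j.
  by rewrite !rV_consS; apply: ballxx; exact: le_lt_trans xz.
by rewrite !rV_cons0.
Qed.

Lemma continuous_consr x : continuous (consr x).
Proof.
apply: continuous_nonexpansive => y z e [e0 yz]; split => // i j.
rewrite ord1; have [k ->|->] := unliftP ord0 j; first by rewrite !rV_consS; exact: yz.
by rewrite !rV_cons0; exact: ballxx.
Qed.

Lemma consl_affine y x v h : consl y (h *: v + x) = h *: consl 0 v + consl y x.
Proof.
apply/rowP => j; rewrite [RHS]mxE [X in _ = X + _]mxE /consl.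
by have [k ->|->] := unliftP ord0 j; rewrite ?rV_consS ?rV_cons0//= mxE mulr0 add0r.
Qed.

Lemma consr_affine x y v h : consr x (h *: v + y) = h *: consr 0 v + consr x y.
Proof.
apply/rowP => j; rewrite [RHS]mxE [X in _ = X + _]mxE /consr.
have [k ->|->] := unliftP ord0 j; rewrite ?rV_consS ?rV_cons0/= ?mulr0 ?add0r//.
by rewrite !mxE.
Qed.

Lemma consl_delta : consl 0 1 = delta_mx ord0 ord0.
Proof.
apply/rowP => j; rewrite [RHS]mxE /consl.
by have [k ->|->] := unliftP ord0 j; rewrite ?rV_consS ?rV_cons0//= mxE.
Qed.

Lemma consr_delta j : consr 0 (delta_mx ord0 j) = delta_mx ord0 (lift ord0 j).
Proof.
apply/rowP => i; rewrite [RHS]mxE /consr.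
have [k ->|->] := unliftP ord0 i; rewrite ?rV_consS ?rV_cons0//= mxE.
by rewrite (inj_eq lift_inj).
Qed.

End cons.

Lemma cube0 n (M : R) (g : 'rV[R]_n -> R) :
  (forall (x : 'rV[R]_n) j, M < `|x ord0 j| -> g x = 0) ->
  forall x, ~ cube M x -> g x = 0.
Proof.
move=> g0 x /existsNP[j]; rewrite /= in_itv/= -ler_norml => /negP; rewrite -ltNge.
exact: g0.
Qed.

Lemma integrable_cube n (M : R) (g : 'rV[R]_n -> R) : continuous g ->
  (forall (x : 'rV[R]_n) j, M < `|x ord0 j| -> g x = 0) ->
  (lebesgue_rV R n).-integrable setT (EFin \o g).
Proof.
move=> cg g0.
have H : (lebesgue_rV R n).-integrable (cube M) (EFin \o g).
  apply: measurable_bounded_integrable; [exact: measurable_cube|exact: lebesgue_cube_lty|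
    exact: continuous_measurable_rV|].
  have : compact (g @` cube M).
    by apply: continuous_compact; [exact: continuous_subspaceT|exact: compact_cube].
  move=> /compact_bounded[K [Kr KP]]; exists K; split => // y Ky x cx.
  by apply: KP => //; exists x.
have := (integrable_mkcond (EFin \o g) (@measurable_cube n M)).1 H.
rewrite (_ : _ \_ _ = EFin \o g)//; apply/funext => x; rewrite patchE.
by case: ifPn => //; rewrite notin_setE /= => /(cube0 g0) ->.
Qed.

Lemma vanish_derive n (M : R) (f : 'rV[R]_n -> R) v :
  (forall (x : 'rV[R]_n) j, M < `|x ord0 j| -> f x = 0) ->
  forall (x : 'rV[R]_n) j, M < `|x ord0 j| -> 'D_v f x = 0.
Proof.
move=> f0 x j xj; rewrite (@near_eq_derive _ _ _ _ (cst 0)) ?derive_cst//.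
have c : {for x, continuous (fun y : 'rV[R]_n => `|y ord0 j|)}.
  by apply: continuous_comp; [exact: coord_continuous|exact: norm_continuous].
have H : \forall y \near x, M < `|(y : 'rV[R]_n) ord0 j| by exact: (cvgr_gt _ c).
by apply: filterS H => y; exact: f0.
Qed.

(** The Lebesgue measure in dimension n + 1 is the image of a product measure,
to which Fubini's theorem applies. *)
Lemma integral_pushforward_cons n (g : 'rV[R]_n.+1 -> R) :
  (lebesgue_rV R n.+1).-integrable setT (EFin \o g) ->
  ((leb \x lebesgue_rV R n)%E).-integrable setT (EFin \o (fun p => g (rV_cons p))) /\
  (\int[lebesgue_rV R n.+1]_x (g x)%:E =
   \int[leb \x lebesgue_rV R n]_p (g (rV_cons p))%:E)%E.
Proof.
move=> ig.
have mg : measurable_fun setT (EFin \o g) by exact: measurable_int ig.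
have mgc : measurable_fun setT (EFin \o (fun p => g (rV_cons p))).
  by apply: (measurableT_comp mg); exact: measurable_rV_cons.
pose prod : {measure set (measurableTypeR R * 'rV[R]_n)%type -> \bar R} :=
  (leb \x lebesgue_rV R n)%E.
have mc := @measurable_rV_cons R n.
have ic : prod.-integrable setT (EFin \o (fun p => g (rV_cons p))).
  apply/integrableP; split => //; have [_ goo] := integrableP _ _ _ ig.
  have := @ge0_integral_pushforward _ _ _ _ R _ mc prod setT (fun x => `|(g x)%:E|%E).
  rewrite preimage_setT => <-//; last exact: measurableT_comp.
split => //.
have := @integral_pushforward _ _ _ _ R _ mc prod setT (EFin \o g) mg.
rewrite preimage_setT => /(_ ic measurableT) <-.
by apply: eq_measure_integral.
Qed.

(** By Fubini's theorem, integrate first with respect to the coordinate [i] if it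
is the first one, and otherwise with respect to all the coordinates but the
first one, where the result is known by induction. *)
Lemma integral_derive_eq0 n (f : 'rV[R]_n -> R) (M : R) (i : 'I_n) :
  smooth f -> (forall (x : 'rV[R]_n) j, M < `|x ord0 j| -> f x = 0) ->
  (\int[lebesgue_rV R n]_x ('D_(delta_mx ord0 i) f x)%:E = 0)%E.
Proof.
elim: n f i => [|n IH] f i sf f0; first by case: i.
set g := fun x => 'D_(delta_mx ord0 i) f x.
have ig : (lebesgue_rV R n.+1).-integrable setT (EFin \o g).
  apply: (@integrable_cube _ M); last exact: vanish_derive.
  exact/smooth_continuous/smooth_derive.
have [ic ->] := integral_pushforward_cons ig.
have [k iE|iE] := unliftP ord0 i.
  rewrite -(integral12_prod_meas1 ic) integral0_eq// => x _.
  rewrite -(IH (fun y => f (consr x y)) k).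
  - by apply: eq_integral => y _; rewrite (derive_slice (consr_affine x)) consr_delta -iE.
  - exact: (@smooth_slice R _ _ (consr x) (consr 0) (@continuous_consr n x)
      (consr_affine x) f sf).
  - by move=> y j yj; apply: (f0 _ (lift ord0 j)); rewrite rV_consS.
rewrite -(integral21_prod_meas1 ic) integral0_eq// => y _.
pose h z := f (consl y z).
have sh : smooth h.
  exact: (@smooth_slice R _ _ (consl y) (consl 0) (@continuous_consl n y)
    (consl_affine y) f sf).
have h0 z : M < `|z| -> h z = 0.
  by move=> Mz; apply: (f0 _ ord0); rewrite rV_cons0.
have hE z : g (rV_cons (z, y)) = derive1 h z.
  by rewrite derive1E (derive_slice (consl_affine y)) consl_delta -iE.
have h'0 z : M < `|z| -> derive1 h z = 0.
  by move=> Mz; rewrite -hE; apply: (@vanish_derive n.+1 M f _ f0 _ ord0); rewrite rV_cons0.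
pose N : R := `|M| + 1; have MN : M < N by rewrite /N ltr_pwDr// ler_norm.
have N0 : 0 <= N by rewrite addr_ge0.
have -> : fubini_G leb (EFin \o (fun p => g (rV_cons p))) y =
    (\int[leb]_(z in `[(- N)%R, N]) (derive1 h z)%:E)%E.
  rewrite [RHS]integral_mkcond; apply: eq_integral => z _; rewrite patchE /= hE.
  case: ifPn => //; rewrite notin_setE/= in_itv/= -ler_norml => /negP.
  by rewrite -ltNge => Nz; rewrite h'0// (lt_trans MN).
have ih' : leb.-integrable `[- N, N] (EFin \o derive1 h).
  apply/bmf_itv_integrable/bmf_continuous/continuous_subspaceT.
  exact/smooth_continuous/smooth_derive1.
rewrite -(fineK (integrable_fin_num _ ih'))// -/(Rintegral _ _ _).
rewrite Rintegral_derive//; last by rewrite ge0_cp.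
by rewrite !h0 ?normrN ?ger0_norm// subrr.
Qed.

Lemma test_partial n (U : set 'rV[R]_n) phi i :
  test_function U phi -> test_function U (partial i phi).
Proof.
move=> [sf [K [cK KU f0]]]; split; first exact: smooth_derive.
exists K; split => // x Kx.
rewrite /partial (@near_eq_derive _ _ _ _ (cst 0)) ?derive_cst//.
have oK : open (~` K) by apply: closed_openC; exact: compact_closed.
by apply: filterS (open_nbhs_nbhs (conj oK Kx)) => y; exact: f0.
Qed.

(** The divergence theorem for functions with compact support in [U]. *)
Lemma Rintegral_partial_eq0 n (U : set 'rV[R]_n) f i : test_function U f ->
  \int[lebesgue_rV R n]_(x in U) partial i f x = 0.
Proof.
move=> tf; have [_ [K' [_ K'U p0]]] := test_partial i tf.
move: tf => [sf [K [cK KU f0]]]; have [M [Mr MP]] := compact_bounded cK.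
have f0M (x : 'rV[R]_n) j : M + 1 < `|x ord0 j| -> f x = 0.
  move=> xj; apply: f0 => Kx; move: xj; apply/negP; rewrite -leNgt.
  by apply: le_trans (coord_le_norm x j) (MP (M + 1) _ x Kx); rewrite ltrDl.
rewrite -(@Rintegral_subset _ _ _ _ setT)//; last by move=> x _ Ux; apply: p0 => /K'U.
by rewrite /Rintegral (integral_derive_eq0 i sf f0M).
Qed.

End rV.

(** * Convergence in mean square *)

Section real_limits.
Context (R : realType).
Implicit Types (a b : nat -> R).

Lemma cvgZ0 c a : a @ \oo --> (0 : R) -> c * a n @[n --> \oo] --> (0 : R).
Proof. by move=> a0; rewrite -(mulr0 c); apply: cvgM => //; exact: cvg_cst. Qed.

Lemma cvgD0 a b : a @ \oo --> (0 : R) -> b @ \oo --> (0 : R) ->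
  a n + b n @[n --> \oo] --> (0 : R).
Proof. by move=> a0 b0; rewrite -(addr0 (0 : R)); apply: cvgD. Qed.

End real_limits.

Section L2.
Context d (T : measurableType d) (R : realType) (mu : {measure set T -> \bar R}).
Variable D : set T.
Hypotheses (mD : measurable D) (muD : (mu D < +oo)%E).
Implicit Types (f g h : T -> R) (fn gn : nat -> T -> R).
Local Notation bmf := (@bmf _ T R D).

Definition L2 f := measurable_fun D f /\ mu.-integrable D (EFin \o (fun x => f x ^+ 2)).
Definition sqnorm f := \int[mu]_(x in D) (f x ^+ 2).

Lemma sqnorm_ge0 f : 0 <= sqnorm f.
Proof. by apply: Rintegral_ge0 => x _; exact: sqr_ge0. Qed.

Lemma sqr_le_norm (x y : R) : `|x| <= `|y| -> x ^+ 2 <= y ^+ 2.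
Proof. by move=> xy; rewrite -(real_normK (num_real x)) -(real_normK (num_real y)) lerXn2r// nnegrE. Qed.

Lemma bmf_L2 f : bmf f -> L2 f.
Proof.
move=> bf; split; first by have [] := bf.
by apply: bmf_integrable => //; under eq_fun do rewrite expr2; exact: bmfM.
Qed.

Lemma L2M f h : bmf h -> L2 f -> L2 (fun x => h x * f x).
Proof.
move=> [mh [K hK]] [mf if_]; split; first exact: measurable_funM.
have : mu.-integrable D (EFin \o (fun x => f x ^+ 2 * h x ^+ 2)).
  apply: integrableM_bmf => //.
  have -> : (fun x => h x ^+ 2) = (fun x => h x * h x) by apply/funext => x; rewrite expr2.
  by apply: bmfM; split => //; exists K.
congr (_.-integrable _ _); apply/funext => x /=; by rewrite exprMn mulrC.
Qed.

Lemma L2D f g : L2 f -> L2 g -> L2 (fun x => f x + g x).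
Proof.
move=> [mf if_] [mg ig]; split; first exact: measurable_funD.
have H : mu.-integrable D (fun x => ((f x ^+ 2)%:E + (g x ^+ 2)%:E)%E) by exact: integrableD.
have H2 : mu.-integrable D (fun x => (2%:E * ((f x ^+ 2)%:E + (g x ^+ 2)%:E))%E).
  exact: integrableZl.
apply: (@le_integrable _ _ _ mu D mD _ _ _ _ H2).
  by apply/measurable_EFinP; apply: measurable_funX; exact: measurable_funD.
move=> x Dx.
have : `|(f x + g x) ^+ 2| <= `|2 * (f x ^+ 2 + g x ^+ 2)|.
  rewrite !ger0_norm ?sqr_ge0//; first by have := sqr_ge0 (f x - g x); nra.
  by rewrite mulr_ge0// addr_ge0 ?sqr_ge0.
by rewrite -lee_fin.
Qed.

Lemma L2B f g : L2 f -> L2 g -> L2 (fun x => f x - g x).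
Proof.
move=> lf lg; have := L2D lf (L2M (bmf_cst D (-1)) lg).
by under eq_fun do rewrite mulN1r.
Qed.

Lemma L2_mul_integrable f g : L2 f -> L2 g ->
  mu.-integrable D (EFin \o (fun x => f x * g x)).
Proof.
move=> [mf if_] [mg ig].
have H : mu.-integrable D (fun x => ((f x ^+ 2)%:E + (g x ^+ 2)%:E)%E) by exact: integrableD.
apply: (@le_integrable _ _ _ mu D mD _ _ _ _ H).
  by apply/measurable_EFinP; exact: measurable_funM.
move=> x Dx; rewrite /= lee_fin [leRHS]ger0_norm ?addr_ge0 ?sqr_ge0//.
rewrite ler_norml; have := sqr_ge0 (f x - g x); have := sqr_ge0 (f x + g x).
by move=> *; apply/andP; split; nra.
Qed.

Lemma sqnorm_le f g : L2 f -> L2 g -> (forall x, D x -> `|f x| <= `|g x|) ->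
  sqnorm f <= sqnorm g.
Proof.
move=> [mf if_] [mg ig] fg; apply: le_Rintegral => // x Dx.
by rewrite sqr_le_norm// fg.
Qed.

Lemma sqnormZ (c : R) f : L2 f -> sqnorm (fun x => c * f x) = c ^+ 2 * sqnorm f.
Proof.
move=> [mf if_]; rewrite /sqnorm -RintegralZl//.
by apply: eq_Rintegral => x _; rewrite exprMn.
Qed.

Lemma sqnormD f g : L2 f -> L2 g ->
  sqnorm (fun x => f x + g x) <= 2 * sqnorm f + 2 * sqnorm g.
Proof.
move=> /[dup] lf [mf if_] /[dup] lg [mg ig]; rewrite -!RintegralZl//.
have i2 := fun h => @integrable_cmul _ _ _ mu D 2 (fun x => h x ^+ 2) mD.
rewrite -RintegralD//; [|exact: i2|exact: i2].
apply: le_Rintegral => //; first by have [] := L2D lf lg.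
  by apply: eq_integrable (integrableD mD (i2 _ if_) (i2 _ ig)).
by move=> x Dx; have := sqr_ge0 (f x - g x); nra.
Qed.

Definition cv2 fn f := [/\ forall n, L2 (fn n), L2 f &
  sqnorm (fun x => fn n x - f x) @[n --> \oo] --> (0 : R)].

Lemma cv2_squeeze fn f (e : nat -> R) : (forall n, L2 (fn n)) -> L2 f ->
  (forall n, sqnorm (fun x => fn n x - f x) <= e n) -> e @ \oo --> (0 : R) ->
  cv2 fn f.
Proof.
move=> lfn lf H e0; split => //.
apply/cvgrPdist_le => eps eps0; move/cvgrPdist_le : e0 => /(_ _ eps0).
apply: filterS => n en; rewrite sub0r normrN ger0_norm ?sqnorm_ge0//.
by apply: le_trans (H n) (le_trans (ler_norm _) _); rewrite -normrN -sub0r.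
Qed.

(** From 2 |a b| <= a^2 / c + c b^2, where [c] is small compared to the norm of
[g] and [n] is then large. *)
Lemma cv2_pairing fn f g : cv2 fn f -> L2 g ->
  \int[mu]_(x in D) (fn n x * g x) @[n --> \oo] --> \int[mu]_(x in D) (f x * g x).
Proof.
move=> [lfn lf fnf] lg; apply/cvgrPdist_le => e e0.
pose c := e / (sqnorm g + 1).
have g1 : 0 < sqnorm g + 1 by rewrite ltr_wpDl// sqnorm_ge0.
have c0 : 0 < c by rewrite divr_gt0.
have ce : c * sqnorm g <= e.
  by rewrite /c mulrAC ler_pdivrMr// ler_wpM2l ?(ltW e0)// lerDl.
have ce0 : 0 < c * e by rewrite mulr_gt0.
move/cvgrPdist_le : fnf => /(_ _ ce0); apply: filterS => n.
rewrite sub0r normrN ger0_norm ?sqnorm_ge0// => fne.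
have lB : L2 (fun x => fn n x - f x) by exact: L2B.
rewrite distrC -RintegralB//; try exact: L2_mul_integrable.
have ib : mu.-integrable D (EFin \o (fun x => (fn n x - f x) * g x)).
  exact: L2_mul_integrable.
rewrite (_ : \int[mu]_(x in D) _ = \int[mu]_(x in D) ((fn n x - f x) * g x)); last first.
  by apply: eq_Rintegral => x _; rewrite mulrBl.
apply: (le_trans (le_normr_Rintegral mD ib)).
have [mB iB] := lB; have [mg ig] := lg.
have i1 : mu.-integrable D (EFin \o (fun x => (2 * c)^-1 * (fn n x - f x) ^+ 2)).
  exact: integrable_cmul.
have i2 : mu.-integrable D (EFin \o (fun x => (c / 2) * g x ^+ 2)).
  exact: integrable_cmul.
apply: (@le_trans _ _ ((2 * c)^-1 * sqnorm (fun x => fn n x - f x) + (c / 2) * sqnorm g)).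
  rewrite -!RintegralZl// -RintegralD//.
  apply: le_Rintegral => //; first exact: integrable_norm.
    by apply: eq_integrable (integrableD mD i1 i2).
  move=> x Dx; set y := fn n x - f x.
  have -> : (2 * c)^-1 * y ^+ 2 + c / 2 * g x ^+ 2 =
      (2 * c)^-1 * (y ^+ 2 + (c * g x) ^+ 2) by field; rewrite gt_eqF.
  have c2 : 0 < 2 * c by exact: mulr_gt0.
  rewrite normrM ler_pdivlMl//.
  have -> : 2 * c * (`|y| * `|g x|) = 2 * (`|y| * `|c * g x|).
    by rewrite normrM (gtr0_norm c0); ring.
  rewrite -(real_normK (num_real y)) -(real_normK (num_real (c * g x))).
  have := sqr_ge0 (`|y| - `|c * g x|); nra.
have -> : e = (2 * c)^-1 * (c * e) + 2^-1 * e by field; rewrite gt_eqF.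
apply: lerD; first by rewrite ler_wpM2l// invr_ge0 mulr_ge0// ltW.
by rewrite mulrAC mulrC ler_wpM2l.
Qed.

Lemma cv2D fn gn f g : cv2 fn f -> cv2 gn g ->
  cv2 (fun n x => fn n x + gn n x) (fun x => f x + g x).
Proof.
move=> [lfn lf fnf] [lgn lg gng].
apply: (@cv2_squeeze _ _ (fun n => 2 * sqnorm (fun x => fn n x - f x) +
  2 * sqnorm (fun x => gn n x - g x))).
- by move=> n; exact: L2D.
- exact: L2D.
- move=> n; have := sqnormD (L2B (lfn n) lf) (L2B (lgn n) lg).
  by under [X in X <= _ -> _]eq_Rintegral do rewrite addrACA -opprD.
- by apply: cvgD0; exact: cvgZ0.
Qed.

Lemma cv2M fn f h : bmf h -> cv2 fn f -> cv2 (fun n x => h x * fn n x) (fun x => h x * f x).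
Proof.
move=> /[dup] bh [mh [K hK]] [lfn lf fnf].
apply: (@cv2_squeeze _ _ (fun n => K ^+ 2 * sqnorm (fun x => fn n x - f x))).
- by move=> n; exact: L2M.
- exact: L2M.
- move=> n; have lB := L2B (lfn n) lf.
  rewrite -sqnormZ//; apply: sqnorm_le.
  + by apply: L2B; exact: L2M.
  + exact: L2M (bmf_cst D K) lB.
  + by move=> x Dx; rewrite -mulrBr !normrM ler_wpM2r// (le_trans (hK x Dx))// ler_norm.
- exact: cvgZ0.
Qed.

Let clip (n : nat) (y : R) := Num.max (- n%:R) (Num.min n%:R y).

Let clip_le n y : `|clip n y| <= n%:R.
Proof.
rewrite /clip ler_norml le_max lexx/= ge_max ge_min lexx/= andbT.
by rewrite lerNl oppr0 ler0n || rewrite (le_trans _ (ler0n _ n))// oppr_le0.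
Qed.

Let clip_id n y : `|y| <= n%:R -> clip n y = y.
Proof. by rewrite ler_norml => /andP[ny yn]; rewrite /clip min_r// max_r. Qed.

Let clip_dist n y : `|y - clip n y| <= `|y|.
Proof.
have n0 : 0 <= n%:R :> R by [].
have [|] := leP `|y| n%:R; first by move=> H; rewrite clip_id// subrr normr0.
rewrite /clip; have [y0|y0] := leP 0 y.
  rewrite (ger0_norm y0) => ny; rewrite min_l ?(ltW ny)// max_r; last first.
    by rewrite (le_trans _ n0)// oppr_le0.
  by rewrite ger0_norm ?subr_ge0 ?(ltW ny)// lerBlDr lerDl.
rewrite (ltr0_norm y0) ltrNr => ny; rewrite min_r ?max_l//; last 2 first.
- exact: ltW.
- exact: le_trans (ltW y0) n0.
by rewrite opprK ler0_norm ?lerN2 ?lerDl//; rewrite -lerBrDr sub0r ltW.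
Qed.

Let measurable_clip n g : measurable_fun D g -> measurable_fun D (fun x => clip n (g x)).
Proof.
move=> mg; apply: measurable_maxr; first exact: measurable_cst.
by apply: measurable_minr => //; exact: measurable_cst.
Qed.

Let clip_cvg g : L2 g -> sqnorm (fun x => g x - clip n (g x)) @[n --> \oo] --> (0 : R).
Proof.
move=> [mg ig].
have [] := @dominated_convergence _ _ _ mu D mD
  (fun n x => ((g x - clip n (g x)) ^+ 2)%:E) (cst 0%E) (fun x => (g x ^+ 2)%:E).
- move=> n; apply/measurable_EFinP; apply: measurable_funX.
  by apply: measurable_funB => //; exact: measurable_clip.
- exact: measurable_cst.
- apply: aeW => x Dx; apply: cvg_near_cst.
  exists (Num.truncn `|g x|).+1 => // n /= gn.
  rewrite clip_id ?subrr ?expr0n//.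
  have /truncn_itv/andP[_ H] : 0 <= `|g x| by [].
  by rewrite (le_trans (ltW H))// ler_nat.
- exact: ig.
- by apply: aeW => x n Dx; rewrite /= lee_fin ger0_norm ?sqr_ge0// sqr_le_norm.
move=> _ _; rewrite integral0.
by move=> /fine_cvgP[].
Qed.

Let measurable_comp_cont (H : R -> R) f : continuous H -> measurable_fun D f ->
  measurable_fun D (fun x => H (f x)).
Proof. by move=> cH mf; apply: measurableT_comp => //; exact: continuous_measurable_fun. Qed.

Lemma cv2_lipschitz (H : R -> R) K fn f : continuous H ->
  (forall x, `|H x| <= K) -> (forall x y, `|H x - H y| <= K * `|x - y|) ->
  cv2 fn f -> cv2 (fun n x => H (fn n x)) (fun x => H (f x)).
Proof.
move=> cH HK HL [lfn lf fnf].
have bH h : measurable_fun D h -> bmf (fun x => H (h x)).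
  by move=> mh; split; [exact: measurable_comp_cont|exists K => x _; exact: HK].
apply: (@cv2_squeeze _ _ (fun n => K ^+ 2 * sqnorm (fun x => fn n x - f x))).
- by move=> n; apply/bmf_L2/bH; have [] := lfn n.
- by apply/bmf_L2/bH; have [] := lf.
- move=> n; have lB := L2B (lfn n) lf.
  rewrite -sqnormZ//; apply: sqnorm_le.
  + by apply: L2B; apply/bmf_L2/bH; [have [] := lfn n|have [] := lf].
  + exact: L2M (bmf_cst D K) lB.
  + by move=> x Dx; rewrite normrM (le_trans (HL _ _))// ler_wpM2r// ler_norm.
- exact: cvgZ0.
Qed.

(** Truncating [g] reduces the convergence of [H (fn n) * g] to that of [fn]. *)
Lemma cv2_lipschitzM (H : R -> R) K fn gn f g : continuous H ->
  (forall x, `|H x| <= K) -> (forall x y, `|H x - H y| <= K * `|x - y|) ->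
  cv2 fn f -> cv2 gn g -> cv2 (fun n x => H (fn n x) * gn n x) (fun x => H (f x) * g x).
Proof.
move=> cH HK HL [lfn lf fnf] [lgn lg gng].
have K0 : 0 <= K by apply: le_trans (HK 0).
have bH h : measurable_fun D h -> bmf (fun x => H (h x)).
  by move=> mh; split; [exact: measurable_comp_cont|exists K => x _; exact: HK].
have bHn n : bmf (fun x => H (fn n x)) by apply: bH; have [] := lfn n.
have bHf : bmf (fun x => H (f x)) by apply: bH; have [] := lf.
split; [by move=> n; exact: L2M|exact: L2M|].
have [mg _] := lg.
pose e n x := H (fn n x) - H (f x).
have be n : bmf (e n) by exact: bmfB.
pose gc N x := clip N (g x).
have lgc N : L2 (gc N).
  by apply: bmf_L2; split; [exact: measurable_clip|exists N%:R => x _; exact: clip_le].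
have lgr N : L2 (fun x => g x - gc N x) by exact: L2B.
have le1 n : L2 (fun x => H (fn n x) * (gn n x - g x)).
  by apply: L2M => //; exact: L2B.
have bound n N : sqnorm (fun x => H (fn n x) * gn n x - H (f x) * g x) <=
    2 * (K ^+ 2 * sqnorm (fun x => gn n x - g x)) +
    2 * (2 * ((N%:R * K) ^+ 2 * sqnorm (fun x => fn n x - f x)) +
         2 * ((2 * K) ^+ 2 * sqnorm (fun x => g x - gc N x))).
  have l2 : L2 (fun x => e n x * g x) by exact: L2M.
  have -> : (fun x => H (fn n x) * gn n x - H (f x) * g x) =
      (fun x => H (fn n x) * (gn n x - g x) + e n x * g x).
    by apply/funext => x; rewrite /e; ring.
  apply: (le_trans (sqnormD (le1 n) l2)); apply: lerD; rewrite ler_wpM2l//.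
    rewrite -sqnormZ; last exact: L2B.
    apply: sqnorm_le => //; first by apply: L2M (bmf_cst D K) _; exact: L2B.
    by move=> x Dx; rewrite !normrM ler_wpM2r// (ger0_norm K0).
  have -> : (fun x => e n x * g x) = (fun x => e n x * gc N x + e n x * (g x - gc N x)).
    by apply/funext => x; ring.
  apply: (le_trans (sqnormD (L2M (be n) (lgc N)) (L2M (be n) (lgr N)))).
  apply: lerD; rewrite ler_wpM2l//.
    rewrite -sqnormZ; last exact: L2B.
    apply: sqnorm_le; [exact: L2M|by apply: L2M (bmf_cst D _) _; exact: L2B|].
    move=> x Dx; rewrite !normrM (ger0_norm K0) normr_nat mulrC -mulrA.
    by rewrite ler_pM// ?clip_le// HL.
  rewrite -sqnormZ//; apply: sqnorm_le; [exact: L2M|exact: L2M (bmf_cst D _) _|].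
  move=> x Dx; rewrite !normrM ler_wpM2r// (ger0_norm K0) normr_nat mulr_natl mulr2n.
  by rewrite (le_trans (ler_normB _ _))// lerD.
apply/cvgrPdist_le => eps eps0.
have [N NP] : exists N, 2 * (2 * ((2 * K) ^+ 2 * sqnorm (fun x => g x - gc N x))) <= eps / 2.
  have : 2 * (2 * ((2 * K) ^+ 2 * sqnorm (fun x => g x - gc N x))) @[N --> \oo] --> (0 : R).
    by do 3 apply: cvgZ0; exact: clip_cvg.
  move=> /cvgrPdist_le/(_ _ (divr_gt0 eps0 (ltr0n R 2))) [N _ /(_ N (leqnn N))].
  by rewrite sub0r normrN => NP; exists N; apply: le_trans NP; exact: ler_norm.
have : 2 * (K ^+ 2 * sqnorm (fun x => gn n x - g x)) +
    2 * (2 * ((N%:R * K) ^+ 2 * sqnorm (fun x => fn n x - f x))) @[n --> \oo] --> (0 : R).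
  by apply: cvgD0; repeat apply: cvgZ0.
move=> /cvgrPdist_le/(_ _ (divr_gt0 eps0 (ltr0n R 2))); apply: filterS => n.
rewrite !sub0r !normrN => Hn; rewrite ger0_norm ?sqnorm_ge0//.
apply: (le_trans (bound n N)); rewrite mulrDr addrA (splitr eps); apply: lerD => //.
exact: le_trans (ler_norm _) Hn.
Qed.

Lemma integral_sqr_restrict f : (\int[mu]_x (`|((f \_ D) x)%:E| `^ 2) =
  \int[mu]_(x in D) (f x ^+ 2)%:E)%E.
Proof.
rewrite [RHS]integral_mkcond; apply: eq_integral => x _.
rewrite !patchE; case: ifP => _.
  by rewrite /= powR_mulrn// real_normK// num_real.
by rewrite /= normr0 powR0// (pnatr_eq0 R 2).
Qed.

Lemma Lp_on2P f : Lp_on mu D 2%:E f <-> L2 f.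
Proof.
have fin : finite_norm mu 2%:E (f \_ D) <-> (\int[mu]_(x in D) (f x ^+ 2)%:E < +oo)%E.
  rewrite /finite_norm unlock /Lnorm -integral_sqr_restrict.
  split; first by apply: contraPP => /negP; rewrite -leNgt leye_eq => /eqP ->; rewrite poweRyr ?invr_eq0.
  by move=> H; rewrite poweR_lty.
split.
  move=> /andP[]; rewrite !inE/= => /(measurable_restrictT _ mD) mf /fin foo.
  split => //; apply/integrableP; split.
    by apply/measurable_EFinP; exact: measurable_funX.
  by under eq_integral do rewrite /= ger0_norm ?sqr_ge0//.
move=> [mf /integrableP[_ foo]]; apply/andP; split; rewrite inE/=.
  exact/(measurable_restrictT _ mD).
apply/fin; move: foo; by under eq_integral do rewrite /= ger0_norm ?sqr_ge0//.
Qed.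

Lemma Lnorm_on2E f : L2 f -> Lnorm_on mu D 2%:E f = ((sqnorm f) `^ 2^-1)%:E.
Proof.
move=> [mf if_]; rewrite /Lnorm_on unlock /Lnorm integral_sqr_restrict.
by rewrite -poweR_EFin /sqnorm /Rintegral fineK// integrable_fin_num.
Qed.

Lemma Lnorm_on2_cvg (fn : nat -> T -> R) : (forall n, L2 (fn n)) ->
  Lnorm_on mu D 2%:E (fn n) @[n --> \oo] --> 0%E <->
  sqnorm (fn n) @[n --> \oo] --> (0 : R).
Proof.
move=> lf; under eq_fun do rewrite Lnorm_on2E//.
have sqrtE (x : R) : 0 <= x -> (x `^ 2^-1) ^+ 2 = x.
  by move=> x0; rewrite -powR_mulrn ?powR_ge0// -powRrM mulVf// powRr1.
split => [H|/cvgrPdist_le H].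
  have {}H : sqnorm (fn n) `^ 2^-1 @[n --> \oo] --> (0 : R).
    by move/fine_cvgP : H => [].
  rewrite -(mulr0 (0 : R)); under eq_fun do rewrite -(sqrtE _ (sqnorm_ge0 _)) expr2.
  exact: cvgM.
apply: cvge0P => [n|eps eps0]; first by rewrite lee_fin powR_ge0.
have e2 : 0 < eps ^+ 2 by rewrite exprn_gt0.
apply: filterS (H _ e2) => n; rewrite sub0r normrN ger0_norm ?sqnorm_ge0// => Hn.
rewrite lee_fin -(@ler_pXn2r _ 2)// ?nnegrE ?powR_ge0 ?(ltW eps0)//.
by rewrite sqrtE ?sqnorm_ge0.
Qed.

End L2.

(** * The chain rule *)

Section domain.
Context (R : realType) (d : nat) (Omega : set 'rV[R]_d).

Lemma bounded_lebesgue_lty : measurable Omega -> bounded_set Omega ->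
  (lebesgue_rV R d Omega < +oo)%E.
Proof.
move=> mO [M [Mr MP]]; apply: le_lt_trans (@lebesgue_cube_lty R d (M + 1)).
apply: le_measure; rewrite ?inE//; first exact: measurable_cube.
move=> x Ox i; rewrite /= in_itv/= -ler_norml.
by apply: le_trans (coord_le_norm x i) (MP (M + 1) _ x Ox); rewrite ltrDl.
Qed.

Lemma test_bmf phi : test_function Omega phi -> bmf Omega phi.
Proof.
move=> [sf [K [cK KU f0]]]; have cf := smooth_continuous sf.
split; first exact: continuous_measurable_rV.
have : compact (phi @` K) by apply: continuous_compact => //; exact: continuous_subspaceT.
move=> /compact_bounded[M [Mr MP]]; exists (`|M| + 1) => x _.
have [Kx|Kx] := pselect (K x); last by rewrite f0// normr0 addr_ge0.
by apply: MP; [rewrite ltr_pwDr// ler_norm|exists x].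
Qed.

Lemma partialM f g i x : smooth f -> smooth g ->
  partial i (fun y : 'rV[R]_d => f y * g y) x = f x * partial i g x + g x * partial i f x.
Proof.
move=> sf sg; have := @deriveM R _ f g x (delta_mx ord0 i).
by apply; exact: smooth_derivable.
Qed.

End domain.

Section chain_rule.
Context (R : realType) (d : nat) (Omega : set 'rV[R]_d).
Local Notation mu := (lebesgue_rV R d).
Hypotheses (mO : measurable Omega) (muO : (mu Omega < +oo)%E).
Local Notation E := ('rV[R]_d -> R).
Local Notation cv2 := (cv2 mu Omega).
Local Notation L2 := (L2 mu Omega).

Definition bounded_lipschitz (H : R -> R) := exists2 K,
  forall x, `|H x| <= K & forall x y, `|H x - H y| <= K * `|x - y|.

Variables (F F1 F2 : R -> R).
Hypotheses (sF : smooth F) (sF1 : smooth F1) (sF2 : smooth F2)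
  (F'E : derive1 F = F1) (F1'E : derive1 F1 = F2)
  (bF : bounded_lipschitz F) (bF1 : bounded_lipschitz F1) (bF2 : bounded_lipschitz F2)
  (F0 : forall x, x <= 0 -> [/\ F x = 0, F1 x = 0 & F2 x = 0]).

Let lip H fn f : bounded_lipschitz H -> smooth H -> cv2 fn f ->
  cv2 (fun n x => H (fn n x)) (fun x => H (f x)).
Proof.
move=> [K HK HL] sH; apply: cv2_lipschitz HK HL => //; exact: smooth_continuous.
Qed.

Let lipM H fn gn f g : bounded_lipschitz H -> smooth H -> cv2 fn f -> cv2 gn g ->
  cv2 (fun n x => H (fn n x) * gn n x) (fun x => H (f x) * g x).
Proof.
move=> [K HK HL] sH; apply: cv2_lipschitzM HK HL => //; exact: smooth_continuous.
Qed.

Let F00 : F 0 = 0. Proof. by have [] := F0 (lexx 0). Qed.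
Let F10 : F1 0 = 0. Proof. by have [] := F0 (lexx 0). Qed.

Section limit.
Variables (w : E) (Gp : 'I_d -> E) (phi : nat -> E).
Hypotheses (tphi : forall n, test_function Omega (phi n)) (cphi : cv2 phi w)
  (cdphi : forall i, cv2 (fun n => partial i (phi n)) (Gp i)).

Let sphi n : smooth (phi n). Proof. by have [] := tphi n. Qed.

Let L2_test psi : test_function Omega psi -> L2 psi.
Proof. by move=> /test_bmf; exact: bmf_L2. Qed.

Lemma partial_comp H i n x : smooth H ->
  partial i (fun y => H (phi n y)) x = derive1 H (phi n x) * partial i (phi n) x.
Proof. by move=> sH; rewrite /partial derive_comp_smooth. Qed.

(** [F(phi n)] and its gradient converge, and the weak formulation passes to
the limit. *)
Lemma weak_chain_rule psi i : test_function Omega psi ->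
  \int[mu]_(x in Omega) (F (w x) * partial i psi x) =
  - \int[mu]_(x in Omega) (F1 (w x) * Gp i x * psi x).
Proof.
move=> tpsi; have [spsi _] := tpsi.
have c1 := cv2_pairing mO (lip bF sF cphi) (L2_test (test_partial i tpsi)).
have c2 := cv2_pairing mO (lipM bF1 sF1 cphi (cdphi i)) (L2_test tpsi).
apply/eqP; rewrite -subr_eq0 opprK; apply/eqP.
suff E n : \int[mu]_(x in Omega) (F (phi n x) * partial i psi x) +
    \int[mu]_(x in Omega) (F1 (phi n x) * partial i (phi n) x * psi x) = 0.
  have : (fun n => \int[mu]_(x in Omega) (F (phi n x) * partial i psi x) +
      \int[mu]_(x in Omega) (F1 (phi n x) * partial i (phi n) x * psi x)) @ \oo -->
    \int[mu]_(x in Omega) (F (w x) * partial i psi x) +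
    \int[mu]_(x in Omega) (F1 (w x) * Gp i x * psi x) by exact: cvgD.
  by under eq_fun do rewrite E; move=> /cvg_lim <-//; rewrite lim_cst.
have sFn : smooth (fun x => F (phi n x)) by exact: smooth_comp.
have /= := Rintegral_partial_eq0 i (test_functionM tpsi sFn).
have [lF _ _] := lip bF sF cphi.
have [lF1 _ _] := lipM bF1 sF1 cphi (cdphi i).
rewrite -RintegralD//; last 2 first.
- by apply: L2_mul_integrable => //; exact/L2_test/test_partial.
- by apply: L2_mul_integrable => //; exact: L2_test.
move=> <-; apply: eq_Rintegral => x _.
by rewrite partialM// partial_comp// F'E; ring.
Qed.

(** The weak formulation for [u], tested with F1(phi n) psi, in the limit. *)
Lemma limit_test u G psi i : L2 u -> is_weak_gradient Omega u G ->
  test_function Omega psi ->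
  \int[mu]_(x in Omega) ((F1 (w x) * partial i psi x + psi x * (F2 (w x) * Gp i x)) * u x) =
  - \int[mu]_(x in Omega) (psi x * F1 (w x) * G i x).
Proof.
move=> lu [lG wG] tpsi; have [spsi _] := tpsi.
have lGi : L2 (G i) by apply/Lp_on2P => //; exact: lG.
have cF1 := lip bF1 sF1 cphi.
have c1 := cv2M mO (test_bmf (test_partial i tpsi)) cF1.
have c2 := cv2M mO (test_bmf tpsi) (lipM bF2 sF2 cphi (cdphi i)).
have c3 := cv2_pairing mO (cv2D mO c1 c2) lu.
have c4 := cv2_pairing mO (cv2M mO (test_bmf tpsi) cF1) lGi.
have sF1n n : smooth (fun x => F1 (phi n x)) by exact: smooth_comp.
have tn n := test_functionM tpsi (sF1n n).
have E n : \int[mu]_(x in Omega) ((partial i psi x * F1 (phi n x) +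
      psi x * (F2 (phi n x) * partial i (phi n) x)) * u x) =
    - \int[mu]_(x in Omega) (psi x * F1 (phi n x) * G i x).
  have := wG i _ (tn n).
  rewrite (_ : \int[mu]_(x in Omega) _ = \int[mu]_(x in Omega)
    ((partial i psi x * F1 (phi n x) +
      psi x * (F2 (phi n x) * partial i (phi n) x)) * u x)); last first.
    by apply: eq_Rintegral => x _; rewrite partialM// partial_comp// F1'E; ring.
  by move=> ->; congr (- _); apply: eq_Rintegral => x _; ring.
have c5 : (- \int[mu]_(x in Omega) (psi x * F1 (phi n x) * G i x)) @[n --> \oo] -->
    - \int[mu]_(x in Omega) (psi x * F1 (w x) * G i x) by exact: cvgN.
move: c5; under eq_fun do rewrite -E.
move=> /cvg_lim <-//; move: c3 => /cvg_lim ->//.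
by apply: eq_Rintegral => x _; ring.
Qed.

End limit.

(** As F vanishes on the nonpositive reals, F(u) = F(w), where w is the positive part
of u, and [weak_chain_rule] gives the gradient F1(w) times that of w. Here the
gradient of w may be replaced by that of u: by [limit_test] the integrals of
both against F1(w) psi are determined by the values of w and u where w > 0,
and these agree. *)
Lemma chain_rule u G : Lp_on mu Omega 2%:E u -> is_weak_gradient Omega u G ->
  le0_on_boundary Omega u ->
  H10 Omega (fun x => F (u x)) /\
  is_weak_gradient Omega (fun x => F (u x)) (fun i x => F1 (u x) * G i x).
Proof.
move=> /(Lp_on2P _ mO) lu /[dup] wuG [lG wG] [/(Lp_on2P _ mO)]; set w := fun x => Num.max 0 (u x).
move=> lw [Gp [/[dup] wwGp [lGp wGp] [phi [tphi cphi cdphi]]]].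
have lphi n : L2 (phi n) by exact/bmf_L2/test_bmf.
have ldphi n i : L2 (partial i (phi n)) by exact/bmf_L2/test_bmf/test_partial.
have lGp2 i : L2 (Gp i) by apply/Lp_on2P => //; exact: lGp.
have swap (f g : E) : sqnorm mu Omega (fun x => f x - g x) = sqnorm mu Omega (g \- f).
  by apply: eq_Rintegral => x _ /=; rewrite -sqrrN opprB.
have Cphi : cv2 phi w.
  split => //; under eq_fun do rewrite swap.
  by apply/Lnorm_on2_cvg => // n; exact: L2B.
have Cdphi i : cv2 (fun n => partial i (phi n)) (Gp i).
  split => //; under eq_fun do rewrite swap.
  by apply/Lnorm_on2_cvg => // n; exact: L2B.
have uw x : u x = w x \/ (u x <= 0 /\ w x = 0).
  by rewrite /w; case: (leP 0 (u x)) => H; [left|right; rewrite ltW].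
have FE x : F (u x) = F (w x).
  by case: (uw x) => [->//|[u0 ->]]; rewrite F00; have [] := F0 u0.
have F1E x : F1 (u x) = F1 (w x).
  by case: (uw x) => [->//|[u0 ->]]; rewrite F10; have [] := F0 u0.
rewrite (_ : (fun x => F (u x)) = fun x => F (w x)); last exact/funext.
have [lFn lF cF] := lip bF sF Cphi.
have lF1 i : L2 (fun x => F1 (w x) * Gp i x) by have [] := lipM bF1 sF1 Cphi (Cdphi i).
have bF1w : bmf Omega (fun x => F1 (w x)).
  have [_ [mF _] _] := lip bF1 sF1 Cphi; split => //.
  by have [K HK _] := bF1; exists K.
split.
  split; first exact/Lp_on2P.
  exists (fun i x => F1 (w x) * Gp i x); split.
    by split=> [i|i psi tpsi]; [exact/Lp_on2P|exact: weak_chain_rule Cphi Cdphi _ _ tpsi].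
  exists (fun n x => F (phi n x)); split.
  - by move=> n; exact: test_function_comp.
  - apply/Lnorm_on2_cvg => //; first by move=> n; exact: L2B.
    by under eq_fun do rewrite -swap.
  - move=> i; have [lP _ cP] := lipM bF1 sF1 Cphi (Cdphi i).
    have dE n : partial i (fun x => F (phi n x)) = fun x => F1 (phi n x) * partial i (phi n) x.
      apply/funext => x; rewrite /partial derive_comp_smooth// ?F'E//.
      by have [] := tphi n.
    under eq_fun do rewrite dE.
    apply/Lnorm_on2_cvg => //; first by move=> n; exact: L2B.
    by under eq_fun do rewrite -swap.
have lGi i : L2 (G i) by apply/Lp_on2P => //; exact: lG.
split=> [i|i psi tpsi].
  apply/Lp_on2P => //; rewrite (_ : (fun x => _) = fun x => F1 (w x) * G i x).
    exact: L2M.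
  by apply/funext => x; rewrite F1E.
rewrite (weak_chain_rule tphi Cphi Cdphi i tpsi); congr (- _).
have Eu := limit_test tphi Cphi Cdphi i lu wuG tpsi.
have Ew := limit_test tphi Cphi Cdphi i lw wwGp tpsi.
transitivity (\int[mu]_(x in Omega) (psi x * F1 (w x) * Gp i x)).
  by apply: eq_Rintegral => x _; ring.
transitivity (\int[mu]_(x in Omega) (psi x * F1 (w x) * G i x)); last first.
  by apply: eq_Rintegral => x _; rewrite F1E; ring.
apply: oppr_inj; rewrite -Eu -Ew; apply: eq_Rintegral => x _.
case: (uw x) => [->//|[u0 w0]]; rewrite w0 mulr0.
by have [_ -> ->] := F0 (lexx 0); ring.
Qed.

End chain_rule.

(** * Diffusion and convection *)

Lemma continuous_sum_ord (R : realType) (V : topologicalType) n (f : 'I_n -> V -> R) :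
  (forall i, continuous (f i)) -> continuous (fun x => \sum_(i < n) f i x).
Proof.
move=> cf; elim: n f cf => [|n IH] f cf.
  by rewrite (_ : (fun x => _) = cst 0) => [x|]; [exact: cvg_cst|
    apply/funext => x; rewrite big_ord0].
rewrite (_ : (fun x => _) = fun x => f ord0 x + \sum_(i < n) f (lift ord0 i) x).
  by move=> x; apply: cvgD; [exact: cf|exact: (IH (fun i => f (lift ord0 i)))].
by apply/funext => x; rewrite big_ord_recl.
Qed.

Section Rayleigh.
Context (R : realType) (d : nat) (A : 'M[R]_d).
Hypotheses (d0 : (0 < d)%N) (spd : sym_pos_def A).
Implicit Types x y v : 'rV[R]_d.

Let B x y : R := (x *m A *m y^T) ord0 ord0.

Let BDl x y z : B (x + y) z = B x z + B y z.
Proof. by rewrite /B !mulmxDl mxE. Qed.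

Let BDr x y z : B x (y + z) = B x y + B x z.
Proof. by rewrite /B raddfD/= mulmxDr mxE. Qed.

Let BZl c x y : B (c *: x) y = c * B x y.
Proof. by rewrite /B -!scalemxAl mxE. Qed.

Let BZr c x y : B x (c *: y) = c * B x y.
Proof. by rewrite /B linearZ/= -scalemxAr mxE. Qed.

Let BC x y : B x y = B y x.
Proof.
have E : (x *m A *m y^T)^T = y *m A *m x^T by rewrite !trmx_mul trmxK spd.1 mulmxA.
by have /matrixP/(_ ord0 ord0) := E; rewrite [LHS]mxE.
Qed.

Lemma dotvE x y : dotv x y = (x *m y^T) ord0 ord0.
Proof. by rewrite mxE; apply: eq_bigr => i _; rewrite mxE. Qed.

Lemma dotv_ge0 x : 0 <= dotv x x.
Proof. by apply: sumr_ge0 => i _; rewrite -expr2 sqr_ge0. Qed.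

Lemma dotv_eq0 x : (dotv x x == 0) = (x == 0).
Proof.
rewrite psumr_eq0; last by move=> i _; rewrite -expr2 sqr_ge0.
apply/idP/eqP => [/allP H|->].
  apply/rowP => i; rewrite mxE; apply/eqP; rewrite -sqrf_eq0 expr2.
  by have := H i (mem_index_enum _).
by apply/allP => i _; rewrite /= mxE mul0r.
Qed.

Let dDl x y z : dotv (x + y) z = dotv x z + dotv y z.
Proof. by rewrite !dotvE mulmxDl mxE. Qed.
Let dDr x y z : dotv x (y + z) = dotv x y + dotv x z.
Proof. by rewrite !dotvE raddfD/= mulmxDr mxE. Qed.
Let dZl c x y : dotv (c *: x) y = c * dotv x y.
Proof. by rewrite !dotvE -!scalemxAl mxE. Qed.
Let dZr c x y : dotv x (c *: y) = c * dotv x y.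
Proof. by rewrite !dotvE linearZ/= -scalemxAr mxE. Qed.
Let dC x y : dotv x y = dotv y x.
Proof. by apply: eq_bigr => i _; rewrite mulrC. Qed.

Let cdot : continuous (fun x => dotv x x).
Proof.
by apply: continuous_sum_ord => i x; apply: (@continuousM R); exact: coord_continuous.
Qed.

Let cB : continuous (fun x => B x x).
Proof.
have E x : B x x = \sum_(j < d) (\sum_(i < d) x ord0 i * A i j) * x ord0 j.
  by rewrite /B mxE; apply: eq_bigr => j _; rewrite !mxE.
under eq_fun do rewrite E; apply: continuous_sum_ord => j x.
apply: (@continuousM R); last exact: coord_continuous.
apply: (continuous_sum_ord (f := fun i (y : 'rV[R]_d) => y ord0 i * A i j)) => i y.
by apply: (@continuousM R); [exact: coord_continuous|exact: cst_continuous].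
Qed.

(** A minimizer of the quadratic form on the unit sphere is an eigenvector. *)
Lemma Rayleigh_min : exists m, [/\ 0 < m, eigenvalue A m &
  forall x, m * dotv x x <= (x *m A *m x^T) ord0 ord0].
Proof.
pose S : set 'rV[R]_d := [set x | dotv x x = 1].
have cS : compact S.
  apply: subclosed_compact (@compact_cube R d 1) _.
    by apply: (@closed_comp _ _ (fun x : 'rV[R]_d => dotv x x) [set 1]); [move=> x _; exact: cdot|exact: closed_eq].
  move=> x /= x1 i; rewrite /= in_itv/= -ler_norml.
  suff : `|x ord0 i| ^+ 2 <= 1 ^+ 2 by rewrite ler_pXn2r ?nnegrE.
  rewrite expr1n real_normK ?num_real// -x1 /dotv (bigD1 i)//= expr2 lerDl.
  by apply: sumr_ge0 => j _; rewrite -expr2 sqr_ge0.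
have S0 : S !=set0.
  exists (delta_mx ord0 (Ordinal d0)).
  rewrite /S /= /dotv (bigD1 (Ordinal d0))//= big1 ?addr0; first by rewrite mxE !eqxx mulr1.
  by move=> i; rewrite mxE eqxx/= => /negbTE ->; rewrite mul0r.
have [c /set_mem Sc cP] := EVT_min_rV S0 cS (continuous_subspaceT cB).
have c0 : c != 0 by rewrite -dotv_eq0 Sc oner_neq0.
have H x : B c c * dotv x x <= B x x.
  have [->|x0] := eqVneq x 0.
    by rewrite -(scale0r 0) BZl dZl !mul0r mulr0.
  have dx : 0 < dotv x x by rewrite lt_neqAle eq_sym dotv_eq0 x0 dotv_ge0.
  pose s := Num.sqrt (dotv x x).
  have s0 : 0 < s by rewrite sqrtr_gt0.
  have ss : s ^+ 2 = dotv x x by rewrite sqr_sqrtr// ltW.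
  have : B c c <= B (s^-1 *: x) (s^-1 *: x).
    apply: cP; rewrite inE /S/= dZl dZr -ss; field; rewrite gt_eqF//.
  rewrite BZl BZr -ss mulrA -expr2 exprVn => Hc.
  by rewrite -ler_pdivlMr ?exprn_gt0// mulrC.
exists (B c c); split => //; first exact: spd.2.
apply/eigenvalueP; exists c => //.
apply/eqP; rewrite -subr_eq0; apply/eqP; set v := c *m A - _.
suff : dotv v v = 0 by move/eqP; rewrite dotv_eq0 => /eqP.
have vE y : dotv v y = B c y - B c c * dotv c y.
  by rewrite dDl -scaleNr dZl mulNr dotvE.
(* The values of the form at c + s v, for small s, force the residual v to
   vanish. *)
clearbody v; pose q := B v v - B c c * dotv v v.
have q0 : 0 <= q by rewrite subr_ge0.
have key s : 0 <= 2 * s * dotv v v + s ^+ 2 * q.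
  have := H (c + s *: v); rewrite !BDl !BDr !BZl !BZr !dDl !dDr !dZl !dZr.
  have Sc1 : dotv c c = 1 := Sc.
  have Bcv : B c v = dotv v v + B c c * dotv c v by rewrite vE subrK.
  rewrite Sc1 (BC v c) (dC v c) Bcv -subr_ge0; congr (_ <= _).
  by rewrite /q; ring.
have vv0 := dotv_ge0 v.
apply/eqP; rewrite eq_le vv0 andbT leNgt; apply/negP => vv.
have := key (- dotv v v / (q + 1)).
have q1 : 0 < q + 1 by rewrite ltr_wpDl.
have -> : 2 * (- dotv v v / (q + 1)) * dotv v v + (- dotv v v / (q + 1)) ^+ 2 * q =
    (dotv v v / (q + 1)) ^+ 2 * (- (q + 2)) by field; rewrite gt_eqF.
rewrite leNgt => /negP; apply; rewrite nmulr_llt0 ?exprn_gt0 ?divr_gt0//.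
by rewrite oppr_lt0 ltr_wpDl.
Qed.

Lemma Rayleigh : 0 < min_eigenvalue A /\
  forall x, min_eigenvalue A * dotv x x <= (x *m A *m x^T) ord0 ord0.
Proof.
have [m [m0 em mP]] := Rayleigh_min.
suff -> : min_eigenvalue A = m by [].
have lbm : lbound [set l | eigenvalue A l] m.
  move=> l /= /eigenvalueP[v vA v0].
  have dv : 0 < dotv v v by rewrite lt_neqAle eq_sym dotv_eq0 v0 dotv_ge0.
  by have := mP v; rewrite vA -scalemxAl mxE -dotvE ler_pM2r.
apply/eqP; rewrite eq_le; apply/andP; split.
  by apply: ge_inf => //; exists m.
by apply: lb_le_inf => //; exists m.
Qed.

End Rayleigh.

Section energy.
Context (R : realType) (d : nat).

(** Completing the square: m |g|^2 + y^2 b.g >= - y^4 |b|^2 / (4 m), where m is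
the least eigenvalue. In the application, [g] is the gradient of u, y = u - k,
[p] is F'(u), and y^2 p = F(u). *)
Lemma energy_ge (A : 'M[R]_d) (b g : 'rV[R]_d) (C y p : R) : (0 < d)%N ->
  sym_pos_def A -> \sum_(i < d) (b ord0 i) ^+ 2 <= 4 * min_eigenvalue A * C -> 0 <= p ->
  - (C * y ^+ 2 * (y ^+ 2 * p)) <=
  \sum_(i < d) \sum_(j < d) A i j * g ord0 j * (p * g ord0 i) +
  \sum_(i < d) b ord0 i * g ord0 i * (y ^+ 2 * p).
Proof.
move=> d0 spd; have [m0 mP] := Rayleigh d0 spd; set m := min_eigenvalue A in m0 mP * => bC p0.
have -> : \sum_(i < d) \sum_(j < d) A i j * g ord0 j * (p * g ord0 i) =
    p * (g *m A *m g^T) ord0 ord0.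
  rewrite mxE exchange_big mulr_sumr; apply: eq_bigr => j _.
  rewrite !mxE mulr_suml mulr_sumr; apply: eq_bigr => i _; ring.
have -> : \sum_(i < d) b ord0 i * g ord0 i * (y ^+ 2 * p) =
    p * (y ^+ 2 * \sum_(i < d) b ord0 i * g ord0 i).
  by rewrite -mulr_suml; ring.
rewrite -mulrDr (_ : - _ = p * - (y ^+ 4 * C)); last by ring.
apply: ler_wpM2l => //.
apply: (@le_trans _ _ (m * dotv g g + y ^+ 2 * \sum_(i < d) b ord0 i * g ord0 i)); last first.
  by rewrite lerD2r.
apply: (@le_trans _ _ (- (y ^+ 4 * (\sum_(i < d) (b ord0 i) ^+ 2 / (4 * m))))).
  rewrite lerN2 ler_wpM2l//; first by rewrite -[4%N]/(2 * 2)%N exprM sqr_ge0.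
  by rewrite -mulr_suml ler_pdivrMr ?mulr_gt0// (mulrC C).
rewrite /dotv !mulr_sumr -sumrN -big_split/=; apply: ler_sum => i _.
set bi := b ord0 i; set gi := g ord0 i.
rewrite -subr_ge0 (_ : _ - _ = (2 * m * gi + y ^+ 2 * bi) ^+ 2 / (4 * m)).
  by rewrite divr_ge0 ?sqr_ge0// mulr_ge0// ltW.
by field; rewrite gt_eqF.
Qed.

End energy.

(** * The test function *)

Section cutoff.
Context (R : realType) (k : R).

Definition cutoff (p : {poly R}) (s : R) := flat p (s - k).

Lemma cutoff_le0 p s : s <= k -> cutoff p s = 0.
Proof. by move=> sk; rewrite /cutoff flat_le0// subr_le0. Qed.

Let shift_derive (s : R) : 'D_1 (fun x : R => x - k) s = 1.
Proof. by rewrite deriveB// derive_id derive_cst subr0. Qed.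

Let smooth_shift : smooth (fun x : R => x - k).
Proof.
have := smooth_affine 1 (- k).
by rewrite (_ : (fun x => _) = fun x => x - k)//; apply/funext => x; rewrite mul1r.
Qed.

Lemma smooth_cutoff p : smooth (cutoff p).
Proof. by apply: smooth_comp => //; exact: smooth_flat. Qed.

Lemma derive1_cutoff p : derive1 (cutoff p) = cutoff ('X^2 * (p - p^`())).
Proof.
apply/funext => s; rewrite derive1E /cutoff derive_comp_smooth//; last exact: smooth_flat.
rewrite shift_derive mulr1 derive1E.
by have [_ ->] := is_derive_flat p (s - k).
Qed.

Lemma cutoff_bounded_lipschitz p : bounded_lipschitz (cutoff p).
Proof.
have [C C0 CP] := flat_bounded p.
have [C' C'0 C'P] := flat_bounded ('X^2 * (p - p^`())).
have H x y : x <= y -> `|cutoff p y - cutoff p x| <= C' * (y - x).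
  move=> xy; have [c _ ->] : exists2 c, c \in `[x, y] &
      cutoff p y - cutoff p x = derive1 (cutoff p) c * (y - x).
    apply: MVT_segment => //; last first.
      by apply: continuous_subspaceT; exact: smooth_continuous (smooth_cutoff p).
    by move=> c _; exact/smooth_is_derive/smooth_cutoff.
  rewrite normrM [X in _ * X]ger0_norm ?subr_ge0// ler_wpM2r ?subr_ge0//.
  by rewrite derive1_cutoff; exact: C'P.
exists (C + C'); first by move=> x; rewrite (le_trans (CP _))// lerDl.
move=> x y; apply: (@le_trans _ _ (C' * `|x - y|)); last by rewrite ler_wpM2r// lerDr.
have [xy|/ltW yx] := leP x y.
  by rewrite distrC [X in _ * X]distrC (ger0_norm (_ : 0 <= y - x)) ?subr_ge0// H.
by rewrite (ger0_norm (_ : 0 <= x - y)) ?subr_ge0// H.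
Qed.

(** The derivative of [cutoff 1], by [derive1_cutoff]. *)
Definition cutoff' := cutoff ('X^2 * (1 - 1^`())).

Lemma cutoff'_ge0 s : 0 <= cutoff' s.
Proof.
rewrite /cutoff' /cutoff; have [y0|y0] := leP (s - k) 0; first by rewrite flat_le0.
rewrite flat_gt0// derivC subr0 mulr1 hornerXn.
by rewrite mulr_ge0 ?expR_ge0// exprn_ge0// invr_ge0 ltW.
Qed.

(** The ratio of the test function to its derivative is small near [k]. *)
Lemma cutoffE s : cutoff 1 s = (s - k) ^+ 2 * cutoff' s.
Proof.
rewrite /cutoff' /cutoff; set y := s - k; have [y0|y0] := leP y 0.
  by rewrite !flat_le0// mulr0.
rewrite !flat_gt0// derivC subr0 mulr1 hornerXn hornerC mul1r mulrA -exprMn.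
by rewrite mulfV ?gt_eqF// expr1n mul1r.
Qed.

Lemma cutoff_ge0 s : 0 <= cutoff 1 s.
Proof. by rewrite cutoffE mulr_ge0 ?sqr_ge0// cutoff'_ge0. Qed.

End cutoff.

Section pairings.
Context (R : realType) (d : nat) (Omega : set 'rV[R]_d).
Local Notation mu := (lebesgue_rV R d).
Local Notation E := ('rV[R]_d -> R).
Local Notation Linf := (Lp_on mu Omega +oo%E).
Local Notation L1 chi := (mu.-integrable Omega (EFin \o chi)).
Hypotheses (d0 : (0 < d)%N) (mO : measurable Omega) (muO : (mu Omega < +oo)%E)
  (muT : (0 < mu [set: 'rV[R]_d])%E).
Variables (k M : R).
Hypotheses (k0 : 0 <= k) (kM : k <= M).
Variables (u : E) (G : 'I_d -> E).
Hypotheses (lu : L2 mu Omega u) (uG : is_weak_gradient Omega u G)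
  (u0 : le0_on_boundary Omega u)
  (uM : {ae mu, forall x, Omega x -> u x <= M}).

Let chi := fun x => cutoff k 1 (u x).
Let H := fun (i : 'I_d) x => cutoff' k (u x) * G i x.

Lemma cutoff_chain_rule : H10 Omega chi /\ is_weak_gradient Omega chi H.
Proof.
apply: (@chain_rule R d Omega mO muO (cutoff k 1) (cutoff' k)
  (cutoff k ('X^2 * (('X^2 * (1 - 1^`())) - ('X^2 * (1 - 1^`()))^`())))) => //;
  try exact: smooth_cutoff; try exact: derive1_cutoff; try exact: cutoff_bounded_lipschitz.
- by move=> x x0; rewrite /cutoff' !cutoff_le0// (le_trans x0).
- exact/Lp_on2P.
Qed.

Let mcomp p : measurable_fun Omega (fun x => cutoff k p (u x)).
Proof.
have [mu_ _] := lu; apply: measurableT_comp => //; apply: continuous_measurable_fun.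
exact: smooth_continuous (smooth_cutoff k p).
Qed.

Lemma bmf_cutoff p : bmf Omega (fun x => cutoff k p (u x)).
Proof.
by split; [exact: mcomp|have [K HK _] := cutoff_bounded_lipschitz k p; exists K => x _].
Qed.

Lemma integrable_cutoff : L1 chi.
Proof. by apply: bmf_integrable => //; exact: bmf_cutoff. Qed.

(** Where [chi] does not vanish, u is positive, so that c u >= - lam u >= - lam M. *)
Lemma reaction_ge (c : E) lam : 0 <= lam ->
  mu.-integrable Omega (fun x => (c x * u x * chi x)%:E) ->
  {ae mu, forall x, Omega x -> - lam <= c x} ->
  - (lam * M) * (\int[mu]_(x in Omega) chi x) <= inner Omega (fun x => c x * u x) chi.
Proof.
move=> lam0 ic cl; have ichi := integrable_cutoff.
rewrite -RintegralZl//; apply: le_Rintegral_ae => //.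
  exact: integrable_cmul.
apply: filterS2 cl uM => x cx ux Ox.
have [uk|ku] := leP (u x) k; first by rewrite /chi cutoff_le0// !mulr0.
rewrite ler_wpM2r ?cutoff_ge0//; have := cx Ox; have := ux Ox => uxM cxl.
have ux0 : 0 < u x by exact: le_lt_trans ku.
rewrite lerNl -mulNr; apply: (@le_trans _ _ (lam * u x)); last by rewrite ler_wpM2l.
by rewrite ler_wpM2r ?(ltW ux0)// lerNl.
Qed.

(** Integrate [energy_ge]; where [chi] does not vanish, (u - k)^2 <= (M - k)^2. *)
Lemma L_form_ge (a : 'rV[R]_d -> R -> 'M[R]_d) (b : 'rV[R]_d -> R -> 'rV[R]_d) t C :
  0 <= C -> (forall i j, Linf (fun x => a x t i j)) ->
  (forall i, Linf (fun x => b x t ord0 i)) ->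
  {ae mu, forall x, Omega x -> sym_pos_def (a x t)} ->
  {ae mu, forall x, Omega x ->
     \sum_(i < d) (b x t ord0 i) ^+ 2 <= 4 * min_eigenvalue (a x t) * C} ->
  - (C * (M - k) ^+ 2) * (\int[mu]_(x in Omega) chi x) <= L_form Omega a b t G H chi.
Proof.
move=> C0 la lb spd bC; have ichi := integrable_cutoff.
have lG i : L2 mu Omega (G i) by apply/Lp_on2P => //; have [] := uG.
have lH i : L2 mu Omega (H i) by apply: L2M => //; exact: bmf_cutoff.
have lchi : L2 mu Omega chi by apply: bmf_L2 => //; exact: bmf_cutoff.
have i1 i j : L1 (fun x => a x t i j * G j x * H i x).
  have := Linf_integrable mO muT (la i j) (L2_mul_integrable mO (lG j) (lH i)).
  by under eq_fun do rewrite mulrA.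
have i2 i : L1 (fun x => b x t ord0 i * G i x * chi x).
  have := Linf_integrable mO muT (lb i) (L2_mul_integrable mO (lG i) lchi).
  by under eq_fun do rewrite mulrA.
have isum n (f : 'I_n -> E) := @Rintegral_sum _ _ _ mu Omega n f mO.
have [j1 e1] := isum _ (fun i x => \sum_(j < d) a x t i j * G j x * H i x)
  (fun i => (isum _ _ (i1 i)).1).
have [j2 e2] := isum _ _ i2.
rewrite /L_form; under eq_bigr do rewrite -(isum _ _ (i1 _)).2.
rewrite -e1 -e2 -RintegralD// -RintegralZl//; apply: le_Rintegral_ae => //.
- exact: integrable_cmul.
- by apply: eq_integrable (integrableD mO j1 j2).
apply: filterS3 spd bC uM => x spdx bx ux Ox.
have := @energy_ge R d (a x t) (b x t) (\row_i G i x) C (u x - k) (cutoff' k (u x)) d0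
  (spdx Ox) (bx Ox) (cutoff'_ge0 k (u x)).
rewrite -cutoffE; under [X in _ <= X + _ -> _]eq_bigr do under eq_bigr do rewrite !mxE.
under [X in _ <= _ + X -> _]eq_bigr do rewrite mxE.
apply: le_trans; rewrite mulNr lerN2.
have [uk|ku] := leP (u x) k; first by rewrite /chi cutoff_le0// !mulr0.
apply: ler_wpM2r; first exact: cutoff_ge0.
rewrite ler_wpM2l// lerXn2r ?nnegrE ?subr_ge0 ?(ltW ku)// lerD2r.
exact: ux.
Qed.

End pairings.

(** * No positive maximum *)

Section small.
Context (R : realType).

Lemma exists_small n (Q : 'I_n -> R -> Prop) :
  (forall i, exists2 e, 0 < e & forall r, 0 < r -> r <= e -> Q i r) ->
  exists2 e, 0 < e & forall r, 0 < r -> r <= e -> forall i, Q i r.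
Proof.
move=> H; have /choice[e eP] : forall i, exists e, 0 < e /\ forall r, 0 < r -> r <= e -> Q i r.
  by move=> i; have [e e0 eQ] := H i; exists e.
have S0 : 0 < \sum_(i < n) (e i)^-1 + 1.
  by rewrite ltr_wpDl// sumr_ge0// => i _; rewrite invr_ge0 ltW//; have [] := eP i.
(* A number below every e i, positive also when n = 0. *)
exists (\sum_(i < n) (e i)^-1 + 1)^-1; first by rewrite invr_gt0.
move=> r r0 re i; have [e0] := eP i; apply => //; apply: (le_trans re).
rewrite -[leRHS]invrK lef_pV2 ?posrE ?invr_gt0// (bigD1 i)//= -addrA lerDl.
by rewrite addr_ge0// sumr_ge0// => j _; rewrite invr_ge0 ltW//; have [] := eP j.
Qed.

Lemma powR_small (beta y : R) : 0 < beta -> 0 < y ->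
  exists2 e, 0 < e & forall r, 0 < r -> r <= e -> r `^ beta <= y.
Proof.
move=> b0 y0; exists (y `^ beta^-1); first exact: powR_gt0.
move=> r r0 re; rewrite -[leRHS](powRr1 (ltW y0)) -(mulVf (lt0r_neq0 b0)) powRrM.
by apply: ge0_ler_powR => //; rewrite ?nnegrE ?powR_ge0//; exact: ltW.
Qed.

End small.

Section positive_maximum.
Context (R : realType) (d : nat) (Omega : set 'rV[R]_d).
Local Notation mu := (lebesgue_rV R d).
Local Notation E := ('rV[R]_d -> R).
Local Notation Linf := (Lp_on mu Omega +oo%E).
Local Notation "'N f" := (Lnorm_on mu Omega +oo%E f%R) (at level 10, f at level 8).
Local Notation P := (pairing mu Omega).
Hypotheses (d0 : (0 < d)%N) (mO : measurable Omega) (muO : (mu Omega < +oo)%E)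
  (muT : (0 < mu [set: 'rV[R]_d])%E).

Lemma integral_cutoff_gt0 k (v : E) : L2 mu Omega v ->
  ~ {ae mu, forall x, Omega x -> v x <= k} ->
  0 < \int[mu]_(x in Omega) cutoff k 1 (v x).
Proof.
move=> lv nv; have iv := integrable_cutoff mO muO k lv.
rewrite lt_neqAle Rintegral_ge0 ?andbT; last by move=> x _; exact: cutoff_ge0.
apply/eqP => /esym I0; apply: nv.
have mv : measurable_fun Omega (fun x => (cutoff k 1 (v x))%:E) by exact: measurable_int iv.
have /(ae_eq_integral_abs mu mO mv) : (\int[mu]_(x in Omega) `|(cutoff k 1 (v x))%:E| = 0)%E.
  under eq_integral do rewrite /= ger0_norm ?cutoff_ge0//.
  by rewrite -[LHS]fineK ?integrable_fin_num//; congr EFin.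
apply: filterS => x H Ox; have := H Ox => -[vx].
rewrite leNgt; apply/negP => kv; move: vx; rewrite /cutoff => /eqP.
by rewrite gt_eqF// flat1_gt0// subr_gt0.
Qed.

Variables (l : nat) (alpha q : 'I_l -> R) (Cq lam t : R).
Hypotheses (alpha01 : forall i, 0 < alpha i < 1) (q0 : forall i, 0 <= q i)
  (Cq0 : 0 < Cq) (qC : Cq <= \sum_(i < l) q i) (lam0 : 0 <= lam) (t0 : 0 < t).
Variables (a : 'rV[R]_d -> R -> 'M[R]_d) (b : 'rV[R]_d -> R -> 'rV[R]_d) (c : E) (C : R).
Hypotheses (C0 : 0 <= C) (la : forall i j, Linf (fun x => a x t i j))
  (lb : forall i, Linf (fun x => b x t ord0 i))
  (spd : {ae mu, forall x, Omega x -> sym_pos_def (a x t)})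
  (bC : {ae mu, forall x, Omega x ->
     \sum_(i < d) (b x t ord0 i) ^+ 2 <= 4 * min_eigenvalue (a x t) * C})
  (cl : {ae mu, forall x, Omega x -> - lam <= c x}).
Variable u : R -> E.
Hypotheses (lu : forall s, 0 <= s <= t -> Linf (u s))
  (cu : forall s, 0 <= s <= t -> forall eps, 0 < eps -> exists2 delta, 0 < delta &
     forall r, 0 <= r <= t -> `|s - r| < delta -> ('N (u s \- u r) <= eps%:E)%E)
  (Wu : forall eps, 0 < eps < t -> W1inf_Linf Omega eps t u)
  (u_bdry : le0_on_boundary Omega (u t)) (u_H1 : H1 Omega (u t))
  (cu_pairing : forall chi, H10 Omega chi ->
     {ae mu, forall x, Omega x -> 0 <= chi x} ->
     mu.-integrable Omega (fun x => (c x * u t x * chi x)%:E))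
  (u_weak : forall chi, H10 Omega chi ->
     {ae mu, forall x, Omega x -> 0 <= chi x} ->
     forall (Du : 'I_l -> E) (G H : 'I_d -> E),
       (forall i, is_Caputo Omega (alpha i) u t (Du i)) ->
       is_weak_gradient Omega (u t) G -> is_weak_gradient Omega chi H ->
       inner Omega (fun x => \sum_(i < l) q i * Du i x) chi
         + L_form Omega a b t G H chi + inner Omega (fun x => c x * u t x) chi <= 0).

(** With a test function concentrated where [u] is close to its maximum [M],
reached shortly after times at which [u] is much smaller, the fractional
derivative term is at least (lam + 1) M times the integral of the test
function; it outweighs the reaction term, at least - lam M, and the elliptic
term, which is negligible. *)
Lemma no_positive_maximum tau s0 M : 0 < tau ->
  (forall i, 2 * (lam + 1) / Cq <= (Gamma (1 - alpha i))^-1 * tau `^ (- alpha i)) ->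
  0 < s0 -> s0 < t -> t - s0 <= tau -> 0 < M ->
  (forall s, 0 <= s <= s0 -> {ae mu, forall x, Omega x -> u s x <= M / 4}) ->
  (forall s, 0 <= s <= t -> {ae mu, forall x, Omega x -> u s x <= M}) ->
  exists2 k, 0 <= k < M & {ae mu, forall x, Omega x -> u t x <= k}.
Proof.
move=> tau0 tauP s00 s0t s0tau M0 uM4 uM.
have [L L0 LP] := Caputo_lower_bound mO muO muT t0 lu cu Wu.
have /choice[W WP] := fun i => LP _ (alpha01 i).
have tt : 0 <= t <= t by rewrite lexx ltW.
have [lu2 [G uG]] := u_H1.
have {}lu2 : L2 mu Omega (u t) by apply/Lp_on2P.
have M16 : 0 < M / 16 by rewrite divr_gt0.
have Tt0 i : 0 < tau `^ (- alpha i) by exact: powR_gt0.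
(* During the last lapse of time r, the singular integral and the variation of
   u, controlled by the bound L of the time derivative, are negligible. *)
have [r [r0 rt2 s0r Lr rP]] : exists r, [/\ 0 < r, r < t / 2, s0 < t - r, L * r <= M / 16 &
    forall i, L * r `^ (1 - alpha i) + L * (r `^ (1 - alpha i) / (1 - alpha i)) <=
      tau `^ (- alpha i) * (M / 16)].
  have [e e0 eP] : exists2 e, 0 < e & forall r, 0 < r -> r <= e -> forall i,
      L * r `^ (1 - alpha i) + L * (r `^ (1 - alpha i) / (1 - alpha i)) <=
      tau `^ (- alpha i) * (M / 16).
    apply: exists_small => i; have /andP[al0 al1] := alpha01 i.
    have a10 : 0 < 1 - alpha i by rewrite subr_gt0.
    pose K := L + L / (1 - alpha i) + 1.
    have K0 : 0 < K by rewrite ltr_wpDl// addr_ge0// divr_ge0// ltW.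
    have [e e0 eP] := powR_small a10 (divr_gt0 (mulr_gt0 (Tt0 i) M16) K0).
    exists e => // r r0 re; have := eP r r0 re; rewrite ler_pdivlMr//; apply: le_trans.
    have -> : L * r `^ (1 - alpha i) + L * (r `^ (1 - alpha i) / (1 - alpha i)) =
      r `^ (1 - alpha i) * (L + L / (1 - alpha i)) by ring.
    by rewrite ler_wpM2l ?powR_ge0// lerDl.
  have L1 : 0 < L + 1 by rewrite ltr_wpDl.
  have ts0 : 0 < t - s0 by rewrite subr_gt0.
  pose r := Num.min (Num.min e (t / 4)) (Num.min ((t - s0) / 2) (M / 16 / (L + 1))).
  have r0 : 0 < r by rewrite !lt_min e0 !divr_gt0.
  have re : r <= e by rewrite /r !ge_min lexx.
  have r4 : r <= t / 4 by rewrite /r !ge_min lexx orbT.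
  have rs : r <= (t - s0) / 2 by rewrite /r !ge_min lexx !orbT.
  have rM : r <= M / 16 / (L + 1) by rewrite /r !ge_min lexx !orbT.
  exists r; split => //.
  - by apply: (le_lt_trans r4); lra.
  - lra.
  - rewrite mulrC; move: rM; rewrite ler_pdivlMr//; apply: le_trans.
    by rewrite ler_wpM2l ?(ltW r0)// lerDl.
  - exact: eP.
(* The test function lives where u > M - de. *)
have [de [de0 deM deC deP]] : exists de, [/\ 0 < de, de <= M / 16, C * de ^+ 2 < M &
    forall i, r `^ (- alpha i) * de <= tau `^ (- alpha i) * (M / 16)].
  have [e e0 eP] : exists2 e, 0 < e & forall de, 0 < de -> de <= e -> forall i,
      r `^ (- alpha i) * de <= tau `^ (- alpha i) * (M / 16).
    apply: exists_small => i.
    have ra0 : 0 < r `^ (- alpha i) by exact: powR_gt0.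
    exists (tau `^ (- alpha i) * (M / 16) / r `^ (- alpha i)).
      by rewrite divr_gt0// mulr_gt0.
    by move=> x x0; rewrite ler_pdivlMr// mulrC.
  have C1 : 0 < C + 1 by rewrite ltr_wpDl.
  pose de := Num.min (Num.min e (M / 16)) (Num.min 1 (M / (C + 1))).
  have de0 : 0 < de by rewrite !lt_min e0 M16 ltr01 divr_gt0.
  have dee : de <= e by rewrite /de !ge_min lexx.
  have deM : de <= M / 16 by rewrite /de !ge_min lexx orbT.
  have de1 : de <= 1 by rewrite /de !ge_min lexx !orbT.
  have deC : de <= M / (C + 1) by rewrite /de !ge_min lexx !orbT.
  exists de; split => //; last exact: eP.
  move: deC; rewrite ler_pdivlMr// => deC; apply: lt_le_trans deC.
  apply: (@le_lt_trans _ _ (de * C)); last by rewrite ltr_pM2l// ltrDl.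
  by rewrite expr2 mulrA (mulrC C) ler_piMr// mulr_ge0// ltW.
pose k := M - de.
have k0 : 0 <= k by rewrite subr_ge0; lra.
have kM : k < M by rewrite ltrBlDr ltrDl.
exists k; first by rewrite k0.
apply: contrapT => nu; pose chi x := cutoff k 1 (u t x).
have X0 : 0 < \int[mu]_(x in Omega) chi x by exact: integral_cutoff_gt0.
set X := \int[mu]_(x in Omega) chi x in X0.
have chi0 x : 0 <= chi x by exact: cutoff_ge0.
have ichi : mu.-integrable Omega (EFin \o chi) by exact: integrable_cutoff.
have [Hchi Gchi] := cutoff_chain_rule mO muO k0 lu2 uG u_bdry.
have aechi : {ae mu, forall x, Omega x -> 0 <= chi x} by apply: aeW.
have kX : k * X <= P (u t) chi.
  rewrite -RintegralZl//; apply: le_Rintegral => //.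
  - exact: integrable_cmul.
  - by apply: Linf_integrable => //; exact: lu.
  - move=> x Ox; have [uk|/ltW ku] := leP (u t x) k; first by rewrite /chi cutoff_le0// !mulr0.
    by rewrite ler_wpM2r.
(* The truncated kernel contributes at least 5/8 M, since
   k - L r - M / 4 >= (1 - 1/16 - 1/16 - 1/4) M, and the errors are at most
   1/16 M + 1/16 M. *)
have caputo i : (Gamma (1 - alpha i))^-1 * (tau `^ (- alpha i) * (M / 2) * X) <= P (W i) chi.
  have /andP[al0 al1] := alpha01 i; have [_ Wi] := WP i.
  have := Wi _ ichi chi0 s0 r (M / 4) M k s00 r0 rt2 s0r (ltW kM) uM4 uM kX.
  apply: le_trans; have G0 : 0 < Gamma (1 - alpha i).
    by rewrite Gamma_gt0 ?subr_gt0// lerBlDr lerDl ltW.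
  rewrite ler_wpM2l ?invr_ge0 ?(ltW G0)// ler_wpM2r ?(ltW X0)//.
  have A : tau `^ (- alpha i) <= (t - s0) `^ (- alpha i).
    rewrite !powRN lef_pV2 ?posrE ?powR_gt0 ?subr_gt0//.
    by apply: ge0_ler_powR => //; rewrite ?nnegrE ?subr_ge0; exact: ltW.
  have H1 : tau `^ (- alpha i) * (M * 5 / 8) <= (t - s0) `^ (- alpha i) * (k - L * r - M / 4).
    by apply: ler_pM => //; rewrite ?(ltW (Tt0 i))//; rewrite /k; lra.
  have H2 : r `^ (- alpha i) * (M - (k - L * r)) =
      r `^ (- alpha i) * de + L * r `^ (1 - alpha i).
    have -> : r `^ (1 - alpha i) = r `^ (- alpha i) * r.
      have := powR_exp_gt0 (1 - alpha i) r0; rewrite addrAC subrr add0r => <-.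
      by rewrite divfK// gt_eqF.
    by rewrite /k; ring.
  have := deP i; have := rP i; rewrite H2; move: H1.
  set p1 := tau `^ _; set p2 := (t - s0) `^ _; lra.
have caputo_sum : (lam + 1) * M * X <= inner Omega (fun x => \sum_(i < l) q i * W i x) chi.
  have lW i : Linf (W i) by have [[]] := WP i.
  rewrite /inner; under eq_Rintegral do rewrite mulr_suml.
  rewrite (Rintegral_sum mO _).2; last first.
    move=> i; apply: (@Linf_integrable _ _ _ mu Omega mO muT (fun x => q i * W i x)) => //.
    exact: LinfZ.
  apply: (@le_trans _ _ (\sum_(i < l) q i * ((lam + 1) / Cq * M * X))).
    rewrite -mulr_suml; have -> : (lam + 1) * M * X = Cq * ((lam + 1) / Cq * M * X).
      by field; rewrite gt_eqF.
    by rewrite ler_wpM2r// !mulr_ge0// ?invr_ge0 ?addr_ge0// ltW.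
  apply: ler_sum => i _; rewrite -[leRHS]/(P (fun x => q i * W i x) chi) pairingZl//.
  apply: ler_wpM2l => //; apply: le_trans (caputo i).
  have := tauP i; move=> /(ler_wpM2r (ltW (mulr_gt0 (divr_gt0 M0 (ltr0n R 2)) X0))).
  have -> : 2 * (lam + 1) / Cq * (M / 2 * X) = (lam + 1) / Cq * M * X.
    by field; rewrite gt_eqF.
  by move=> /le_trans; apply; rewrite -!mulrA.
have react := reaction_ge mO muO k0 lu2 (uM _ tt) lam0 (cu_pairing Hchi aechi) cl.
have ellip := L_form_ge d0 mO muO muT (ltW kM) lu2 uG (uM _ tt) C0 la lb spd bC.
have := u_weak Hchi aechi (fun i => (WP i).1) uG Gchi.
have MCd : M - k = de by rewrite /k; ring.
move: react ellip caputo_sum; rewrite MCd -/chi -/X => react ellip caputo_sum.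
rewrite leNgt => /negP; apply.
have : 0 < (M - C * de ^+ 2) * X by rewrite mulr_gt0// subr_gt0.
move: react ellip caputo_sum; set x1 := inner _ _ _; set x2 := L_form _ _ _ _ _ _ _.
set x3 := inner _ _ _; rewrite !mulrDl mul1r !mulNr; lra.
Qed.

End positive_maximum.

Section supremum.
Context (R : realType) (d : nat) (Omega : set 'rV[R]_d).
Local Notation mu := (lebesgue_rV R d).
Local Notation E := ('rV[R]_d -> R).
Local Notation Linf := (Lp_on mu Omega +oo%E).
Local Notation "'N f" := (Lnorm_on mu Omega +oo%E f%R) (at level 10, f at level 8).
Hypotheses (mO : measurable Omega) (muT : (0 < mu [set: 'rV[R]_d])%E).

(** Unlike the essential supremum, it is finite, even if [Omega] is negligible. *)
Definition sup_pos (f : E) : R := fine ('N (fun x => Num.max 0 (f x))).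

Lemma sup_pos_ge0 f : 0 <= sup_pos f.
Proof. by rewrite fine_ge0// Lnorm_ge0. Qed.

Lemma sup_pos_leP f M : Linf f -> 0 <= M ->
  (sup_pos f <= M) <-> {ae mu, forall x, Omega x -> f x <= M}.
Proof.
move=> lf M0; have [K K0 /(Lnorm_on_leP muT _ _ K0) fK] := Linf_bound lf.
have NK : ('N (fun x => Num.max 0 (f x)) <= K%:E)%E.
  apply/(Lnorm_on_leP muT _ _ K0); apply: filterS fK => x fx Ox.
  by rewrite ger0_norm ?le_max ?lexx// ge_max K0 (le_trans (ler_norm _)) ?fx.
have Nfin : 'N (fun x => Num.max 0 (f x)) \is a fin_num.
  by rewrite ge0_fin_numE ?Lnorm_ge0// (le_lt_trans NK)// ltry.
rewrite -lee_fin fineK//; split.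
  move=> /(Lnorm_on_leP muT _ _ M0); apply: filterS => x H Ox.
  by have := H Ox; rewrite ger0_norm ?le_max ?lexx// ge_max => /andP[].
move=> H; apply/(Lnorm_on_leP muT _ _ M0); apply: filterS H => x H Ox.
by rewrite ger0_norm ?le_max ?lexx// ge_max M0 H.
Qed.

Lemma sup_pos_lipschitz f g e : Linf f -> Linf g -> 0 <= e ->
  ('N (f \- g) <= e%:E)%E -> `|sup_pos f - sup_pos g| <= e.
Proof.
have H f' g' : Linf f' -> Linf g' -> 0 <= e -> ('N (f' \- g') <= e%:E)%E ->
    sup_pos f' <= sup_pos g' + e.
  move=> lf lg e0 /(Lnorm_on_leP muT _ _ e0) fg; have g0 := sup_pos_ge0 g'.
  apply/sup_pos_leP => //; first exact: addr_ge0.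
  have /(sup_pos_leP lg g0) := lexx (sup_pos g').
  apply: filterS2 fg => x fgx gx Ox; have := fgx Ox; have := gx Ox => /= gx'.
  move=> /(le_trans (ler_norm _)); rewrite lerBlDr addrC => /le_trans; apply.
  by rewrite lerD2r.
move=> lf lg e0 fg; rewrite ler_norml; apply/andP; split.
  by rewrite lerNl opprB lerBlDr addrC H// Lnorm_onC.
by rewrite lerBlDr addrC H.
Qed.

End supremum.

Theorem mainTheorem7 (R : realType) (T : R) (T_gt0 : 0 < T)
  (l : nat) (l_gt0 : (0 < l)%N)
  (alpha : 'I_l -> R) (alpha01 : forall i, 0 < alpha i < 1)
  (alpha_decr : forall i j : 'I_l, (i < j)%N -> alpha j < alpha i)
  (q : 'I_l -> R -> R) (Cq : R) (Cq_gt0 : 0 < Cq)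
  (q_ge0 : forall (i : 'I_l) (t : R), 0 <= t <= T -> 0 <= q i t)
  (q_sum : forall t : R, 0 <= t <= T -> Cq <= \sum_(i < l) q i t)
  (d : nat) (d123 : (0 < d <= 3)%N)
  (Omega : set 'rV[R]_d) (OmegaL : bounded_Lipschitz_domain Omega)
  (a : 'rV[R]_d -> R -> 'M[R]_d) (b : 'rV[R]_d -> R -> 'rV[R]_d)
  (c : 'rV[R]_d -> R -> R) (lam : R) (lam_ge0 : 0 <= lam)
  (a_Linf : forall i j, Linf_cylinder Omega T (fun x t => a x t i j))
  (b_Linf : forall i, Linf_cylinder Omega T (fun x t => b x t ord0 i))
  (CL_fin : (CL Omega T a b < +oo)%E)
  (c_inf : ((- lam)%:E <= ess_inf_on (cylinder_measure R d) (cylinder Omega T)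
                            (fun p => c p.1 p.2))%E)
  (at_Linf : forall t : R, 0 < t <= T -> forall i j,
     Lp_on (lebesgue_rV R d) Omega +oo%E (fun x => a x t i j))
  (bt_Linf : forall t : R, 0 < t <= T -> forall i,
     Lp_on (lebesgue_rV R d) Omega +oo%E (fun x => b x t ord0 i))
  (at_spd : forall t : R, 0 < t <= T ->
     {ae lebesgue_rV R d, forall x, Omega x -> sym_pos_def (a x t)})
  (bt_CL : forall t : R, 0 < t <= T ->
     {ae lebesgue_rV R d, forall x, Omega x ->
        \sum_(i < d) (b x t ord0 i) ^+ 2
          <= 4 * min_eigenvalue (a x t) * fine (CL Omega T a b)})
  (ct_inf : forall t : R, 0 < t <= T ->
     {ae lebesgue_rV R d, forall x, Omega x -> - lam <= c x t})
  (u : R -> 'rV[R]_d -> R)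
  (u_init : {ae lebesgue_rV R d, forall x, Omega x -> u 0 x <= 0})
  (u_bdry : forall t : R, 0 <= t <= T -> le0_on_boundary Omega (u t))
  (u_cont : C_Linf Omega T u)
  (u_W1inf : forall eps t : R, 0 < eps -> eps < t -> t <= T ->
     W1inf_Linf Omega eps t u)
  (u_H1 : forall t : R, 0 < t <= T -> H1 Omega (u t))
  (cu_pairing : forall (t : R) (chi : 'rV[R]_d -> R), 0 < t <= T -> H10 Omega chi ->
     {ae lebesgue_rV R d, forall x, Omega x -> 0 <= chi x} ->
     (lebesgue_rV R d).-integrable Omega (fun x => (c x t * u t x * chi x)%:E))
  (u_weak : forall (t : R) (chi : 'rV[R]_d -> R), 0 < t <= T -> H10 Omega chi ->
     {ae lebesgue_rV R d, forall x, Omega x -> 0 <= chi x} ->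
     forall (Du : 'I_l -> 'rV[R]_d -> R) (G H : 'I_d -> 'rV[R]_d -> R),
       (forall i, is_Caputo Omega (alpha i) u t (Du i)) ->
       is_weak_gradient Omega (u t) G -> is_weak_gradient Omega chi H ->
       inner Omega (fun x => \sum_(i < l) q i t * Du i x) chi
         + L_form Omega a b t G H chi
         + inner Omega (fun x => c x t * u t x) chi <= 0) :
  forall t : R, 0 <= t <= T ->
    (ess_sup_on (lebesgue_rV R d) Omega (u t) <= 0)%E.
Proof.
have [d0 _] := andP d123.
have [oO _ _ bO _] := OmegaL.
have mO : measurable Omega := open_measurable_rV oO.
have muO : (lebesgue_rV R d Omega < +oo)%E := bounded_lebesgue_lty mO bO.
have muT : (0 < lebesgue_rV R d setT)%E := lebesgue_rV_setT_gt0 R d.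
have [lu u_c] := u_cont.
have cu s : 0 <= s <= T -> forall eps, 0 < eps -> exists2 delta, 0 < delta &
    forall r, 0 <= r <= T -> `|s - r| < delta ->
      (Lnorm_on (lebesgue_rV R d) Omega +oo%E (u s \- u r)%R <= eps%:E)%E.
  move=> sT eps e0; have := cvge0_le (u_c s sT) e0.
  move=> [delta /= delta0 dP]; exists delta => // r rT sr.
  by rewrite Lnorm_onC; exact: dP.
pose S t := sup_pos Omega (u t).
have S0 t : 0 <= S t by exact: sup_pos_ge0.
have S_le t M : 0 <= t <= T -> 0 <= M ->
    (S t <= M) <-> {ae lebesgue_rV R d, forall x, Omega x -> u t x <= M}.
  by move=> tT M0; apply: sup_pos_leP => //; exact: lu.
have S_near s : 0 <= s <= T -> forall eps, 0 < eps -> exists2 delta, 0 < delta &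
    forall r, 0 <= r <= T -> `|s - r| < delta -> `|S s - S r| <= eps.
  move=> sT eps e0; have [delta delta0 dP] := cu s sT eps e0.
  exists delta => // r rT sr; apply: sup_pos_lipschitz => //; try exact: lu.
    exact: ltW.
  exact: dP.
have S00 : S 0 <= 0 by apply/S_le => //; rewrite lexx ltW.
have [tau tau0 tauP] : exists2 tau, 0 < tau & forall i,
    2 * (lam + 1) / Cq <= (Gamma (1 - alpha i))^-1 * tau `^ (- alpha i).
  have [e e0 eP] : exists2 e, 0 < e & forall r, 0 < r -> r <= e -> forall i,
      2 * (lam + 1) / Cq <= (Gamma (1 - alpha i))^-1 * r `^ (- alpha i).
    apply: exists_small => i; have /andP[al0 al1] := alpha01 i.
    have G0 : 0 < Gamma (1 - alpha i).
      by rewrite Gamma_gt0 ?subr_gt0// lerBlDr lerDl ltW.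
    pose B := 2 * (lam + 1) / Cq.
    have B0 : 0 < B by rewrite divr_gt0// mulr_gt0// ltr_wpDl.
    have BG0 : 0 < (B * Gamma (1 - alpha i))^-1 by rewrite invr_gt0 mulr_gt0.
    have [e e0 eP] := powR_small al0 BG0.
    exists e => // r r0 re; rewrite -/B mulrC ler_pdivlMr// powRN.
    have ra0 : 0 < r `^ alpha i by exact: powR_gt0.
    by rewrite -[leLHS]invrK lef_pV2 ?posrE//; exact: eP.
  by exists e => // i; exact: eP.
(* Induction over time intervals of length tau. *)
suff step s : 0 <= s -> (forall r, 0 <= r <= T -> r <= s -> S r <= 0) ->
    forall r, 0 <= r <= T -> r <= s + tau -> S r <= 0.
  have H n : forall r, 0 <= r <= T -> r <= n%:R * tau -> S r <= 0.
    elim: n => [|n IH] r rT rn.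
      suff -> : r = 0 by [].
      by apply/eqP; rewrite eq_le; case/andP : rT => -> _; rewrite andbT -(mul0r tau).
    apply: (step (n%:R * tau)) => //; first by rewrite mulr_ge0// ltW.
    by rewrite -[X in _ + X]mul1r -mulrDl natr1.
  move=> t tT; apply/ess_supP.
  have /(S_le t 0 tT (lexx 0)) : S t <= 0.
    apply: (H (Num.truncn (t / tau)).+1) => //.
    have /truncn_itv/andP[_ tn] : 0 <= t / tau by rewrite divr_ge0 ?(ltW tau0)//; case/andP : tT.
    by rewrite -ler_pdivrMr// ltW.
  apply: filterS => x ux; case: ifPn => [/set_mem Ox|_]; last exact: leNye.
  by rewrite lee_fin ux.
move=> s0 Ss t1 t1T t1s; rewrite leNgt; apply/negP => St1.
have [t10 t1T'] := andP t1T.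
have cS : {within `[0, t1], continuous S}.
  apply/subspace_continuousP => s'; rewrite /= in_itv/= => s't.
  have s'T : 0 <= s' <= T by case/andP : s't => -> /= /le_trans; apply.
  apply/cvgrPdist_le => e e0; have [delta delta0 dP] := S_near s' s'T e e0.
  exists delta => //= r sr; rewrite in_itv/= => rt; apply: dP => //.
  by case/andP : rt => -> /= /le_trans; apply.
(* A time t at which the maximum over [0, t1] is reached. *)
have [t] := EVT_max t10 cS; rewrite in_itv/= => /andP[t0 tt1] tP.
have tT : 0 <= t <= T by rewrite t0 (le_trans tt1).
pose M := S t; have M0 : 0 < M.
  by apply: (lt_le_trans St1); apply: tP; rewrite in_itv/= t10 lexx.
have st : s < t.
  by rewrite ltNge; apply/negP => ts; have := Ss t tT ts; rewrite leNgt M0.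
have t0' : 0 < t by exact: le_lt_trans st.
have sT : 0 <= s <= T by rewrite s0 (le_trans (ltW st))//; case/andP : tT.
have M4 : 0 < M / 4 by rewrite divr_gt0.
have [delta delta0 dP] := S_near s sT _ M4.
(* S <= M / 4 up to time s1, and s < s1 < t. *)
pose s1 := Num.min (s + delta / 2) ((s + t) / 2).
have ss1 : s < s1 by rewrite lt_min ltrDl divr_gt0//=; lra.
have s1t : s1 < t by rewrite gt_min; apply/orP; right; lra.
have inT r : 0 <= r <= t -> 0 <= r <= T.
  by case/andP => -> /= /le_trans; apply; case/andP : tT.
have SM r : 0 <= r <= t -> S r <= M.
  by case/andP => r0 rt; apply: tP; rewrite in_itv/= r0 (le_trans rt).
have SM4 r : 0 <= r <= s1 -> S r <= M / 4.
  case/andP => r0 rs1; have rT : 0 <= r <= T.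
    by apply: inT; rewrite r0 (le_trans rs1)// ltW.
  have [rs|sr] := leP r s; first by rewrite (le_trans (Ss r rT rs))// ltW.
  have : `|S s - S r| <= M / 4.
    apply: dP => //; rewrite distrC ger0_norm ?subr_ge0 ?(ltW sr)//.
    have : s1 <= s + delta / 2 by rewrite ge_min lexx.
    lra.
  have := Ss s sT (lexx s); rewrite ler_norml => Ss0 /andP[]; lra.
have tpos : 0 < t <= T by rewrite t0'; case/andP : tT.
(* The real value of an extended real number that may be -oo is made
   nonnegative. *)
pose C := Num.max 0 (fine (CL Omega T a b)).
have C0 : 0 <= C by rewrite le_max lexx.
have bC : {ae lebesgue_rV R d, forall x, Omega x ->
    \sum_(i < d) (b x t ord0 i) ^+ 2 <= 4 * min_eigenvalue (a x t) * C}.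
  apply: filterS2 (at_spd t tpos) (bt_CL t tpos) => x spdx bx Ox.
  have [m0 _] := Rayleigh d0 (spdx Ox); apply: (le_trans (bx Ox)).
  by rewrite ler_wpM2l ?le_max ?lexx ?orbT// mulr_ge0// ltW.
have cut r : 0 <= r <= t -> forall eps, 0 < eps -> exists2 delta, 0 < delta &
    forall r', 0 <= r' <= t -> `|r - r'| < delta ->
      (Lnorm_on (lebesgue_rV R d) Omega +oo%E (u r \- u r')%R <= eps%:E)%E.
  move=> rt eps e0; have [de de0 deP] := cu r (inT r rt) eps e0.
  by exists de => // r' r't; apply: deP; exact: inT.
have Wut eps : 0 < eps < t -> W1inf_Linf Omega eps t u.
  by move=> /andP[e0 et]; apply: u_W1inf => //; case/andP : tT.
have s10 : 0 < s1 by exact: le_lt_trans ss1.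
have ts1 : t - s1 <= tau by have := le_trans tt1 t1s; lra.
have uM4 r : 0 <= r <= s1 -> {ae lebesgue_rV R d, forall x, Omega x -> u r x <= M / 4}.
  move=> rs1; apply/S_le; [|exact: ltW|exact: SM4].
  by apply: inT; case/andP : rs1 => -> /= /le_trans; apply; exact: ltW.
have uM r : 0 <= r <= t -> {ae lebesgue_rV R d, forall x, Omega x -> u r x <= M}.
  by move=> rt; apply/S_le; [exact: inT|exact: ltW|exact: SM].
have [k /andP[k0 kM]] := no_positive_maximum d0 mO muO muT alpha01
  (fun i => q_ge0 i t tT) Cq_gt0 (q_sum t tT) lam_ge0 t0' C0 (at_Linf t tpos)
  (bt_Linf t tpos) (at_spd t tpos) bC (ct_inf t tpos) (fun r rt => lu r (inT r rt))
  cut Wut (u_bdry t tT) (u_H1 t tpos) (fun chi => cu_pairing t chi tpos)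
  (fun chi => u_weak t chi tpos) tau0 tauP s10 s1t ts1 M0 uM4 uM.
by move=> /(S_le t k tT k0); rewrite leNgt => /negP; apply.
Qed.
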